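(* The assignments $(Y,X)\mapsto \operatorname{Ext}(X,Y)$, $(Y,X)\mapsto \mathcal Q(X,Y)$ and $(Y,X)\mapsto \operatorname{Ext}^{\varpi}(X,Y)$, regarded as functors from the category $\mathbf{Q}\times\mathbf{Q}^{\mathrm{op}}$ (covariant in $Y$, contravariant in $X$) to the category $\mathbf{Q}_{1/2}$ of semi quasi-Banach spaces and continuous linear maps, each space carrying its own semi-quasi-norm $\varrho([\cdot])$, $Q([\cdot])$ and $|[\cdot]|_{\varpi}$ respectively, are naturally equivalent.
   Context: Scalars are real or complex (the same field $\mathbb K$ throughout). A semi-quasi-norm on a linear space $X$ is a function $\varrho:X\to[0,\infty)$ with $\varrho(\lambda x)=|\lambda|\varrho(x)$ and $\varrho(x+y)\le\Delta(\varrho(x)+\varrho(y))$ for some constant $\Delta$ and all $x,y\in X$ and scalars $\lambda$; it induces the least linear topology for which $\{\varrho\le1\}$ is a neighborhood of $0$. A semi quasi-Banach space is a complete semi-quasi-normed space (not necessarily Hausdorff). If $\varrho(x)=0$ implies $x=0$, $\varrho$ is a quasi-norm; a quasi-Banach space is a complete quasi-normed space. $\mathbf{Q}$ is the category of quasi-Banach spaces and operators (continuous linear maps). $\mathfrak L(X,Y)$ is the space of operators $X\to Y$ with the quasi-norm $\|u\|=\sup_{\|x\|\le1}\|u(x)\|$. For $p\in(0,1]$, a quasi-Banach space is $p$-normable if it has an equivalent quasi-norm satisfying $\|x+y\|^p\le\|x\|^p+\|y\|^p$; by the Aoki-Rolewicz theorem every quasi-Banach space is $p$-normable for some $p\in(0,1]$.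 The space $\mathcal Q(X,Y)$. A map $F:X\to Y$ is homogeneous if $F(\lambda x)=\lambda F(x)$ for all scalars $\lambda$; a homogeneous map is bounded if $\|F\|:=\sup_{\|x\|\le1}\|F(x)\|<\infty$. A map $F:X\to Y$ is quasilinear if it is homogeneous and $\|F(x+y)-F(x)-F(y)\|_Y\le Q(\|x\|_X+\|y\|_X)$ for some constant $Q$ and all $x,y\in X$; the least such $Q$ is $Q(F)$. $F$ is trivial if it is the sum of a linear (possibly discontinuous) map and a bounded homogeneous map. Two quasilinear maps are equivalent if their difference is trivial. $\mathcal Q(X,Y)$ is the linear space of quasilinear maps $X\to Y$ modulo equivalence, with $Q([F])=\inf\{Q(G):G\text{ is equivalent to }F\}$. Operators $\gamma:X'\to X$ and $\beta:Y\to Y'$ act by $[F]\mapsto[\beta\circ F\circ\gamma]$. The space $\operatorname{Ext}(X,Y)$. An extension of $X$ by $Y$ is a short exact sequence $0\to Y\xrightarrow{\imath}Z\xrightarrow{\pi}X\to0$ of quasi-Banach spaces and operators. Two extensions of $X$ by $Y$ with middle spaces $Z$, $Z'$ are equivalent if there is an operator $t:Z\to Z'$ commuting with the identities of $Y$ and $X$. $\operatorname{Ext}(X,Y)$ is the set of extensions modulo equivalence, with its usual linear structure (Baer sum, with scalar multiplication by push-out along scalar multiples of the identity of $Y$), whose zero is the class of split extensions; operators act by push-out in $Y$ and pull-back in $X$. Its semi-quasi-norm is $\varrho([(\imath,\pi)])=\inf\varrho(\imath',\pi')$, the infimum over all extensions $0\to Y\xrightarrow{\imath'}Z'\xrightarrow{\pi'}X\to0$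 equivalent to the given one, where $$\varrho(\imath,\pi)=\inf_B\ \sup_{x,y\in X}\frac{\|\imath^{-1}(B(x+y)-B(x)-B(y))\|_Y}{\|x\|_X+\|y\|_X},$$ and $B$ runs over all homogeneous bounded maps $B:X\to Z$ with $\pi\circ B=\mathrm{Id}_X$ (the supremum being over $(x,y)\neq(0,0)$). The space $\operatorname{Ext}^{\varpi}(X,Y)$. Given quasi-Banach spaces $X,Y$, both $p$-normable for some $p\in(0,1]$, take $0<q<p$, a set $I$ of cardinality $\operatorname{dens}(X)$ (the density character of $X$) and a quotient map $\varpi:\ell_q(I)\to X$ (a continuous open linear surjection); let $K=\ker\varpi$, with inclusion $\varkappa:K\to\ell_q(I)$. Let $\varkappa^*:\mathfrak L(\ell_q(I),Y)\to\mathfrak L(K,Y)$ be the restriction map $\varkappa^*(v)=v\circ\varkappa$. Put $$\operatorname{Ext}^{\varpi}(X,Y)=\frac{\mathfrak L(K,Y)}{\varkappa^*(\mathfrak L(\ell_q(I),Y))},\qquad |[u]|_{\varpi}=\inf\{\|u-\varkappa^*(v)\|_{\mathfrak L(K,Y)}:v\in\mathfrak L(\ell_q(I),Y)\}.$$ Such a choice is fixed for each pair $(X,Y)$. Each $u\in\mathfrak L(K,Y)$ gives, by push-out of $0\to K\to\ell_q(I)\to X\to0$ along $u$, an extension $0\to Y\to P_u\to X\to0$. Operators act on $\operatorname{Ext}^{\varpi}$ as follows. Given $\beta:Y\to Y'$ and $\gamma:X'\to X$, with presentation $0\to K'\to\ell_{q'}(I')\xrightarrow{\varpi'}X'\to0$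 fixed for $(X',Y')$, the class $[u]$ is sent to the class of the restriction to $K'$ (which takes values in $Y'$) of any operator $V:\ell_{q'}(I')\to P_{\beta\circ u}$ lifting $\gamma\circ\varpi'$, i.e. whose composition with the quotient map $P_{\beta\circ u}\to X$ is $\gamma\circ\varpi'$. *)

(* Defs.v *)
From HB Require Import structures.
From mathcomp Require Import all_boot all_order all_algebra finmap complex ring lra.
From mathcomp Require Import all_classical all_reals all_analysis.

Set Implicit Arguments.
Unset Strict Implicit.
Unset Printing Implicit Defensive.

Import Order.TTheory GRing.Theory Num.Theory.
Import numFieldNormedType.Exports.
Local Open Scope classical_set_scope.
Local Open Scope ring_scope.

Inductive scalar_kind (R : realType) := RealScalars | ComplexScalars.
Arguments RealScalars {R}.
Arguments ComplexScalars {R}.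

Definition scalar (R : realType) (k : scalar_kind R) : fieldType :=
  match k with RealScalars => R | ComplexScalars => R[i]%C end.

Definition modulus (R : realType) (k : scalar_kind R) : scalar k -> R :=
  match k return scalar k -> R with
  | RealScalars => fun a => `|a|
  | ComplexScalars => fun a => @ComplexField.Normc.normc R a
  end.

Section Modulus.
Variables (R : realType) (k : scalar_kind R).
Implicit Types a b : scalar k.

Lemma modulus_ge0 a : 0 <= modulus a.
Proof. by case: k a => [a|[u v]] /=; rewrite ?normr_ge0 ?sqrtr_ge0. Qed.

Lemma modulusM a b : modulus (a * b) = modulus a * modulus b.
Proof.
case: k a b => a b /=; first exact: normrM.
exact: ComplexField.Normc.normcM.
Qed.

Lemma modulus0 : modulus (0 : scalar k) = 0.
Proof. by case: k; rewrite /= ?normr0 // expr0n /= addr0 sqrtr0. Qed.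

Lemma modulus0_eq0 a : modulus a = 0 -> a = 0.
Proof.
case: k a => a /=; first by move/normr0P/eqP.
exact: ComplexField.Normc.eq0_normc.
Qed.

Lemma modulus1 : modulus (1 : scalar k) = 1.
Proof. by case: k; rewrite /= ?normr1 // expr0n /= addr0 expr1n sqrtr1. Qed.

Lemma modulusN a : modulus (- a) = modulus a.
Proof. by case: k a => a /=; [exact: normrN|exact: normcN]. Qed.

Lemma ler_modulusD a b : modulus (a + b) <= modulus a + modulus b.
Proof. by case: k a b => a b /=; [exact: ler_normD|exact: le_normcD]. Qed.

End Modulus.

Definition is_semi_quasi_norm (R : realType) (k : scalar_kind R)
    (X : lmodType (scalar k)) (rho : X -> R) :=
  [/\ forall x, 0 <= rho x,
      forall a x, rho (a *: x) = modulus a * rho x &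
      exists D, forall x y, rho (x + y) <= D * (rho x + rho y)].

Record sqspace (R : realType) (k : scalar_kind R) := SQSpace {
  sq_car :> lmodType (scalar k);
  qnorm : sq_car -> R;
  qnormP : is_semi_quasi_norm qnorm }.
Arguments qnorm {R k s} _.

Section SQSpaceTheory.
Variables (R : realType) (k : scalar_kind R) (X : sqspace k).
Implicit Types x y : X.

Lemma qnorm_ge0 x : 0 <= qnorm x.
Proof. by case: (qnormP X). Qed.

Lemma qnormZ a x : qnorm (a *: x) = modulus a * qnorm x.
Proof. by case: (qnormP X). Qed.

Lemma qnorm0 : qnorm (0 : X) = 0.
Proof. by rewrite -(scale0r 0) qnormZ modulus0 mul0r. Qed.

Lemma qnormN x : qnorm (- x) = qnorm x.
Proof. by rewrite -scaleN1r qnormZ modulusN modulus1 mul1r. Qed.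

Lemma qnormB x y : qnorm (x - y) = qnorm (y - x).
Proof. by rewrite -qnormN opprB. Qed.

Lemma qnormD : exists2 D : R,
  0 < D & forall x y, qnorm (x + y) <= D * (qnorm x + qnorm y).
Proof.
case: (qnormP X) => ge0 _ [D HD]; exists (`|D| + 1).
  by apply: ltr_wpDl => //.
move=> x y; apply: le_trans (HD x y) _; apply: ler_wpM2r.
  by rewrite addr_ge0.
by apply: le_trans (ler_norm D) _; rewrite lerDl.
Qed.

End SQSpaceTheory.

(* The topology induced by the semi-quasi-norm, as a uniform structure: the sets
   [set y | qnorm (x - y) <= e], e > 0, form a basis of neighborhoods of x.  It
   is carried by an alias so that no instance is attached to an arbitrary
   [lmodType]. *)
Definition qtop (R : realType) (k : scalar_kind R) (X : sqspace k) : Type := X.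

Section Topology.
Variables (R : realType) (k : scalar_kind R) (X : sqspace k).
Local Open Scope relation_scope.

Definition qentourage : set_system (qtop X * qtop X) :=
  filter_from [set e : R | 0 < e]
    (fun e => [set xy | qnorm ((xy.1 : X) - (xy.2 : X)) <= e]).

Let qentourage_filter : Filter qentourage.
Proof.
apply: filter_from_filter; first by exists 1 => /=.
move=> e d /= e0 d0; exists (Num.min e d) => /=; first by rewrite lt_min e0.
by move=> [x y] /=; rewrite le_min => /andP[].
Qed.

Let qentourage_diagonal A : qentourage A -> diagonal `<=` A.
Proof.
move=> [e /= e0 eA] [x y] /= /diagonalP ->; apply: eA => /=.
by rewrite subrr qnorm0 ltW.
Qed.

Let qentourage_inv A : qentourage A -> qentourage A^-1.
Proof.
move=> [e /= e0 eA]; exists e => // -[x y] /= xy.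
by apply: eA => /=; rewrite qnormB.
Qed.

Let qentourage_split A : qentourage A ->
  exists2 B, qentourage B & B \; B `<=` A.
Proof.
move=> [e /= e0 eA]; have [D D0 HD] := qnormD X.
have d0 : 0 < e / (D * 2) by rewrite divr_gt0// mulr_gt0.
exists [set xy | qnorm ((xy.1 : X) - (xy.2 : X)) <= e / (D * 2)].
  by exists (e / (D * 2)).
move=> [x y] [z /= xz zy]; apply: eA => /=.
rewrite -(subrKA (z : X)); apply: le_trans (HD _ _) _.
apply: le_trans (ler_wpM2l (ltW D0) (lerD xz zy)) _.
by rewrite le_eqVlt; apply/orP; left; apply/eqP; field; rewrite gt_eqF.
Qed.

HB.instance Definition _ := Choice.copy (qtop X) X.
HB.instance Definition _ := isPointed.Build (qtop X) (0 : X).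
HB.instance Definition _ := isUniform.Build (qtop X)
  qentourage_filter qentourage_diagonal qentourage_inv qentourage_split.

Lemma qtop_nbhsP (x : X) (A : set (qtop X)) : nbhs (x : qtop X) A <->
  exists2 e : R, 0 < e & forall y : X, qnorm (x - y) <= e -> A y.
Proof.
rewrite -nbhs_entourageE; split.
- move=> [B [e /= e0 eB] BA]; exists e => // y xy.
  by apply: BA; apply/xsectionP; apply: eB.
- move=> [e e0 eA].
  exists [set xy | qnorm ((xy.1 : X) - (xy.2 : X)) <= e]; first by exists e.
  by move=> y /xsectionP /=; exact: eA.
Qed.

End Topology.

Lemma qcontinuousP (R : realType) (k : scalar_kind R) (X Y : sqspace k)
    (f : X -> Y) :
  continuous (f : qtop X -> qtop Y) <->
  forall (x : X) (e : R), 0 < e -> exists2 d : R,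
    0 < d & forall y, qnorm (x - y) <= d -> qnorm (f x - f y) <= e.
Proof.
split=> [fc x e e0|H x A /qtop_nbhsP[e e0 eA]].
  have : nbhs (f x : qtop Y) [set y | qnorm (f x - y) <= e].
    by apply/qtop_nbhsP; exists e.
  by move/(fc x) => /qtop_nbhsP.
have [d d0 dA] := H x e e0.
by apply/qtop_nbhsP; exists d => // y /dA /eA.
Qed.

Definition qcomplete (R : realType) (k : scalar_kind R) (X : sqspace k) :=
  forall F : set_system (qtop X), ProperFilter F -> cauchy F -> cvg F.

Record sqbanach (R : realType) (k : scalar_kind R) := SQBanach {
  sqb_space :> sqspace k;
  sqb_complete : qcomplete sqb_space }.

Record qbanach (R : realType) (k : scalar_kind R) := QBanach {
  qb_space :> sqbanach k;
  qb_separated : forall x : qb_space, qnorm x = 0 -> x = 0 }.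

Section Operators.
Variables (R : realType) (k : scalar_kind R) (X Y : sqspace k).

Definition is_operator : {pred X -> Y} :=
  fun f => `[< linear f /\ continuous (f : qtop X -> qtop Y) >].

Record operator := Operator {
  op_fun :> X -> Y;
  op_funP : op_fun \in is_operator }.

Lemma is_operatorP (f : X -> Y) : reflect
  (linear f /\ continuous (f : qtop X -> qtop Y)) (f \in is_operator).
Proof. exact: asboolP. Qed.

Let is_operator_submod : submod_closed is_operator.
Proof.
split.
  apply/is_operatorP; split=> [a x y|]; first by rewrite /= scaler0 addr0.
  apply/qcontinuousP => x e e0; exists 1 => // y _.
  by rewrite subrr qnorm0 ltW.
move=> a f g /is_operatorP[fl /qcontinuousP fc] /is_operatorP[gl /qcontinuousP gc].
apply/is_operatorP; split=> [b x y|].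
  change (a *: f (b *: x + y) + g (b *: x + y) =
          b *: (a *: f x + g x) + (a *: f y + g y)).
  by rewrite fl gl !scalerDr !scalerA mulrC addrACA.
apply/qcontinuousP => x e e0; have [D D0 HD] := qnormD Y.
have a0 := modulus_ge0 a.
have e2 : 0 < e / (D * 2) by rewrite divr_gt0// mulr_gt0.
have m0 : 0 < modulus a + 1 by rewrite ltr_wpDl.
have e1 : 0 < e / (D * 2) / (modulus a + 1) by rewrite divr_gt0.
have [d d0 Hd] := fc x _ e1; have [c c0 Hc] := gc x _ e2.
exists (Num.min d c) => [|y]; first by rewrite lt_min d0.
rewrite le_min => /andP[/Hd Hf /Hc Hg].
have -> : (a *: f + g) x - (a *: f + g) y = a *: (f x - f y) + (g x - g y).
  change (a *: f x + g x - (a *: f y + g y) = a *: (f x - f y) + (g x - g y)).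
  by rewrite opprD addrACA scalerBr.
apply: le_trans (HD _ _) _; rewrite qnormZ.
have H1 : modulus a * qnorm (f x - f y) <= e / (D * 2).
  apply: le_trans (ler_wpM2l a0 Hf) _.
  by rewrite mulrA ler_pdivrMr// mulrC ler_wpM2l ?(ltW e2)// lerDl.
apply: le_trans (ler_wpM2l (ltW D0) (lerD H1 Hg)) _.
by rewrite le_eqVlt; apply/orP; left; apply/eqP; field; rewrite gt_eqF.
Qed.

HB.instance Definition _ :=
  GRing.isSubmodClosed.Build (scalar k) (X -> Y) is_operator is_operator_submod.
HB.instance Definition _ := [isSub for op_fun].
HB.instance Definition _ := [Choice of operator by <:].
HB.instance Definition _ := [SubChoice_isSubLmodule of operator by <:].

Definition op_norm (u : operator) : R :=
  sup [set qnorm (u x) | x in [set x : X | qnorm x <= 1]].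

Lemma opP (u v : operator) : u =1 v -> u = v.
Proof. by move=> uv; apply: val_inj; apply/funext. Qed.

End Operators.

Section Filters.
Variables (R : realType) (k : scalar_kind R).

Lemma qcauchyP (X : sqspace k) (F : set_system (qtop X)) {FF : Filter F} :
  cauchy F <-> forall e : R, 0 < e -> exists2 A, F A &
    forall x y : X, A x -> A y -> qnorm (x - y) <= e.
Proof.
split=> [Fc e e0|H A [e /= e0 eA]].
  have /Fc : entourage [set xy : qtop X * qtop X |
      qnorm ((xy.1 : X) - (xy.2 : X)) <= e] by exists e.
  move=> [[A B] /= [FA FB] AB]; exists (A `&` B); first exact: filterI.
  by move=> x y [Ax _] [_ By]; exact: (AB (x, y)).
have [B FB HB] := H e e0; exists (B, B) => // -[x y] /= [Bx By].
by apply: eA; exact: HB.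
Qed.

Lemma qcvgP (X : sqspace k) (F : set_system (qtop X)) {FF : Filter F} (x : X) :
  F --> (x : qtop X) <->
  forall e : R, 0 < e -> F [set y | qnorm (x - (y : X)) <= e].
Proof.
split=> [Fx e e0|H A /qtop_nbhsP[e e0 eA]]; last exact: filterS (H e e0).
by apply: Fx; apply/qtop_nbhsP; exists e.
Qed.

Let real_lim (T : Type) (F : set_system T) {FF : ProperFilter F} (g : T -> R) :
  (forall e : R, 0 < e ->
     exists2 A, F A & forall x y, A x -> A y -> `|g x - g y| <= e) ->
  exists l, forall e : R, 0 < e -> F [set x | `|l - g x| <= e].
Proof.
move=> H; have /cauchy_cvg : cauchy (g @ F).
  apply/cauchy_exP => _/posnumP[e].
  have e2 : 0 < e%:num / 2 by rewrite divr_gt0.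
  have [A FA HA] := H _ e2.
  have [x Ax] := filter_ex FA.
  exists (g x); change (F (g @^-1` ball (g x) e%:num)).
  apply: filterS FA => y Ay /=.
  rewrite -ball_normE /ball_ /=; apply: le_lt_trans (HA _ _ Ax Ay) _.
  by rewrite ltr_pdivrMr// ltr_pMr ?ltr1n.
move=> /cvg_ex[l /cvgrPdist_le gl]; exists l => e e0.
exact: gl.
Qed.

Lemma scalar_lim (T : Type) (F : set_system T) {FF : ProperFilter F}
    (g : T -> scalar k) :
  (forall e : R, 0 < e ->
     exists2 A, F A & forall x y, A x -> A y -> modulus (g x - g y) <= e) ->
  exists l, forall e : R, 0 < e -> F [set x | modulus (l - g x) <= e].
Proof.
case: k g => /= g H; first exact: real_lim.
have ReIm (z : R[i]%C) : (`|complex.Re z| <= ComplexField.Normc.normc z) /\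
    (`|complex.Im z| <= ComplexField.Normc.normc z) /\
    ComplexField.Normc.normc z <= `|complex.Re z| + `|complex.Im z|.
  case: z => a b /=; rewrite -{1}(sqrtr_sqr a) -{1}(sqrtr_sqr b).
  split; [|split].
  - by rewrite ler_wsqrtr// lerDl sqr_ge0.
  - by rewrite ler_wsqrtr// lerDr sqr_ge0.
  rewrite -[leRHS]ger0_norm ?addr_ge0// -sqrtr_sqr ler_wsqrtr//.
  rewrite sqrrD !real_normK ?num_real//.
  by rewrite addrAC lerDl mulrn_wge0 ?mulr_ge0.
have [|a Ha] := @real_lim _ F FF (fun x => complex.Re (g x)).
  move=> e /H[A FA HA]; exists A => // x y Ax Ay.
  apply: le_trans (HA x y Ax Ay); have [+ _] := ReIm (g x - g y).
  by case: (g x) (g y) => [? ?] [? ?].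
have [|b Hb] := @real_lim _ F FF (fun x => complex.Im (g x)).
  move=> e /H[A FA HA]; exists A => // x y Ax Ay.
  apply: le_trans (HA x y Ax Ay); have [_ [+ _]] := ReIm (g x - g y).
  by case: (g x) (g y) => [? ?] [? ?].
exists (complex.Complex a b) => e e0.
have e2 : 0 < e / 2 by rewrite divr_gt0.
apply: filterS2 (Ha _ e2) (Hb _ e2) => x /= xa xb.
have [_ [_ +]] := ReIm (complex.Complex a b - g x).
move/le_trans; apply; rewrite (splitr e).
by move: xa xb; case: (g x) => c d /= xa xb; exact: lerD.
Qed.

End Filters.

Section Ellq.
Variables (R : realType) (k : scalar_kind R) (I : choiceType) (q : {posnum R}).
Implicit Types f g : I -> (scalar k)^o.

Definition ellq_sum f : \bar R :=
  (\esum_(i in [set: I]) (modulus (f i) `^ q%:num)%:E)%E.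

Definition is_ellq : {pred I -> (scalar k)^o} :=
  fun f => `[< (ellq_sum f < +oo)%E >].

Record ellq_car := Ellq {
  ellq_fun :> I -> (scalar k)^o;
  ellq_funP : ellq_fun \in is_ellq }.

Let le_sumP f (c : R) : (ellq_sum f <= c%:E)%E <->
  forall J : {fset I}, \sum_(i <- J) modulus (f i) `^ q%:num <= c.
Proof.
split=> [fc J|fc].
  rewrite -lee_fin; apply: le_trans fc; apply: esum_ge.
  exists [set` J]; first by split => //; exact: finite_fset.
  by rewrite fsbig_finite//= set_fsetK -sumEFin.
apply: ge_ereal_sup => _ [J [finJ _] <-].
by rewrite fsbig_finite//= sumEFin lee_fin.
Qed.

Let sum_ge0 f : (0 <= ellq_sum f)%E.
Proof. by apply: esum_ge0 => i _; rewrite lee_fin powR_ge0. Qed.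

Let is_ellqP f : reflect (exists c : R, (ellq_sum f <= c%:E)%E) (f \in is_ellq).
Proof.
apply: (iffP (asboolP _)) => [fo|[c fc]]; last exact: le_lt_trans fc (ltry c).
by exists (fine (ellq_sum f)); rewrite fineK// ge0_fin_numE.
Qed.

Let fine_sum f : f \in is_ellq -> ellq_sum f = (fine (ellq_sum f))%:E.
Proof. by move=> /asboolP fo; rewrite fineK// ge0_fin_numE. Qed.

Let modulus_powD (a b : scalar k) : modulus (a + b) `^ q%:num <=
  2 `^ q%:num * (modulus a `^ q%:num + modulus b `^ q%:num).
Proof.
have q0 : 0 <= q%:num by [].
have [A B] := (modulus_ge0 a, modulus_ge0 b).
wlog ab : a b A B / modulus a <= modulus b.
  move=> W; have [ab|/ltW ba] := leP (modulus a) (modulus b); first exact: W.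
  by rewrite addrC [X in _ * X]addrC; exact: W.
apply: (@le_trans _ _ ((2 * modulus b) `^ q%:num)).
  apply: ge0_ler_powR; rewrite ?nnegrE ?modulus_ge0 ?mulr_ge0//.
  by apply: le_trans (ler_modulusD a b) _; rewrite mulr2n mulrDl mul1r lerD2r.
by rewrite powRM// ler_wpM2l ?powR_ge0// lerDr powR_ge0.
Qed.

Let sumD f g (c d : R) : (ellq_sum f <= c%:E)%E -> (ellq_sum g <= d%:E)%E ->
  (ellq_sum (f + g)%R <= (2 `^ q%:num * (c + d))%:E)%E.
Proof.
move=> /le_sumP fc /le_sumP gd; apply/le_sumP => J.
apply: (@le_trans _ _ (\sum_(i <- J) 2 `^ q%:num *
    (modulus (f i) `^ q%:num + modulus (g i) `^ q%:num))).
  by apply: ler_sum => i _; exact: modulus_powD.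
by rewrite -mulr_sumr ler_wpM2l ?powR_ge0// big_split lerD.
Qed.

Let sumZ (a : scalar k) f (c : R) : (ellq_sum f <= c%:E)%E ->
  (ellq_sum (a *: f)%R <= (modulus a `^ q%:num * c)%:E)%E.
Proof.
move=> /le_sumP fc; apply/le_sumP => J.
rewrite (_ : \sum_(i <- J) _ =
    modulus a `^ q%:num * \sum_(i <- J) modulus (f i) `^ q%:num).
  by rewrite ler_wpM2l ?powR_ge0.
rewrite mulr_sumr; apply: eq_bigr => i _.
by rewrite [X in modulus X](_ : _ = a * f i)// modulusM powRM ?modulus_ge0.
Qed.

Let is_ellq_submod : submod_closed is_ellq.
Proof.
split=> [|a f g /is_ellqP[c fc] /is_ellqP[d gd]]; apply/is_ellqP.
  exists 0; apply/le_sumP => J; rewrite big1// => i _.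
  by rewrite [X in modulus X](_ : _ = 0)// modulus0 powR0.
by exists (2 `^ q%:num * (modulus a `^ q%:num * c + d)); apply/sumD/gd/sumZ.
Qed.

HB.instance Definition _ := GRing.isSubmodClosed.Build (scalar k)
  (I -> (scalar k)^o) is_ellq is_ellq_submod.
HB.instance Definition _ := [isSub for ellq_fun].
HB.instance Definition _ := [Choice of ellq_car by <:].
HB.instance Definition _ := [SubChoice_isSubLmodule of ellq_car by <:].

Definition ellq_norm (f : ellq_car) : R := fine (ellq_sum f) `^ q%:num^-1.

Let norm_le (f : ellq_car) (c : R) : 0 <= c ->
  (ellq_norm f <= c) = (ellq_sum f <= (c `^ q%:num)%:E)%E.
Proof.
move=> c0; rewrite /ellq_norm (fine_sum (ellq_funP f)) lee_fin /=.
set s := fine _; have s0 : 0 <= s by rewrite fine_ge0.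
have q0 : q%:num != 0 :> R by [].
have pw (x : R) : 0 <= x -> (x `^ q%:num^-1) `^ q%:num = x.
  by move=> x0; rewrite -powRrM mulVf// powRr1.
apply/idP/idP => H.
  rewrite -(pw _ s0); apply: ge0_ler_powR => //; by rewrite nnegrE ?powR_ge0.
have -> : c = (c `^ q%:num) `^ q%:num^-1 by rewrite -powRrM mulfV// powRr1.
by apply: ge0_ler_powR; rewrite ?nnegrE ?powR_ge0 ?invr_ge0.
Qed.

Let norm_ge0 (f : ellq_car) : 0 <= ellq_norm f. Proof. exact: powR_ge0. Qed.

Let norm_sum (f : ellq_car) : (ellq_sum f <= (ellq_norm f `^ q%:num)%:E)%E.
Proof. by rewrite -norm_le. Qed.

Let normZ_le (a : scalar k) (f : ellq_car) :
  ellq_norm (a *: f) <= modulus a * ellq_norm f.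
Proof.
rewrite norm_le ?mulr_ge0 ?modulus_ge0// powRM ?modulus_ge0//.
exact: sumZ (norm_sum f).
Qed.

Lemma ellq_normP : is_semi_quasi_norm ellq_norm.
Proof.
split; first exact: norm_ge0.
  move=> a f; apply/eqP; rewrite eq_le normZ_le /=.
  have [->|a0] := eqVneq a 0; first by rewrite modulus0 mul0r norm_ge0.
  have am : modulus a != 0 by apply: contra a0 => /eqP/modulus0_eq0 ->.
  rewrite -{1}[f]scale1r -(mulVf a0) -scalerA.
  apply: le_trans (ler_wpM2l (modulus_ge0 a) (normZ_le _ _)) _.
  by rewrite mulrA -modulusM mulfV// modulus1 mul1r.
exists (2 * 2 `^ q%:num^-1) => f g.
have [c0 d0] := (norm_ge0 f, norm_ge0 g).
have q0 : q%:num != 0 :> R by [].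
have r0 : 0 <= 2 `^ q%:num^-1 :> R by exact: powR_ge0.
have cd0 := addr_ge0 c0 d0.
have t0 : 0 <= 2 * 2 `^ q%:num^-1 :> R by exact: (mulr_ge0 (ler0n _ 2) r0).
rewrite norm_le; last exact: (mulr_ge0 t0 cd0).
apply: le_trans (sumD (norm_sum f) (norm_sum g)) _; rewrite lee_fin.
rewrite (powRM _ t0 cd0) (powRM _ (ler0n _ 2) r0) -mulrA ler_wpM2l ?powR_ge0//.
rewrite -powRrM mulVf// powRr1// mulrDl mul1r.
have pw (c : R) : 0 <= c -> c <= ellq_norm f + ellq_norm g ->
    c `^ q%:num <= (ellq_norm f + ellq_norm g) `^ q%:num.
  by move=> c1 c2; apply: (ge0_ler_powR (ltW (gt0 q))); rewrite ?nnegrE.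
apply: lerD.
  by apply: (pw _ c0); rewrite lerDl.
apply: (pw _ d0); rewrite lerDr; exact: c0.
Qed.

Definition ellq_space : sqspace k := SQSpace ellq_normP.

Let coord_le (f : ellq_car) i : modulus (f i) <= ellq_norm f.
Proof.
have := norm_sum f; move=> /le_sumP/(_ [fset i]%fset).
rewrite big_seq_fset1 => H; rewrite leNgt; apply/negP => fi.
have : ellq_norm f `^ q%:num < modulus (f i) `^ q%:num.
  by apply: gt0_ltr_powR; rewrite ?nnegrE ?modulus_ge0.
by rewrite ltNge H.
Qed.

Lemma ellq_complete : qcomplete ellq_space.
Proof.
move=> F FF /qcauchyP Fc.
have lim i : exists l, forall e : R, 0 < e ->
    F [set x : ellq_car | modulus (l - x i) <= e].
  apply: scalar_lim => e /Fc[A FA HA]; exists A => // x y Ax Ay.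
  by apply: le_trans (HA _ _ Ax Ay); exact: (coord_le (x - y : ellq_car) i).
have [l Hl] := choice lim.
have key (e : R) : 0 < e -> exists2 A, F A & forall x : ellq_car, A x ->
    (ellq_sum ((l : I -> (scalar k)^o) - (x : I -> (scalar k)^o))%R <= e%:E)%E.
  move=> e0; pose e1 := e / (2 * 2 `^ q%:num).
  have p2 : 0 < 2 `^ q%:num :> R by rewrite powR_gt0.
  have e10 : 0 < e1 by rewrite divr_gt0// mulr_gt0.
  have [A FA HA] := Fc (e1 `^ q%:num^-1) (powR_gt0 _ e10).
  exists A => // x Ax; apply/le_sumP => J.
  pose d := (e1 / (#|` J|.+1)%:R) `^ q%:num^-1.
  have d0 : 0 < d by rewrite powR_gt0// divr_gt0.
  have qq (c : R) : 0 <= c -> (c `^ q%:num^-1) `^ q%:num = c.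
    by move=> c0; rewrite -powRrM mulVf// powRr1.
  have FJ : F (\bigcap_(i in [set` J]) [set y : ellq_car | modulus (l i - y i) <= d]).
    by apply: filter_bigI => i _; exact: Hl.
  have [y [Ay yJ]] := filter_ex (filterI FA FJ).
  have S1 : \sum_(i <- J) modulus (l i - y i) `^ q%:num <= e1.
    apply: (@le_trans _ _ (\sum_(i <- J) e1 / (#|` J|.+1)%:R)).
      rewrite big_seq [leRHS]big_seq; apply: ler_sum => i iJ.
      have dq : d `^ q%:num = e1 / (#|` J|.+1)%:R by rewrite qq// divr_ge0// ltW.
      rewrite -dq; have := yJ i iJ => /= H.
      apply: (ge0_ler_powR (ltW (gt0 q)) _ _ H); rewrite nnegrE ?modulus_ge0//.
      exact: ltW.
    rewrite big_const_seq count_predT iter_addr addr0 -[leLHS]mulr_natl mulrA.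
    by rewrite ler_pdivrMr// mulrC ler_wpM2l ?(ltW e10)// ler_nat leqnSn.
  have S2 : \sum_(i <- J) modulus (y i - x i) `^ q%:num <= e1.
    have := HA _ _ Ay Ax; rewrite /qnorm /= norm_le ?powR_ge0// (qq _ (ltW e10)).
    by move=> /le_sumP/(_ J).
  apply: (@le_trans _ _ (\sum_(i <- J) 2 `^ q%:num *
      (modulus (l i - y i) `^ q%:num + modulus (y i - x i) `^ q%:num))).
    apply: ler_sum => i _.
    by apply: le_trans (modulus_powD _ _); rewrite subrKA.
  rewrite -mulr_sumr big_split /=.
  apply: le_trans (ler_wpM2l (ltW p2) (lerD S1 S2)) _.
  by rewrite /e1 le_eqVlt; apply/orP; left; apply/eqP; field; rewrite gt_eqF.
have lP : (l : I -> (scalar k)^o) \in is_ellq.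
  have [A FA HA] := key 1 ltr01; have [x Ax] := filter_ex FA.
  rewrite -(subrK (x : I -> (scalar k)^o) (l : I -> (scalar k)^o)).
  by apply: rpredD; [apply/is_ellqP; exists 1; exact: HA|exact: ellq_funP].
apply/cvg_ex; exists (Ellq lP); apply/qcvgP => e e0.
have [A FA HA] := key _ (powR_gt0 q%:num e0).
apply: filterS FA => x Ax /=; rewrite /qnorm /= (norm_le _ (ltW e0)).
exact: HA.
Qed.

Lemma ellq_separated (f : ellq_space) : qnorm f = 0 -> f = 0.
Proof.
move=> f0; apply: val_inj; apply/funext => i; apply: modulus0_eq0.
by apply/eqP; rewrite eq_le modulus_ge0 andbT -f0 coord_le.
Qed.

Definition ellq : qbanach k := QBanach (qb_space := SQBanach ellq_complete) ellq_separated.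

End Ellq.

Section Linear.
Variables (R : realType) (k : scalar_kind R) (X Y : sqspace k) (u : operator X Y).

Let op_linear : linear u.
Proof. by have /is_operatorP[] := op_funP u. Qed.

HB.instance Definition _ := GRing.isLinear.Build (scalar k) X Y *:%R u op_linear.

Lemma op_continuous : continuous (u : qtop X -> qtop Y).
Proof. by have /is_operatorP[] := op_funP u. Qed.

End Linear.

Section OperatorConstructions.
Variables (R : realType) (k : scalar_kind R).

Lemma bounded_is_operator (X Y : sqspace k) (f : X -> Y) (C : R) :
  linear f -> (forall x, qnorm (f x) <= C * qnorm x) ->
  f \in @is_operator R k X Y.
Proof.
move=> fl fC; apply/is_operatorP; split=> //; apply/qcontinuousP => x e e0.
have C0 : 0 < `|C| + 1 by apply: ltr_wpDl.
exists (e / (`|C| + 1)) => [|y xy]; first exact: divr_gt0.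
have -> : f x - f y = f (x - y).
  by rewrite addrC -scaleN1r -fl scaleN1r addrC.
apply: le_trans (fC _) _.
apply: (@le_trans _ _ ((`|C| + 1) * qnorm (x - y))).
  apply: ler_wpM2r; first exact: qnorm_ge0.
  by apply: le_trans (ler_norm C) _; rewrite lerDl.
by rewrite mulrC -ler_pdivlMr.
Qed.

Let id_is_operator (X : sqspace k) : idfun \in @is_operator R k X X.
Proof. by apply: (@bounded_is_operator _ _ _ 1) => // x; rewrite mul1r. Qed.

Definition op_id (X : sqspace k) : operator X X := Operator (id_is_operator X).

Let comp_is_operator (X Y Z : sqspace k) (v : operator Y Z) (u : operator X Y) :
  v \o u \in @is_operator R k X Z.
Proof.
apply/is_operatorP; split=> [a x y|]; first by rewrite /= !linearP.
move=> x; apply: (@continuous_comp (qtop X) (qtop Y) (qtop Z)).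
  exact: op_continuous.
exact: op_continuous.
Qed.

Definition op_comp (X Y Z : sqspace k) (v : operator Y Z) (u : operator X Y) :
  operator X Z := Operator (comp_is_operator v u).

End OperatorConstructions.

Record category := Category {
  ob :> Type;
  hom : ob -> ob -> Type;
  idm : forall a, hom a a;
  cmp : forall a b c, hom b c -> hom a b -> hom a c;
  cmp_idl : forall a b (f : hom a b), cmp (idm b) f = f;
  cmp_idr : forall a b (f : hom a b), cmp f (idm a) = f;
  cmp_assoc : forall a b c d (h : hom c d) (g : hom b c) (f : hom a b),
    cmp h (cmp g f) = cmp (cmp h g) f }.

Definition opposite (C : category) : category :=
  @Category C (fun a b => hom b a) (@idm C) (fun a b c g f => cmp f g)
    (fun a b f => cmp_idr f) (fun a b f => cmp_idl f)
    (fun a b c d h g f => esym (cmp_assoc f g h)).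

Definition product_category (C D : category) : category :=
  @Category (C * D)%type (fun a b => (hom a.1 b.1 * hom a.2 b.2)%type)
    (fun a => (idm a.1, idm a.2))
    (fun a b c g f => (cmp g.1 f.1, cmp g.2 f.2))
    (fun a b '(f1, f2) => f_equal2 pair (cmp_idl f1) (cmp_idl f2))
    (fun a b '(f1, f2) => f_equal2 pair (cmp_idr f1) (cmp_idr f2))
    (fun a b c d h g f =>
       f_equal2 pair (cmp_assoc h.1 g.1 f.1) (cmp_assoc h.2 g.2 f.2)).

Record functor (C D : category) := Functor {
  fob :> C -> D;
  fmap : forall a b, hom a b -> hom (fob a) (fob b);
  fmap_id : forall a, fmap (idm a) = idm (fob a);
  fmap_cmp : forall a b c (g : hom b c) (f : hom a b),
    fmap (cmp g f) = cmp (fmap g) (fmap f) }.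

Definition isomorphism (C : category) (a b : C) (f : hom a b) :=
  exists g : hom b a, cmp g f = idm a /\ cmp f g = idm b.

Definition naturally_equivalent (C D : category) (F G : functor C D) :=
  exists eta : forall a, hom (F a) (G a),
    (forall a, isomorphism (eta a)) /\
    (forall a b (f : hom a b), cmp (eta b) (fmap F f) = cmp (fmap G f) (eta a)).

Definition is_pushout (C : category) (a b c p : C)
    (f : hom a b) (g : hom a c) (i : hom b p) (j : hom c p) :=
  cmp i f = cmp j g /\
  forall w (i' : hom b w) (j' : hom c w), cmp i' f = cmp j' g ->
    exists! h : hom p w, cmp h i = i' /\ cmp h j = j'.

Definition is_pullback (C : category) (a b c p : C)
    (f : hom b a) (g : hom c a) (i : hom p b) (j : hom p c) :=
  @is_pushout (opposite C) a b c p f g i j.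

Section CategoriesOfSpaces.
Variables (R : realType) (k : scalar_kind R).

Let op_idl (X Y : sqspace k) (f : operator X Y) : op_comp (op_id Y) f = f.
Proof. exact: opP. Qed.
Let op_idr (X Y : sqspace k) (f : operator X Y) : op_comp f (op_id X) = f.
Proof. exact: opP. Qed.
Let op_assoc (X Y Z W : sqspace k)
  (h : operator Z W) (g : operator Y Z) (f : operator X Y) :
  op_comp h (op_comp g f) = op_comp (op_comp h g) f.
Proof. exact: opP. Qed.

Definition Qcat : category :=
  @Category (qbanach k) (fun X Y => operator X Y) (fun X => op_id X)
    (fun X Y Z v u => op_comp v u)
    (fun X Y f => op_idl f) (fun X Y f => op_idr f)
    (fun X Y Z W h g f => op_assoc h g f).

Definition Qhalf : category :=
  @Category (sqbanach k) (fun X Y => operator X Y) (fun X => op_id X)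
    (fun X Y Z v u => op_comp v u)
    (fun X Y f => op_idl f) (fun X Y f => op_idr f)
    (fun X Y Z W h g f => op_assoc h g f).

End CategoriesOfSpaces.

Section Kernel.
Variables (R : realType) (k : scalar_kind R) (X Y : qbanach k).
Variable u : operator X Y.

Definition in_ker : {pred X} := fun x => u x == 0.

Record ker_car := Ker { ker_val :> X; ker_valP : ker_val \in in_ker }.

Let in_ker_submod : submod_closed in_ker.
Proof.
split=> [|a x y]; rewrite !unfold_in; first by rewrite linear0.
by move=> /eqP x0 /eqP y0; rewrite linearP /= x0 y0 scaler0 addr0.
Qed.

HB.instance Definition _ :=
  GRing.isSubmodClosed.Build (scalar k) X in_ker in_ker_submod.
HB.instance Definition _ := [isSub for ker_val].
HB.instance Definition _ := [Choice of ker_car by <:].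
HB.instance Definition _ := [SubChoice_isSubLmodule of ker_car by <:].

Let ker_normP : is_semi_quasi_norm (fun x : ker_car => qnorm (x : X)).
Proof.
split=> [x|a x|]; [exact: qnorm_ge0|exact: qnormZ|].
by have [D _ HD] := qnormD X; exists D => x y; exact: HD.
Qed.

Definition ker_space : sqspace k := SQSpace ker_normP.

Let ker_complete : qcomplete ker_space.
Proof.
move=> F FF /qcauchyP Fc; pose G : set_system (qtop X) := ker_val @ F.
have GP (A : set X) : G A = F (ker_val @^-1` A) by [].
have GF : ProperFilter G by exact: fmap_proper_filter.
have /sqb_complete/cvg_ex[x /qcvgP Gx] : cauchy G.
  apply/qcauchyP => e /Fc[A FA HA]; exists (ker_val @` A).
    by rewrite GP; apply: filterS FA => a Aa; exists a.
  by move=> _ _ [a Aa <-] [b Ab <-]; exact: HA.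
have xP : x \in in_ker.
  rewrite unfold_in; apply/eqP/qb_separated/eqP; rewrite eq_le qnorm_ge0 andbT.
  apply/ler_addgt0Pl => e e0; rewrite addr0.
  have /qcontinuousP/(_ x e e0)[d d0 Hd] := @op_continuous _ _ _ _ u.
  have [y /Hd] := filter_ex (Gx d d0 : F _).
  by have /eqP -> : u (ker_val y) == 0 := ker_valP y; rewrite subr0.
apply/cvg_ex; exists (Ker xP : qtop ker_space); apply/qcvgP => e e0.
exact: Gx.
Qed.

Let ker_separated (x : ker_space) : qnorm x = 0 -> x = 0.
Proof. by move=> x0; apply: val_inj; exact: qb_separated. Qed.

Definition ker : qbanach k :=
  QBanach (qb_space := SQBanach ker_complete) ker_separated.

Let ker_val_is_operator : (ker_val : ker -> X) \in @is_operator R k ker X.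
Proof. by apply: (@bounded_is_operator _ _ _ _ _ 1) => // x; rewrite mul1r. Qed.

Definition ker_incl : operator ker X := Operator ker_val_is_operator.

End Kernel.

Section DirectSum.
Variables (R : realType) (k : scalar_kind R) (X Y : qbanach k).

Let sum_normP : is_semi_quasi_norm
  (fun z : (X * Y)%type => qnorm (z.1 : X) + qnorm (z.2 : Y)).
Proof.
split=> [z|a z|]; first by rewrite addr_ge0 ?qnorm_ge0.
  by rewrite !qnormZ mulrDr.
have [D D0 HD] := qnormD X; have [E E0 HE] := qnormD Y.
exists (Num.max D E) => x y; rewrite addrACA mulrDr; apply: lerD.
  apply: le_trans (HD _ _) _; rewrite ler_wpM2r ?addr_ge0 ?qnorm_ge0//.
  by rewrite le_max lexx.
apply: le_trans (HE _ _) _; rewrite ler_wpM2r ?addr_ge0 ?qnorm_ge0//.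
by rewrite le_max lexx orbT.
Qed.

Definition dsum_space : sqspace k := SQSpace sum_normP.

Let sum_complete : qcomplete dsum_space.
Proof.
move=> F FF /qcauchyP Fc.
pose G : set_system (qtop X) := (fun z : X * Y => z.1) @ F.
pose H : set_system (qtop Y) := (fun z : X * Y => z.2) @ F.
have GF : ProperFilter G by exact: fmap_proper_filter.
have HF : ProperFilter H by exact: fmap_proper_filter.
have /sqb_complete/cvg_ex[x /qcvgP Gx] : cauchy G.
  apply/qcauchyP => e /Fc[A FA HA]; exists [set z.1 | z in A].
    by rewrite /G /=; apply: filterS FA => a Aa; exists a.
  move=> _ _ [a Aa <-] [b Ab <-]; apply: le_trans (HA _ _ Aa Ab).
  by rewrite lerDl qnorm_ge0.
have /sqb_complete/cvg_ex[y /qcvgP Hy] : cauchy H.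
  apply/qcauchyP => e /Fc[A FA HA]; exists [set z.2 | z in A].
    by rewrite /H /=; apply: filterS FA => a Aa; exists a.
  move=> _ _ [a Aa <-] [b Ab <-]; apply: le_trans (HA _ _ Aa Ab).
  by rewrite lerDr qnorm_ge0.
apply/cvg_ex; exists ((x, y) : qtop dsum_space); apply/qcvgP => e e0.
have e2 : 0 < e / 2 by rewrite divr_gt0.
apply: filterS2 (Gx _ e2 : F _) (Hy _ e2 : F _) => z /= xz yz.
by rewrite (splitr e); exact: lerD.
Qed.

Let sum_separated (z : dsum_space) : qnorm z = 0 -> z = 0.
Proof.
move=> /eqP; rewrite paddr_eq0 ?qnorm_ge0// => /andP[/eqP z1 /eqP z2].
by case: z z1 z2 => x y /= /qb_separated -> /qb_separated ->.
Qed.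

Definition dsum : qbanach k :=
  QBanach (qb_space := SQBanach sum_complete) sum_separated.

End DirectSum.

Section DirectSumOperators.
Variables (R : realType) (k : scalar_kind R).

Let diag_is_operator (X : qbanach k) :
  (fun x => (x, x)) \in @is_operator R k X (dsum X X).
Proof.
apply: (@bounded_is_operator _ _ _ _ _ 2) => // x.
by rewrite mulr2n mulrDl mul1r.
Qed.

Definition op_diag (X : qbanach k) : operator X (dsum X X) :=
  Operator (diag_is_operator X).

Let codiag_is_operator (Y : qbanach k) :
  (fun y => y.1 + y.2) \in @is_operator R k (dsum Y Y) Y.
Proof.
have [D D0 HD] := qnormD Y; apply: (@bounded_is_operator _ _ _ _ _ D).
  by move=> a x y /=; rewrite scalerDr addrACA.
by move=> y; exact: HD.
Qed.

Definition op_codiag (Y : qbanach k) : operator (dsum Y Y) Y :=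
  Operator (codiag_is_operator Y).

Let dsum_is_operator (X1 X2 Y1 Y2 : qbanach k)
    (u : operator X1 Y1) (v : operator X2 Y2) :
  (fun x => (u x.1, v x.2)) \in @is_operator R k (dsum X1 X2) (dsum Y1 Y2).
Proof.
apply/is_operatorP; split; first by move=> a x y /=; rewrite !linearP.
apply/qcontinuousP => x e e0; have e2 : 0 < e / 2 by rewrite divr_gt0.
have /qcontinuousP/(_ x.1 _ e2)[c c0 Hc] := @op_continuous _ _ _ _ u.
have /qcontinuousP/(_ x.2 _ e2)[d d0 Hd] := @op_continuous _ _ _ _ v.
exists (Num.min c d) => [|y]; first by rewrite lt_min c0.
rewrite le_min => /andP[xc xd]; rewrite (splitr e); apply: lerD.
  by apply: Hc; apply: le_trans xc; rewrite lerDl qnorm_ge0.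
by apply: Hd; apply: le_trans xd; rewrite lerDr qnorm_ge0.
Qed.

Definition op_dsum (X1 X2 Y1 Y2 : qbanach k)
    (u : operator X1 Y1) (v : operator X2 Y2) :
  operator (dsum X1 X2) (dsum Y1 Y2) := Operator (dsum_is_operator u v).

End DirectSumOperators.

Section Quasilinear.
Variables (R : realType) (k : scalar_kind R) (X Y : sqspace k).

Definition homogeneous (F : X -> Y) := forall a x, F (a *: x) = a *: F x.

Definition bounded_on_ball (F : X -> Y) :=
  exists M, forall x, qnorm x <= 1 -> qnorm (F x) <= M.

Definition quasilinear_const (F : X -> Y) (Q : R) :=
  forall x y, qnorm (F (x + y) - F x - F y) <= Q * (qnorm x + qnorm y).

Definition is_quasilinear : {pred X -> Y} :=
  fun F => `[< homogeneous F /\ exists Q, quasilinear_const F Q >].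

Record quasilinear := Quasilinear {
  ql_fun :> X -> Y;
  ql_funP : ql_fun \in is_quasilinear }.

Let is_quasilinearP (F : X -> Y) : reflect
  (homogeneous F /\ exists Q, quasilinear_const F Q) (F \in is_quasilinear).
Proof. exact: asboolP. Qed.

Let is_quasilinear_submod : submod_closed is_quasilinear.
Proof.
split.
  apply/is_quasilinearP; split=> [a x|]; first by rewrite /= scaler0.
  exists 0 => x y; rewrite [X in qnorm X](_ : _ = 0) ?qnorm0 ?mul0r//.
  by change (0 - 0 - 0 = 0 :> Y); rewrite !subr0.
move=> a F G /is_quasilinearP[Fh [P FP]] /is_quasilinearP[Gh [Q GQ]].
apply/is_quasilinearP; split=> [b x|].
  change (a *: F (b *: x) + G (b *: x) = b *: (a *: F x + G x)).
  by rewrite Fh Gh scalerDr !scalerA mulrC.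
have [D D0 HD] := qnormD Y; exists (D * (modulus a * P + Q)) => x y.
have -> : (a *: F + G) (x + y) - (a *: F + G) x - (a *: F + G) y =
    a *: (F (x + y) - F x - F y) + (G (x + y) - G x - G y).
  change (a *: F (x + y) + G (x + y) - (a *: F x + G x) - (a *: F y + G y) =
    a *: (F (x + y) - F x - F y) + (G (x + y) - G x - G y)).
  by rewrite !scalerBr !opprD !addrA [_ + G (x + y) - _]addrAC
    [_ + G (x + y) - _ - _]addrAC; congr (_ + _); rewrite -!addrA;
    congr (_ + (_ + _)); rewrite [RHS]addrC -!addrA; congr (_ + _); rewrite addrC.
apply: le_trans (HD _ _) _; rewrite -mulrA ler_wpM2l ?(ltW D0)// mulrDl.
by rewrite lerD// qnormZ -mulrA ler_wpM2l ?modulus_ge0.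
Qed.

HB.instance Definition _ := GRing.isSubmodClosed.Build (scalar k) (X -> Y)
  is_quasilinear is_quasilinear_submod.
HB.instance Definition _ := [isSub for ql_fun].
HB.instance Definition _ := [Choice of quasilinear by <:].
HB.instance Definition _ := [SubChoice_isSubLmodule of quasilinear by <:].

(* The lower bound 0 <= Q only matters when X = 0. *)
Definition ql_norm (F : quasilinear) : R :=
  inf [set Q | 0 <= Q /\ quasilinear_const F Q].

Definition trivial_map (F : X -> Y) :=
  exists (L : {linear X -> Y}) (B : X -> Y),
    [/\ homogeneous B, bounded_on_ball B & forall x, F x = L x + B x].

End Quasilinear.

Section Extensions.
Variables (R : realType) (k : scalar_kind R).

Record extension (X Y : qbanach k) := Extension {
  mid : qbanach k;
  ext_i : operator Y mid;
  ext_p : operator mid X;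
  ext_i_inj : injective ext_i;
  ext_p_surj : forall x, exists z, ext_p z = x;
  ext_exact : forall z, ext_p z = 0 <-> exists y, ext_i y = z }.

Definition ext_equiv (X Y : qbanach k) (E E' : extension X Y) :=
  exists t : operator (mid E) (mid E'),
    (forall y, t (ext_i E y) = ext_i E' y) /\
    (forall z, ext_p E' (t z) = ext_p E z).

Definition ext_split (X Y : qbanach k) (E : extension X Y) :=
  exists s : operator X (mid E), forall x, ext_p E (s x) = x.

(* E' is the lower row of the push-out diagram of E along beta; by the universal
   property [ext_p E'] is determined by its composites with t and [ext_i E']. *)
Definition pushout_ext (X Y Y' : qbanach k) (beta : operator Y Y')
    (E : extension X Y) (E' : extension X Y') :=
  exists t : operator (mid E) (mid E'),
    (forall z, ext_p E' (t z) = ext_p E z) /\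
    @is_pushout (Qcat k) Y (mid E) Y' (mid E') (ext_i E) beta t (ext_i E').

Definition pullback_ext (X X' Y : qbanach k) (gamma : operator X' X)
    (E : extension X Y) (E' : extension X' Y) :=
  exists t : operator (mid E') (mid E),
    (forall y, t (ext_i E' y) = ext_i E y) /\
    @is_pullback (Qcat k) X (mid E) X' (mid E') (ext_p E) gamma t (ext_p E').

Section Dsum.
Variables (X1 X2 Y1 Y2 : qbanach k).
Variables (E1 : extension X1 Y1) (E2 : extension X2 Y2).

Let i_inj : injective (op_dsum (ext_i E1) (ext_i E2)).
Proof. by move=> [x1 x2] [y1 y2] [/ext_i_inj -> /ext_i_inj ->]. Qed.

Let p_surj x : exists z, op_dsum (ext_p E1) (ext_p E2) z = x.
Proof.
case: x => x1 x2; have [z1 <-] := ext_p_surj E1 x1.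
by have [z2 <-] := ext_p_surj E2 x2; exists (z1, z2).
Qed.

Let exact_dsum z : op_dsum (ext_p E1) (ext_p E2) z = 0 <->
  exists y, op_dsum (ext_i E1) (ext_i E2) y = z.
Proof.
case: z => z1 z2; split=> [[/ext_exact[y1 <-] /ext_exact[y2 <-]]|].
  by exists (y1, y2).
move=> [[y1 y2] [<- <-]].
have p1 : ext_p E1 (ext_i E1 y1) = 0 by apply/ext_exact; exists y1.
have p2 : ext_p E2 (ext_i E2 y2) = 0 by apply/ext_exact; exists y2.
by rewrite /= p1 p2.
Qed.

Definition dsum_ext : extension (dsum X1 X2) (dsum Y1 Y2) :=
  Extension i_inj p_surj exact_dsum.

End Dsum.

Definition baer_sum (X Y : qbanach k) (E1 E2 E : extension X Y) :=
  exists E' : extension X (dsum Y Y),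
    pullback_ext (op_diag X) (dsum_ext E1 E2) E' /\
    pushout_ext (op_codiag Y) E' E.

Definition bounded_section (X Y : qbanach k) (E : extension X Y)
    (B : X -> mid E) :=
  [/\ homogeneous B, bounded_on_ball B & forall x, ext_p E (B x) = x].

(* All the quotients are nonnegative; adjoining 0 to them makes the supremum
   equal to 0, rather than -oo, when X = 0. *)
Definition section_const (X Y : qbanach k) (E : extension X Y)
    (B : X -> mid E) : \bar R :=
  ereal_sup ([set 0%E] `|`
    [set r | exists x y w, [/\ (x, y) <> (0, 0),
       ext_i E w = B (x + y) - B x - B y &
       r = (qnorm w / (qnorm x + qnorm y))%:E]]).

Definition ext_rho (X Y : qbanach k) (E : extension X Y) : \bar R :=
  ereal_inf [set section_const B | B in @bounded_section X Y E].

End Extensions.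

Section Presentations.
Variables (R : realType) (k : scalar_kind R).

Definition is_p_norm (p : R) (X : lmodType (scalar k)) (N : X -> R) :=
  [/\ is_semi_quasi_norm N, forall x, N x = 0 -> x = 0 &
      forall x y, N (x + y) `^ p <= N x `^ p + N y `^ p].

Definition p_normable (p : R) (X : qbanach k) :=
  exists N : X -> R, is_p_norm p N /\
    exists c C : R, [/\ 0 < c, 0 < C &
      forall x, c * qnorm x <= N x <= C * qnorm x].

Definition density_character (X : sqspace k) (I : Type) :=
  exists D : set (qtop X), [/\ dense D, ([set: I] #= D)%card &
    forall D' : set (qtop X), dense D' -> (D #<= D')%card].

Definition open_map (X Y : sqspace k) (u : X -> Y) :=
  forall U : set (qtop X), open U -> open (u @` U : set (qtop Y)).

Record presentation (X Y : qbanach k) := Presentation {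
  pr_p : R;
  pr_q : {posnum R};
  pr_q_lt : pr_q%:num < pr_p;
  pr_p_le1 : pr_p <= 1;
  pr_normable_X : p_normable pr_p X;
  pr_normable_Y : p_normable pr_p Y;
  pr_index : choiceType;
  pr_dens : density_character X pr_index;
  pr_map : operator (ellq k pr_index pr_q) X;
  pr_surj : forall x, exists f, pr_map f = x;
  pr_open : open_map pr_map }.

Section PresentationExtension.
Variables (X Y : qbanach k) (P : presentation X Y).

Definition pr_ker : qbanach k := ker (pr_map P).
Definition pr_incl : operator pr_ker (ellq k (pr_index P) (pr_q P)) :=
  ker_incl (pr_map P).

Let pr_incl_inj : injective pr_incl.
Proof. exact: val_inj. Qed.

Let pr_exact f : pr_map P f = 0 <-> exists x, pr_incl x = f.
Proof.
split=> [/eqP f0|[x <-]]; last by apply/eqP; exact: ker_valP.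
by exists (@Ker _ _ _ _ (pr_map P) f f0).
Qed.

Definition pr_ext : extension X pr_ker :=
  Extension pr_incl_inj (@pr_surj _ _ P) pr_exact.

End PresentationExtension.

End Presentations.

Section Functors.
Variables (R : realType) (k : scalar_kind R).

Definition bifunctor :=
  functor (product_category (Qcat k) (opposite (Qcat k))) (Qhalf k).

Definition fspace (F : bifunctor) (X Y : qbanach k) : sqbanach k := F (Y, X).

Definition fact (F : bifunctor) (X X' Y Y' : qbanach k)
    (beta : operator Y Y') (gamma : operator X' X) :
    operator (fspace F X Y) (fspace F X' Y') :=
  @fmap _ _ F (Y, X) (Y', X') (beta, gamma).

(* [q : V -> W] exhibits W as the quotient of V by the subspace N, endowed with
   the semi-quasi-norm inf {rho v' | v' = v mod N}. *)
Definition is_quotient_map (V : lmodType (scalar k)) (N : set V) (rho : V -> R)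
    (W : sqspace k) (q : V -> W) :=
  [/\ linear q,
      forall w, exists v, q v = w,
      forall v, q v = 0 <-> N v &
      forall v, qnorm (q v) = inf [set rho v' | v' in [set v' | N (v - v')]]].

(* f is the map induced on classes by the correspondence r between
   representatives. *)
Definition induced_by (A B C D : Type) (clsA : A -> C) (clsB : B -> D)
    (r : A -> B -> Prop) (f : C -> D) :=
  (forall a, exists b, r a b) /\
  (forall a b, r a b -> f (clsA a) = clsB b).

Definition is_Q_functor (F : bifunctor) :=
  exists cls : forall X Y : qbanach k, quasilinear X Y -> fspace F X Y,
    (forall X Y : qbanach k, is_quotient_map
       [set G : quasilinear X Y | trivial_map G] (@ql_norm R k X Y)
       (@cls X Y)) /\
    (forall (X X' Y Y' : qbanach k)
       (beta : operator Y Y') (gamma : operator X' X),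
       induced_by (@cls X Y) (@cls X' Y')
         (fun G G' => forall x, G' x = beta (G (gamma x)))
         (fact F beta gamma)).

(* The extensions of X by Y form a large type; Ext(X, Y) is presented through the
   map [cls] sending an extension to its equivalence class. *)
Definition is_Ext_functor (F : bifunctor) :=
  exists cls : forall X Y : qbanach k, extension X Y -> fspace F X Y,
    [/\ forall (X Y : qbanach k) (c : fspace F X Y), exists E, cls X Y E = c,
        forall (X Y : qbanach k) (E E' : extension X Y),
          cls X Y E = cls X Y E' <-> ext_equiv E E',
        (forall (X Y : qbanach k) (E : extension X Y), cls X Y E = 0 <-> ext_split E) /\
        (forall X Y : qbanach k, induced_by
          (fun E : extension X Y * extension X Y => (cls X Y E.1, cls X Y E.2))
          (@cls X Y) (fun E E' => baer_sum E.1 E.2 E')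
          (fun c => c.1 + c.2)) /\
        (forall (X Y : qbanach k) (a : scalar k), induced_by (@cls X Y) (@cls X Y)
          (pushout_ext (a *: op_id Y)) (fun c => a *: c)),
        forall (X Y : qbanach k) (E : extension X Y), (qnorm (cls X Y E))%:E =
          ereal_inf [set r | exists2 E', ext_equiv E E' & r = ext_rho E'] &
        forall (X X' Y Y' : qbanach k)
          (beta : operator Y Y') (gamma : operator X' X),
          induced_by (@cls X Y) (@cls X' Y')
            (fun E E' => exists E1 : extension X Y',
               pushout_ext beta E E1 /\ pullback_ext gamma E1 E')
            (fact F beta gamma)].

Variable P : forall X Y : qbanach k, presentation X Y.

(* The correspondence u |-> u' on representatives: E is the push-out P_(beta u)
   and V : ell_q'(I') -> P_(beta u) is a lifting of gamma \o pi', whose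
   restriction to K' takes the values of u' in Y'. *)
Definition varpi_action (X X' Y Y' : qbanach k)
    (beta : operator Y Y') (gamma : operator X' X)
    (u : operator (pr_ker (P X Y)) Y) (u' : operator (pr_ker (P X' Y')) Y') :=
  exists (E : extension X Y')
    (V : operator (ellq k (pr_index (P X' Y')) (pr_q (P X' Y'))) (mid E)),
    [/\ pushout_ext (op_comp beta u) (pr_ext (P X Y)) E,
        forall f, ext_p E (V f) = gamma (pr_map (P X' Y') f) &
        forall x, ext_i E (u' x) = V (pr_incl (P X' Y') x)].

Definition is_varpi_functor (F : bifunctor) :=
  exists cls : forall X Y : qbanach k, operator (pr_ker (P X Y)) Y -> fspace F X Y,
    (forall X Y : qbanach k, is_quotient_map
       [set op_comp v (pr_incl (P X Y)) | v in
         [set: operator (ellq k (pr_index (P X Y)) (pr_q (P X Y))) Y]]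
       (@op_norm R k (pr_ker (P X Y)) Y) (@cls X Y)) /\
    (forall (X X' Y Y' : qbanach k)
       (beta : operator Y Y') (gamma : operator X' X),
       induced_by (@cls X Y) (@cls X' Y')
         (varpi_action beta gamma) (fact F beta gamma)).

End Functors.

(* Main.v *)
From HB Require Import structures.
From mathcomp Require Import all_boot all_order all_algebra finmap complex ring lra.
From mathcomp Require Import all_classical all_reals all_analysis.
Require Import Defs.

(** Extensions and quasilinear maps carry the same information.  Given
0 -> Y -> Z -> X -> 0, take a bounded homogeneous section B and a linear section
L of Z -> X.  The difference B - L has values in the copy i(Y) of Y, so that
B - L = i F, where F is quasilinear because the defect F(x+y) - F(x) - F(y) is
that of B ([represents]).  Another B changes F by a bounded map and another L
changes it by a linear map, so the class of F in Q(X, Y) depends on the extension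
only.  Conversely F is represented by the twisted sum, Y x X with the quasi-norm
|y - F x| + |x| ([twisted_ext]).

The main dictionary is [ext_morP]: a morphism of extensions lying over given
operators beta on the subspaces and gamma on the quotients exists if and only if
beta F - F' gamma is within a bounded map of a linear one.  It turns equivalence,
splitting, push-outs, pull-backs and Baer sums of extensions into identities in
Q(X, Y).  The semi-quasi-norms agree exactly: as L is linear, the defect of B is
the defect of F, and when B runs over all bounded homogeneous sections F runs, up
to linear maps, which have no defect, over the whole class; hence
rho([E]) = Q([F]) ([ext_rhoE]).  So the functor Q, with extensions sent to their
classes in it, is itself a model of Ext.

For Ext^varpi, let omega represent 0 -> K -> l_q(I) -> X -> 0.  The push-out of
this sequence along u : K -> Y has the class of u omega, and [u] |-> [u omega] is
well defined and injective because u omega is trivial exactly when u extends to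
l_q(I) ([pushout_cls_eq0]).  It is onto with bounded inverse because quasilinear
maps from l_q(I) to a p-normable space, p > q, are within M Q(F) of a linear
map ([quasilinear_ellq_near_linear]): applied to F varpi this gives a linear T, and
u = T on K, where F varpi vanishes, satisfies |u| <= C Q(F) and u omega ~ F
([pushout_cls_lift]).  The completeness of Q(X, Y) follows, since it is an image
of the complete space of operators K -> Y ([Q_space_complete]).  Carried over to
Ext^varpi, the action of operators on Q is the one described by liftings, again
by [ext_morP] ([varpi_actionE]).

The estimate on l_q(I) is proved by bisection.  Let e(m) bound the p-norm of
F(f) - sum_i f_i F(e_i) for finitely supported f with sum |f_i|^q = m.  Cutting the
support at a coordinate into two parts of mass at most m/2 gives
e(m)^p <= c Q^p m^(p/q) + 2 e(m/2)^p, and 2 (1/2)^(p/q) < 1 because p > q; so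
e(m) <= M Q m^(1/q).  On all of l_q(I) the linear map is
T f = lim_s (F(f - f_s) + sum_(i in s) f_i F(e_i)), where f_s is the truncation of
f to the finite set s.

The bounded homogeneous sections, and the bounds on the inverse of i, come from
the open mapping theorem for quasi-Banach spaces; the linear sections and the
quotient spaces come from the existence of linear complements. *)

Set Implicit Arguments.
Unset Strict Implicit.
Unset Printing Implicit Defensive.

Import Order.TTheory GRing.Theory Num.Theory.
Import numFieldNormedType.Exports.
Local Open Scope classical_set_scope.
Local Open Scope ring_scope.

#[local] Hint Extern 0 (is_true (0 <= qnorm _)) => exact: qnorm_ge0 : core.

(** * Equalities in abelian groups *)

(** Reified sums and opposites, for the proof by reflection behind [abel]. *)
Inductive zexpr := ZVar of nat | ZZero | ZAdd of zexpr & zexpr | ZOpp of zexpr.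

Section Abel.
Variable V : zmodType.

Fixpoint zeval (e : seq V) (t : zexpr) : V :=
  match t with
  | ZVar n => nth 0 e n
  | ZZero => 0
  | ZAdd a b => zeval e a + zeval e b
  | ZOpp a => - zeval e a
  end.

(** The number of positive ([b] is true) or negative occurrences of a variable; keeping
the two counts apart avoids computing with signed integers. *)
Fixpoint zcoef (b : bool) (t : zexpr) (n : nat) : nat :=
  match t with
  | ZVar m => b && (n == m)
  | ZZero => 0
  | ZAdd s t => zcoef b s n + zcoef b t n
  | ZOpp s => zcoef (~~ b) s n
  end.

Let zsum (e : seq V) (f : nat -> nat) := \sum_(i < size e) nth 0 e i *+ f i.

Lemma zeval_coef e t :
  zeval e t = zsum e (zcoef true t) - zsum e (zcoef false t).
Proof.
have zsumD f g : zsum e (fun i => f i + g i)%N = zsum e f + zsum e g.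
  by rewrite /zsum -big_split; apply: eq_bigr => i _; rewrite mulrnDr.
have zsum0 : zsum e (fun=> 0%N) = 0 by rewrite /zsum big1.
elim: t => /= [n||s -> t ->|s ->].
- rewrite zsum0 subr0; have [ne|ne] := ltnP n (size e).
    rewrite /zsum (bigD1 (Ordinal ne))//= eqxx big1 ?addr0// => i.
    by rewrite -val_eqE /= => /negPf ->.
  rewrite nth_default// /zsum big1// => i _.
  by rewrite ltn_eqF//; exact: leq_trans ne.
- by rewrite zsum0 subr0.
- by rewrite !zsumD opprD addrACA.
- by rewrite opprB.
Qed.

Lemma zeval_eq e n s t : size e = n ->
  all (fun i => zcoef true s i + zcoef false t i ==
                zcoef true t i + zcoef false s i)%N (iota 0 n) ->
  zeval e s = zeval e t.
Proof.
move=> <- /allP H; rewrite !zeval_coef; apply/eqP; rewrite subr_eq addrAC eq_sym.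
rewrite subr_eq /zsum -!big_split; apply/eqP/eq_bigr => i _ /=.
by rewrite -!mulrnDr; congr (_ *+ _); apply/esym/eqP/H; rewrite mem_iota /=.
Qed.

End Abel.

(** Syntactically different atoms are also compared up to conversion: the same
term often arises with its operations taken from different structures. *)
Ltac zindex x l :=
  match l with
  | x :: _ => constr:(0%N)
  | ?y :: _ => let _ := constr:(erefl x : x = y) in constr:(0%N)
  | _ :: ?l' => let n := zindex x l' in constr:(S n)
  end.

Ltac zadd x l :=
  match l with
  | context [x :: _] => l
  | _ => let n := zindex x l in l
  | _ => constr:(x :: l)
  end.

Ltac zsize l :=
  lazymatch l with
  | _ :: ?l' => let n := zsize l' in constr:(S n)
  | _ => constr:(0%N)
  end.

Ltac zvars l t :=
  lazymatch t with
  | ?a + ?b => let l' := zvars l a in zvars l' b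
  | - ?a => zvars l a
  | 0 => l
  | ?x => zadd x l
  end.

Ltac zquote l t :=
  lazymatch t with
  | ?a + ?b => let a' := zquote l a in let b' := zquote l b in constr:(ZAdd a' b')
  | - ?a => let a' := zquote l a in constr:(ZOpp a')
  | 0 => constr:(ZZero)
  | ?x => let n := zindex x l in constr:(ZVar n)
  end.

(** Equalities valid in every abelian group.  The number of atoms is passed separately so
that only numbers are computed, never the atoms. *)
Ltac abel :=
  lazymatch goal with
  | |- @eq ?T ?s ?t =>
    let l := zvars (@nil T) s in
    let l := zvars l t in
    let s' := zquote l s in
    let t' := zquote l t in
    let n := zsize l in
    refine (@zeval_eq _ l n s' t' erefl _); vm_compute; reflexivity
  end.

(** * Bounded maps between semi-quasi-normed spaces *)

Section LinearMaps.
Variables (K : fieldType) (V W : lmodType K) (f : V -> W).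
Hypothesis fl : linear f.

Lemma linear_zero : f 0 = 0.
Proof. by have := fl (-1) 0 0; rewrite scaler0 addr0 scaleN1r addNr. Qed.

Lemma linear_scale a x : f (a *: x) = a *: f x.
Proof. by have := fl a x 0; rewrite !addr0 linear_zero addr0. Qed.

Lemma linear_add x y : f (x + y) = f x + f y.
Proof. by have := fl 1 x y; rewrite !scale1r. Qed.

Lemma linear_opp x : f (- x) = - f x.
Proof. by rewrite -scaleN1r linear_scale scaleN1r. Qed.

Lemma linear_sub x y : f (x - y) = f x - f y.
Proof. by rewrite linear_add linear_opp. Qed.

End LinearMaps.

Section Basics.
Variables (R : realType) (k : scalar_kind R).

Definition real_scalar : R -> scalar k :=
  match k return R -> scalar k with
  | RealScalars => fun r => r
  | ComplexScalars => fun r => complex.Complex r 0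
  end.

Lemma eq_ler (x y : R) : x = y -> x <= y.
Proof. by move->. Qed.

Lemma modulus_real_scalar r : modulus (real_scalar r) = `|r|.
Proof.
rewrite /real_scalar; case: k => //=.
by rewrite expr0n /= addr0 sqrtr_sqr.
Qed.

Lemma modulusV (a : scalar k) : modulus a^-1 = (modulus a)^-1.
Proof.
have [->|a0] := eqVneq a 0; first by rewrite invr0 !modulus0 invr0.
have am : modulus a != 0 by apply: contra a0 => /eqP/modulus0_eq0 ->.
by apply: (mulIf am); rewrite -modulusM !mulVf// modulus1.
Qed.

(** The inequality for the inverse scalar gives the converse one. *)
Lemma norm_homogeneous (V : lmodType (scalar k)) (N : V -> R) :
  (forall x, 0 <= N x) -> (forall a x, N (a *: x) <= modulus a * N x) ->
  forall a x, N (a *: x) = modulus a * N x.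
Proof.
move=> N0 NZ a x; apply/eqP; rewrite eq_le NZ /=.
have [->|a0] := eqVneq a 0; first by rewrite modulus0 mul0r.
have am : modulus a != 0 by apply: contra a0 => /eqP/modulus0_eq0 ->.
rewrite -{1}[x]scale1r -(mulVf a0) -scalerA.
apply: le_trans (ler_wpM2l (modulus_ge0 a) (NZ _ _)) _.
by rewrite modulusV mulrA mulfV// mul1r.
Qed.

Lemma qnormD_ge1 (X : sqspace k) : exists2 D : R,
  1 <= D & forall x y : X, qnorm (x + y) <= D * (qnorm x + qnorm y).
Proof.
have [D D0 HD] := qnormD X; exists (Num.max 1 D); first by rewrite le_max lexx.
move=> x y; apply: le_trans (HD x y) _; apply: ler_wpM2r.
  by rewrite addr_ge0 ?qnorm_ge0.
by rewrite le_max lexx orbT.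
Qed.

Lemma qnorm_eq0 (X : qbanach k) (x : X) : (qnorm x == 0) = (x == 0).
Proof.
by apply/eqP/eqP => [/qb_separated//|->]; exact: qnorm0.
Qed.

Lemma qnorm_gt0 (X : qbanach k) (x : X) : (0 < qnorm x) = (x != 0).
Proof. by rewrite lt_def qnorm_ge0 andbT qnorm_eq0. Qed.

Lemma qnorm_small_eq0 (X : qbanach k) (x : X) (C : R) :
  (forall e, 0 < e -> qnorm x <= C * e) -> x = 0.
Proof.
move=> H; apply: qb_separated; apply/eqP; rewrite eq_le qnorm_ge0 andbT.
apply/ler_addgt0Pl => e e0; rewrite addr0.
have C0 : 0 < `|C| + 1 by apply: ltr_wpDl.
apply: le_trans (H (e / (`|C| + 1)) (divr_gt0 e0 C0)) _.
rewrite mulrCA ler_piMr ?(ltW e0)// ler_pdivrMr// mul1r.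
by apply: le_trans (ler_norm C) _; rewrite lerDl.
Qed.

(** For a homogeneous map on a quasi-Banach space this is boundedness on the unit
ball; the global form is stable under composition without rescaling. *)
Definition lbounded (X Y : sqspace k) (f : X -> Y) :=
  exists2 M, 0 <= M & forall x, qnorm (f x) <= M * qnorm x.

Lemma homogeneous0 (X Y : sqspace k) (f : X -> Y) : homogeneous f -> f 0 = 0.
Proof. by move=> fh; rewrite -(scale0r (0 : X)) fh scale0r. Qed.

Lemma homogeneousN (X Y : sqspace k) (f : X -> Y) x :
  homogeneous f -> f (- x) = - f x.
Proof. by move=> fh; rewrite -scaleN1r fh scaleN1r. Qed.

Lemma linear_homogeneous (X Y : sqspace k) (f : X -> Y) :
  linear f -> homogeneous f.
Proof. by move=> fl a x; rewrite linear_scale. Qed.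

Lemma qnorm_rescale (X : sqspace k) (x : X) (d : R) : 0 < qnorm x -> 0 < d ->
  qnorm (real_scalar (d / qnorm x) *: x) = d.
Proof.
move=> x0 d0; rewrite qnormZ modulus_real_scalar ger0_norm.
  by rewrite divfK// gt_eqF.
by rewrite divr_ge0// ltW.
Qed.

(** A nonzero vector is rescaled to norm d; separation takes care of the others. *)
Lemma homogeneous_lbounded (X : qbanach k) (Y : sqspace k) (f : X -> Y) d e :
  homogeneous f -> 0 < d -> (forall x, qnorm x <= d -> qnorm (f x) <= e) ->
  forall x, qnorm (f x) <= e / d * qnorm x.
Proof.
move=> fh d0 H x.
have [->|] := eqVneq x 0; first by rewrite homogeneous0// !qnorm0 mulr0.
rewrite -qnorm_gt0 => x0.
have /H : qnorm (real_scalar (d / qnorm x) *: x) <= d by rewrite qnorm_rescale.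
rewrite fh qnormZ modulus_real_scalar ger0_norm; last first.
  by rewrite divr_ge0// ltW.
move=> H1.
rewrite -(ler_pM2l (divr_gt0 d0 x0)); apply: le_trans H1 _.
apply: eq_ler; field.
by rewrite !gt_eqF.
Qed.

Lemma bounded_on_ball_lbounded (X : qbanach k) (Y : sqspace k) (f : X -> Y) :
  homogeneous f -> bounded_on_ball f -> lbounded f.
Proof.
move=> fh [M HM]; exists M.
  by apply: le_trans (HM 0 _); rewrite ?homogeneous0 ?qnorm0.
move=> x; have := homogeneous_lbounded fh ltr01 HM x.
by rewrite divr1.
Qed.

Lemma lbounded_on_ball (X Y : sqspace k) (f : X -> Y) :
  lbounded f -> bounded_on_ball f.
Proof.
move=> [M M0 HM]; exists M => x x1; apply: le_trans (HM x) _.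
by rewrite ler_piMr.
Qed.

Lemma op_linear (X Y : sqspace k) (u : operator X Y) : linear u.
Proof. by have /is_operatorP[] := op_funP u. Qed.

Lemma op_homogeneous (X Y : sqspace k) (u : operator X Y) : homogeneous u.
Proof. exact: linear_homogeneous (op_linear u). Qed.

Lemma op_lbounded (X : qbanach k) (Y : sqspace k) (u : operator X Y) :
  lbounded u.
Proof.
have /qcontinuousP/(_ 0 _ ltr01)[d d0 Hd] := @op_continuous _ _ _ _ u.
exists (1 / d); first by rewrite divr_ge0 // ltW.
apply: homogeneous_lbounded => //; first exact: op_homogeneous.
move=> x xd; have := Hd x; rewrite linear0 !sub0r !qnormN; exact.
Qed.

Lemma lbounded_operator (X Y : sqspace k) (f : X -> Y) : linear f ->
  lbounded f -> exists u : operator X Y, u =1 f.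
Proof.
by move=> fl [M _ HM]; exists (Operator (bounded_is_operator fl HM)).
Qed.

Lemma lboundedD (X Y : sqspace k) (f g : X -> Y) :
  lbounded f -> lbounded g -> lbounded (fun x => f x + g x).
Proof.
move=> [M M0 HM] [N N0 HN]; have [D D1 HD] := qnormD_ge1 Y.
have D0 : 0 <= D by apply: le_trans D1.
exists (D * (M + N)); first by rewrite mulr_ge0// addr_ge0.
move=> x; apply: le_trans (HD _ _) _; rewrite -mulrA ler_wpM2l//.
by rewrite mulrDl lerD.
Qed.

Lemma lboundedN (X Y : sqspace k) (f : X -> Y) :
  lbounded f -> lbounded (fun x => - f x).
Proof. by move=> [M M0 HM]; exists M => // x; rewrite qnormN. Qed.

Lemma lboundedZ (X Y : sqspace k) (a : scalar k) (f : X -> Y) :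
  lbounded f -> lbounded (fun x => a *: f x).
Proof.
move=> [M M0 HM]; exists (modulus a * M); first by rewrite mulr_ge0 ?modulus_ge0.
by move=> x; rewrite qnormZ -mulrA ler_wpM2l ?modulus_ge0.
Qed.

Lemma lboundedB (X Y : sqspace k) (f g : X -> Y) :
  lbounded f -> lbounded g -> lbounded (fun x => f x - g x).
Proof. by move=> bf bg; apply: lboundedD => //; exact: lboundedN. Qed.

Lemma lbounded_comp (X Y Z : sqspace k) (g : Y -> Z) (f : X -> Y) :
  lbounded g -> lbounded f -> lbounded (fun x => g (f x)).
Proof.
move=> [M M0 HM] [N N0 HN]; exists (M * N); first exact: mulr_ge0.
by move=> x; apply: le_trans (HM _) _; rewrite -mulrA ler_wpM2l.
Qed.

Lemma eq_lbounded (X Y : sqspace k) (f g : X -> Y) :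
  f =1 g -> lbounded f -> lbounded g.
Proof. by move=> /funext ->. Qed.

Lemma lbounded_id (X : sqspace k) : lbounded (fun x : X => x).
Proof. by exists 1 => // x; rewrite mul1r. Qed.

(** All the limits below are geometric: this is how their rest terms are absorbed. *)
Lemma exprn_small (M c e : R) : 0 <= c < 1 -> 0 < e ->
  exists n, M * c ^+ n <= e.
Proof.
move=> /andP[c0 c1] e0.
have : (fun n => M * c ^+ n) @ \oo --> M * 0.
  by apply: cvgMr; apply: cvg_expr; rewrite ger0_norm.
rewrite mulr0 => /cvgrPdist_le/(_ e e0)[n _ Hn]; exists n.
by have := Hn n (leqnn n); rewrite sub0r normrN; apply: le_trans; exact: ler_norm.
Qed.

End Basics.

(** * The open mapping theorem for quasi-Banach spaces *)

Section OpenMapping.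
Variables (R : realType) (k : scalar_kind R).

(** In a quasi-normed space a series converges when its terms decay at a rate c that
beats the constant D of the quasi-triangle inequality, here c = 1/(2D): a sum of
n terms costs D^n.  The rest is then dominated by its first term, uniformly in
the sequence. *)
Lemma geometric_limit (X : sqbanach k) : exists c A : R,
  [/\ 0 < c, c < 1, 0 <= A & forall (x : nat -> X) (r : nat -> R),
    (forall n, 0 <= r n) -> (forall n, r n.+1 <= c * r n) ->
    (forall n, qnorm (x n.+1 - x n) <= r n) ->
    exists l, forall n, qnorm (l - x n) <= A * r n].
Proof.
have [D D1 HD] := qnormD_ge1 X.
have D0 : 0 < D by apply: lt_le_trans D1.
have D20 : 0 < 2 * D by rewrite mulr_gt0.
exists (2 * D)^-1, (D * (2 * D)); split.
- by rewrite invr_gt0.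
- by rewrite invf_lt1//; lra.
- by rewrite mulr_ge0 ?ltW.
move=> x r r0 rc xr.
have tail m n : qnorm (x (n + m)%N - x n) <= 2 * D * r n.
  elim: m n => [|m IH] n; first by rewrite addn0 subrr qnorm0 mulr_ge0// ltW.
  rewrite addnS -addSn -(subrKA (x n.+1)); apply: le_trans (HD _ _) _.
  have -> : 2 * D * r n = D * (r n + r n) by ring.
  apply: (ler_wpM2l (ltW D0)); apply: lerD (xr n).
  apply: le_trans (IH _) _; rewrite -ler_pdivlMl//; exact: rc.
have rn n : r n <= r 0%N * (2 * D)^-1 ^+ n.
  elim: n => [|n IH]; first by rewrite expr0 mulr1.
  apply: le_trans (rc n) _; rewrite exprS mulrCA ler_wpM2l//.
  by rewrite invr_ge0 ltW.
have rsmall e : 0 < e -> exists n, r n <= e.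
  move=> e0; have [|n Hn] := @exprn_small _ (r 0%N) (2 * D)^-1 e _ e0.
    by rewrite invr_ge0 (ltW D20) /= invf_lt1//; lra.
  by exists n; exact: le_trans (rn n) Hn.
pose F : set_system (qtop X) := (x : nat -> qtop X) @ \oo.
have FF : ProperFilter F by exact: fmap_proper_filter.
have /sqb_complete/cvg_ex[l /qcvgP Fl] : cauchy F.
  apply/qcauchyP => e e0.
  have e1 : 0 < e / (D * (2 * (2 * D))) by rewrite divr_gt0// !mulr_gt0.
  have [n Hn] := rsmall _ e1.
  exists (x @` [set i | (n <= i)%N]).
    by exists n => // i ni; exists i.
  move=> _ _ [i /= ni <-] [j /= nj <-]; rewrite -(subrKA (x n)).
  apply: le_trans (HD _ _) _; rewrite (qnormB (x n)).
  have := tail (i - n)%N n; have := tail (j - n)%N n; rewrite !subnKC// => Hj Hi.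
  apply: le_trans (ler_wpM2l (ltW D0) (lerD Hi Hj)) _.
  have : D * (2 * (2 * D)) * r n <= e.
    by rewrite mulrC -ler_pdivlMr// !mulr_gt0.
  by apply: le_trans; apply: eq_ler; ring.
exists l => n; apply/ler_addgt0Pr => e e0.
have [m _ Hm] := Fl _ (divr_gt0 e0 D0).
have := Hm (maxn m n) (leq_maxl _ _) => /= lm.
rewrite -(subrKA (x (maxn m n))); apply: le_trans (HD _ _) _.
have := tail (maxn m n - n)%N n; rewrite subnKC ?leq_maxr// => xm.
apply: le_trans (ler_wpM2l (ltW D0) (lerD lm xm)) _.
by apply: eq_ler; field; rewrite gt_eqF.
Qed.

(** The argument of Baire: if no closure of the image of the ball of radius n
contains a ball, one constructs nested balls that avoid these images one after the
other, and their common point is not in the image of T.  Translating and rescaling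
the ball found in this way approximates every vector. *)
Lemma almost_open (Z X : qbanach k) (T : operator Z X) :
  (forall x, exists z, T z = x) ->
  exists2 C, 0 <= C & forall x e, 0 < e ->
    exists z, qnorm z <= C * qnorm x /\ qnorm (x - T z) <= e.
Proof.
move=> Tsurj; have [c [A [c0 c1 A0 lim]]] := geometric_limit X.
have A1 : 0 < A + 1 by rewrite ltr_wpDl.
have [DZ DZ1 HDZ] := qnormD_ge1 Z; have [DX DX1 HDX] := qnormD_ge1 X.
have DZ0 : 0 < DZ by apply: lt_le_trans DZ1.
have DX0 : 0 < DX by apply: lt_le_trans DX1.
have [n [x0 [r [r0 H]]]] : exists (n : nat) x0 r, 0 < r /\ forall x,
    qnorm (x - x0) <= r ->
    forall e, 0 < e -> exists z, qnorm z <= n%:R /\ qnorm (x - T z) <= e.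
  apply: contrapT => nH.
  (* A pair is a center and a radius.  The factor A + 1 leaves room for the distance
     A r between a center and the limit of the later ones. *)
  have step (n : nat) (s : X * {posnum R}) : exists s' : X * {posnum R},
      [/\ qnorm (s'.1 - s.1) <= s.2%:num, s'.2%:num <= c * s.2%:num &
        forall z, qnorm z <= n%:R -> (A + 1) * s'.2%:num < qnorm (s'.1 - T z)].
    apply: contrapT => ns; apply: nH; exists n, s.1, s.2%:num; split=> // x xs e e0.
    apply: contrapT => nz; apply: ns.
    have d0 : 0 < Num.min (c * s.2%:num) (e / (A + 1)).
      by rewrite lt_min mulr_gt0//= divr_gt0.
    exists (x, PosNum d0); split=> //=; first by rewrite ge_min lexx.
    move=> z zn; rewrite ltNge; apply/negP => H; apply: nz; exists z; split=> //.
    apply: le_trans H _; rewrite mulrC -ler_pdivlMr//.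
    by rewrite ge_min lexx orbT.
  have [g Hg] := choice (fun ns : nat * (X * {posnum R}) => step ns.1 ns.2).
  pose s := fix s n := if n is m.+1 then g (m, s m) else (0, PosNum (@ltr01 R)).
  have sS n : s n.+1 = g (n, s n) by [].
  have [||| l Hl] := lim (fun n => (s n).1) (fun n => (s n).2%:num).
  - by move=> n.
  - by move=> n; rewrite sS; case: (Hg (n, s n)).
  - by move=> n; rewrite sS; case: (Hg (n, s n)).
  have [z Tz] := Tsurj l.
  have [n zn] : exists n : nat, qnorm z <= n%:R.
    by exists (Num.truncn (qnorm z)).+1; apply/ltW; exact: truncnS_gt.
  have [_ _ /(_ z zn)] := Hg (n, s n).
  rewrite -sS Tz qnormB ltNge => /negP; apply.
  by apply: le_trans (Hl _) _; rewrite ler_wpM2r// lerDl.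
exists (2 * DZ * n%:R / r).
  by rewrite divr_ge0 ?(ltW r0)// mulr_ge0// mulr_ge0// ltW.
have ball w e : qnorm w <= r -> 0 < e ->
    exists z, qnorm z <= 2 * DZ * n%:R /\ qnorm (w - T z) <= e.
  move=> wr e0; have e1 : 0 < e / (2 * DX) by rewrite divr_gt0// mulr_gt0.
  have [|z1 [z1n Hz1]] := H (x0 + w) _ _ e1; first by rewrite addrC addKr.
  have [|z2 [z2n Hz2]] := H x0 _ _ e1; first by rewrite subrr qnorm0 ltW.
  exists (z1 - z2); split.
    apply: le_trans (HDZ _ _) _; rewrite qnormN [2 * _]mulrC -mulrA.
    by rewrite (ler_wpM2l (ltW DZ0))// mulr2n mulrDl mul1r lerD.
  have -> : w - T (z1 - z2) = (x0 + w - T z1) - (x0 - T z2).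
    by rewrite linearB /=; abel.
  apply: le_trans (HDX _ _) _; rewrite qnormN.
  apply: le_trans (ler_wpM2l (ltW DX0) (lerD Hz1 Hz2)) _.
  apply: eq_ler; field; exact: lt0r_neq0.
move=> x e e0; have [->|] := eqVneq x 0.
  by exists 0; rewrite linear0 subr0 !qnorm0 mulr0; split=> //; exact: ltW.
rewrite -qnorm_gt0 => x_gt0.
pose a := r / qnorm x; have a0 : 0 < a by rewrite divr_gt0.
have ma : modulus (real_scalar k a) = a.
  by rewrite modulus_real_scalar gtr0_norm.
have an0 : real_scalar k a != 0.
  by apply/eqP => ha; move: ma a0; rewrite ha modulus0 => <-; rewrite ltxx.
have [||z [zn Hz]] := ball (real_scalar k a *: x) (a * e).
- by rewrite qnorm_rescale.
- exact: mulr_gt0.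
exists ((real_scalar k a)^-1 *: z); split.
  rewrite qnormZ modulusV ma ler_pdivrMl// /a; apply: le_trans zn _.
  apply: eq_ler; field.
  by rewrite !gt_eqF.
rewrite -(ler_pM2l a0) -{1}ma -qnormZ scalerBr -linearZ /= scalerA mulfV//.
by rewrite scale1r.
Qed.

(** The error of the approximate preimage given by [almost_open] is corrected by
further approximate preimages, geometrically smaller. *)
Theorem open_mapping (Z X : qbanach k) (T : operator Z X) :
  (forall x, exists z, T z = x) ->
  exists2 C, 0 <= C & forall x, exists2 z, T z = x & qnorm z <= C * qnorm x.
Proof.
move=> /almost_open[C C0 HC]; have [c [A [c0 c1 A0 lim]]] := geometric_limit Z.
have [DX DX1 HDX] := qnormD_ge1 X; have DX0 : 0 < DX by apply: lt_le_trans DX1.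
have [M M0 HM] := op_lbounded T.
exists (A * C); first exact: mulr_ge0.
move=> x; have [->|] := eqVneq x 0.
  by exists 0; rewrite ?linear0// !qnorm0 mulr0.
rewrite -qnorm_gt0 => x0.
have step (ns : nat * Z) : exists z, qnorm z <= C * qnorm (x - T ns.2) /\
    qnorm (x - T ns.2 - T z) <= qnorm x * c ^+ ns.1.+1.
  by apply: HC; rewrite mulr_gt0// exprn_gt0.
have [g Hg] := choice step.
pose s := fix s n := if n is m.+1 then s m + g (m, s m) else 0.
have res n : qnorm (x - T (s n)) <= qnorm x * c ^+ n.
  case: n => [|n]; first by rewrite linear0 subr0 expr0 mulr1.
  by have [_] := Hg (n, s n); rewrite /= linearD /= opprD addrA.
have [||| z Hz] := lim s (fun n => C * (qnorm x * c ^+ n)).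
- by move=> n; rewrite !mulr_ge0 ?exprn_ge0 ?qnorm_ge0// ltW.
- move=> n; rewrite exprS le_eqVlt; apply/orP; left; apply/eqP; ring.
- move=> n; rewrite /= addrC addKr; have [+ _] := Hg (n, s n).
  by move/le_trans; apply; rewrite ler_wpM2l// res.
exists z; last first.
  by have := Hz 0%N; rewrite subr0 expr0 mulr1 mulrA.
apply/esym/eqP; rewrite -subr_eq0; apply/eqP.
apply: (@qnorm_small_eq0 _ _ _ _ (DX * (1 + M * A * C))) => e e0.
have [|n Hn] := @exprn_small _ (qnorm x) c e _ e0; first by rewrite ltW.
rewrite -(subrKA (T (s n))); apply: le_trans (HDX _ _) _.
rewrite -mulrA (ler_wpM2l (ltW DX0))// mulrDl mul1r lerD//; first exact: le_trans Hn.
rewrite -linearB; apply: le_trans (HM _) _; rewrite qnormB -!mulrA ler_wpM2l//.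
by apply: le_trans (Hz n) _; rewrite !ler_wpM2l.
Qed.

(** The range is the kernel of p, hence complete, and the open mapping theorem applies
to the corestriction of i. *)
Lemma injective_closed_range (Y Z X : qbanach k) (i : operator Y Z)
    (p : operator Z X) : injective i ->
  (forall z, p z = 0 <-> exists y, i y = z) ->
  exists2 C, 0 <= C & forall y, qnorm y <= C * qnorm (i y).
Proof.
move=> i_inj ex.
have iK y : i y \in in_ker p by apply/eqP/ex; exists y.
pose j y : ker p := @Ker _ _ _ _ p (i y) (iK y).
have [M M0 HM] := op_lbounded i.
have [|u ju] := @lbounded_operator _ _ _ _ j _ (ex_intro2 _ _ M M0 HM).
  by move=> a x y; apply: val_inj; rewrite /= linearP.
have [|C C0 HC] := @open_mapping _ _ u.
  move=> z; have /ex[y yz] : p (ker_val z) = 0 by apply/eqP; exact: ker_valP.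
  by exists y; rewrite ju; apply: val_inj.
exists C => // y; have [y' + H] := HC (j y).
rewrite ju => /(congr1 (@ker_val _ _ _ _ p)) /i_inj y'y.
by rewrite -{1}y'y; exact: H.
Qed.

End OpenMapping.

(** * Factorizations, linear complements and quotients *)

Section Factorizations.
Variables (R : realType) (k : scalar_kind R).

(** Continuity of the induced map holds because a preimage under s can be chosen of
comparable norm. *)
Lemma operator_factor (A Z W : qbanach k) (s : operator A Z) (g : operator A W) :
  (forall z, exists a, s a = z) -> (forall a, s a = 0 -> g a = 0) ->
  exists h : operator Z W, forall a, h (s a) = g a.
Proof.
move=> s_surj sg; have [C C0 HC] := open_mapping s_surj.
have /choice[r Hr] z : exists a, s a = z /\ qnorm a <= C * qnorm z.
  by have [a az aC] := HC z; exists a.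
have rs a : g (r (s a)) = g a.
  apply/eqP; rewrite -subr_eq0 -linearB; apply/eqP/sg.
  by rewrite linearB /= (Hr _).1 subrr.
have [||h hE] := @lbounded_operator _ _ Z W (fun z => g (r z)).
- move=> a x y; have -> : a *: x + y = s (a *: r x + r y).
    by rewrite linearP /= !(Hr _).1.
  by rewrite rs linearP.
- apply: lbounded_comp; first exact: op_lbounded.
  by exists C => // z; case: (Hr z).
by exists h => a; rewrite hE.
Qed.

Lemma operator_lift (A X Z W : qbanach k) (s : operator Z A) (v : operator A X)
    (g : operator W A) : injective s ->
  (forall a, v a = 0 <-> exists z, s z = a) -> (forall w, v (g w) = 0) ->
  exists h : operator W Z, forall w, s (h w) = g w.
Proof.
move=> s_inj ex vg; have [C C0 HC] := injective_closed_range s_inj ex.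
have [r Hr] := choice (fun w => (ex (g w)).1 (vg w)).
have [||h hE] := @lbounded_operator _ _ W Z r.
- by move=> a x y; apply: s_inj; rewrite linearP /= !Hr linearP.
- have [M M0 HM] := op_lbounded g.
  exists (C * M); first exact: mulr_ge0.
  move=> w; apply: le_trans (HC _) _; rewrite Hr -mulrA.
  exact: ler_wpM2l.
by exists h => w; rewrite hE.
Qed.

End Factorizations.

(** A maximal subspace S meeting N only at 0 is a complement: a vector outside S + N
could be adjoined to it.  The map p is the projection onto S along N. *)
Lemma subspace_complement (K : fieldType) (V : lmodType K) (N : set V) :
  N 0 -> (forall a x y, N x -> N y -> N (a *: x + y)) ->
  exists p : V -> V, [/\ linear p, forall v, N (v - p v) &
    forall v, N v -> p v = 0].
Proof.
move=> N0 Nlin.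
pose P (S : set V) := (forall a x y, S x -> S y -> S (a *: x + y)) /\
  forall x, S x -> N x -> x = 0.
have [F FP tot|S [[Slin SN] Smax]] := @Zorn_bigcup V P.
  split=> [a x y [A FA Ax] [B FB By]|x [A FA Ax]]; last exact: (FP A FA).2.
  have [AB|BA] := tot _ _ FA FB.
    by exists B => //; apply: (FP B FB).1 => //; exact: AB.
  by exists A => //; apply: (FP A FA).1 => //; exact: BA.
(* A maximal S could be empty, since P does not ask for 0. *)
pose S0 x := S x \/ x = 0.
have S0lin a x y : S0 x -> S0 y -> S0 (a *: x + y).
  move=> [Sx|->] [Sy|->].
  - by left; exact: Slin.
  - by left; apply: (Slin) => //; rewrite -(addNr x) -scaleN1r; exact: Slin.
  - by left; rewrite scaler0 add0r.
  - by right; rewrite scaler0 addr0.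
have S0N x : S0 x -> N x -> x = 0 by move=> [/SN|].
have cover v : exists s, S0 s /\ N (v - s).
  apply: contrapT => nv.
  have vS : ~ S0 v by move=> Sv; apply: nv; exists v; rewrite subrr.
  pose A x := exists a s, S0 s /\ x = a *: v + s.
  apply: (Smax A); first split.
  - by move=> x Sx; exists 0, x; rewrite scale0r add0r; split=> //; left.
  - move=> AS; apply: vS; left; apply: AS; exists 1, 0.
    by rewrite scale1r addr0; split=> //; right.
  split=> [a x y [b [s [Ss ->]]] [c [t [St ->]]]|x [a [s [Ss ->]]] Nas].
    exists (a * b + c), (a *: s + t); split; first exact: S0lin.
    by rewrite scalerDr scalerDl scalerA addrACA.
  have [a0|a0] := eqVneq a 0.
    by move: Nas; rewrite a0 scale0r add0r; exact: S0N.
  case: nv; exists (- a^-1 *: s); split.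
    by rewrite -[_ *: s]addr0; apply: S0lin => //; right.
  have := Nlin a^-1 _ _ Nas N0.
  by rewrite addr0 scalerDr scalerA mulVf// scale1r scaleNr opprK.
have [p Hp] := choice cover.
have puniq v s : S0 s -> N (v - s) -> p v = s.
  move=> Ss Ns; apply/eqP; rewrite -subr_eq0; apply/eqP/S0N.
    by rewrite addrC -scaleN1r; apply: S0lin => //; case: (Hp v).
  have := Nlin (-1) _ _ (Hp v).2 Ns; congr N.
  by rewrite scaleN1r; abel.
exists p; split=> [a x y|v|v Nv]; last 2 first.
- by case: (Hp v).
- by apply: puniq; [right|rewrite subr0].
apply: puniq; first exact: S0lin (Hp x).1 (Hp y).1.
have := Nlin a _ _ (Hp x).2 (Hp y).2; congr N.
by rewrite scalerBr; abel.
Qed.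

(** A preimage of w projected along the kernel onto a complement depends on w only. *)
Lemma linear_section (K : fieldType) (V W : lmodType K) (T : V -> W) :
  linear T -> (forall w, exists v, T v = w) ->
  exists2 L : W -> V, linear L & forall w, T (L w) = w.
Proof.
move=> Tl Ts.
have [| |p [pl pN p0]] := @subspace_complement _ V [set v | T v = 0].
- exact: linear_zero.
- by move=> a x y /= Tx Ty; rewrite Tl Tx Ty scaler0 addr0.
have [r Hr] := choice Ts.
have rp w v : T v = w -> p (r w) = p v.
  move=> Tv; apply/eqP; rewrite -subr_eq0 -linear_sub//; apply/eqP/p0 => /=.
  by rewrite linear_sub// Hr Tv subrr.
exists (fun w => p (r w)) => [a x y|w].
  by rewrite -pl; apply: rp; rewrite Tl !Hr.
have /eqP := pN (r w); rewrite /= linear_sub// subr_eq0 => /eqP <-; exact: Hr.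
Qed.

Section CompleteImage.
Variables (R : realType) (k : scalar_kind R).

(** A Cauchy filter is replaced by a fast Cauchy sequence of W, which lifts to a
fast Cauchy sequence of V.  The tolerance e is needed since an infimum, such as the
norm of a quotient, need not be attained. *)
Lemma complete_image (V W : sqspace k) (T : V -> W) (C : R) :
  qcomplete V -> linear T -> lbounded T ->
  (forall w e, 0 < e -> exists2 v, T v = w & qnorm v <= C * qnorm w + e) ->
  qcomplete W.
Proof.
move=> Vc Tl [M M0 HM] Tlift F FF /qcauchyP Fc.
have [c [A [c0 c1 A0 lim]]] := geometric_limit (SQBanach Vc).
have [D D1 HD] := qnormD_ge1 W; have D0 : 0 < D by apply: lt_le_trans D1.
have /choice[a Ha] n : exists S, F S /\
    forall x y : W, S x -> S y -> qnorm (x - y) <= c ^+ n.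
  by have [S FS HS] := Fc _ (exprn_gt0 n c0); exists S.
have [w Hw] := choice (fun n => filter_ex (Ha n).1).
have wS n : qnorm (w n.+1 - w n) <= 2 * D * c ^+ n.
  have [y [yn yn1]] := filter_ex (filterI (Ha n).1 (Ha n.+1).1).
  rewrite -(subrKA y); apply: le_trans (HD _ _) _.
  have -> : 2 * D * c ^+ n = D * (c ^+ n + c ^+ n) by ring.
  rewrite ler_wpM2l ?(ltW D0)// lerD//; last exact: (Ha n).2.
  apply: le_trans ((Ha n.+1).2 _ _ (Hw _) yn1) _.
  by rewrite exprS ler_piMl ?exprn_ge0 ?ltW.
pose B := `|C| * (2 * D) + 1.
have B0 : 0 <= B by rewrite addr_ge0// mulr_ge0// mulr_ge0// ltW.
have step n : exists v, T v = w n.+1 - w n /\ qnorm v <= B * c ^+ n.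
  have [v Tv vC] := Tlift (w n.+1 - w n) (c ^+ n) (exprn_gt0 n c0).
  exists v; split=> //; apply: le_trans vC _.
  rewrite mulrDl mul1r lerD2r -mulrA.
  apply: le_trans (ler_wpM2r (qnorm_ge0 _) (ler_norm C)) _.
  by rewrite ler_wpM2l.
have [d Hd] := choice step; have [v0 Tv0 _] := Tlift (w 0%N) 1 ltr01.
pose v := fix v n := if n is m.+1 then v m + d m else v0.
have Tv n : T (v n) = w n.
  elim: n => //= n IH; rewrite linear_add// IH (Hd n).1; abel.
have [||| l Hl] := lim v (fun n => B * c ^+ n).
- by move=> n; rewrite mulr_ge0// exprn_ge0// ltW.
- by move=> n; rewrite exprS mulrCA.
- by move=> n; rewrite /= addrC addKr; exact: (Hd n).2.
apply/cvg_ex; exists (T l : qtop W); apply/qcvgP => e e0.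
have [|n Hn] := @exprn_small _ (D * (M * (A * B) + 1)) c e _ e0; first by rewrite ltW.
apply: filterS (Ha n).1 => y yn /=.
rewrite -(subrKA (w n)); apply: le_trans (HD _ _) _; apply: le_trans Hn.
rewrite -mulrA ler_wpM2l ?(ltW D0)// mulrDl mul1r lerD//; last exact: (Ha n).2.
rewrite -Tv -linear_sub//; apply: le_trans (HM _) _; rewrite -!mulrA ler_wpM2l//.
Qed.

End CompleteImage.

Section Quotient.
Variables (R : realType) (k : scalar_kind R) (V : sqspace k).
Variables (N : set V) (N0 : N 0).
Variable (Nlin : forall a x y, N x -> N y -> N (a *: x + y)).

(** The quotient of V by N is realized on a linear complement of N, the set of fixed
points of a projection with kernel N; so it inherits its algebraic structure as a
subspace of V. *)
Definition qproj : V -> V := projT1 (cid (subspace_complement N0 Nlin)).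

Lemma qproj_linear : linear qproj.
Proof. by rewrite /qproj; case: cid => p []. Qed.

Lemma qproj_mod v : N (v - qproj v).
Proof. by rewrite /qproj; case: cid => p []. Qed.

Lemma qproj_eq0 v : qproj v = 0 <-> N v.
Proof.
split=> [p0|]; first by have := qproj_mod v; rewrite p0 subr0.
by rewrite /qproj; case: cid => p /= [_ _ p0]; exact: p0.
Qed.

Lemma qprojK v : qproj (qproj v) = qproj v.
Proof.
apply/eqP; rewrite eq_sym -subr_eq0 -linear_sub; last exact: qproj_linear.
exact/eqP/qproj_eq0/qproj_mod.
Qed.

Definition in_quot : {pred V} := fun v => qproj v == v.

Record quot_car := Quot { quot_val :> V; quot_valP : quot_val \in in_quot }.

Let in_quot_submod : submod_closed in_quot.
Proof.
split=> [|a x y]; rewrite !unfold_in.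
  by apply/eqP/qproj_eq0.
by move=> /eqP xp /eqP yp; rewrite qproj_linear xp yp.
Qed.

HB.instance Definition _ :=
  GRing.isSubmodClosed.Build (scalar k) V in_quot in_quot_submod.
HB.instance Definition _ := [isSub for quot_val].
HB.instance Definition _ := [Choice of quot_car by <:].
HB.instance Definition _ := [SubChoice_isSubLmodule of quot_car by <:].

Definition quot_cls (v : V) : quot_car :=
  @Quot (qproj v) (introT eqP (qprojK v)).

Lemma quot_cls_linear : linear quot_cls.
Proof. by move=> a x y; apply: val_inj; rewrite /= qproj_linear. Qed.

Lemma quot_clsE v v' : quot_cls v = quot_cls v' <-> N (v - v').
Proof.
rewrite -qproj_eq0 linear_sub; last exact: qproj_linear.
split=> [/(congr1 quot_val) /= ->|/eqP]; first by rewrite subrr.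
by rewrite subr_eq0 => /eqP vv'; apply: val_inj.
Qed.

Lemma quot_cls_eq0 v : quot_cls v = 0 <-> N v.
Proof.
rewrite -qproj_eq0; split=> [/(congr1 quot_val)//|v0]; exact: val_inj.
Qed.

Lemma quot_valK w : quot_cls (quot_val w) = w.
Proof. by apply: val_inj; apply/eqP; exact: quot_valP. Qed.

Definition quot_norm (w : quot_car) : R :=
  inf [set qnorm v | v in [set v : V | quot_cls v = w]].

Lemma quot_norm_le v : quot_norm (quot_cls v) <= qnorm v.
Proof.
apply: ge_inf; last by exists v.
by exists 0 => _ [v' _ <-]; exact: qnorm_ge0.
Qed.

Lemma le_quot_norm w r : (forall v, quot_cls v = w -> r <= qnorm v) ->
  r <= quot_norm w.
Proof.
move=> H; apply: lb_le_inf; first by exists (qnorm (quot_val w)), (quot_val w);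
  rewrite //= quot_valK.
by move=> _ [v /= vw <-]; exact: H.
Qed.

Lemma le_quot_normM w r M : 0 <= M ->
  (forall v, quot_cls v = w -> r <= M * qnorm v) -> r <= M * quot_norm w.
Proof.
move=> M0 H; have [M00|Mn0] := eqVneq M 0.
  by have := H _ (quot_valK w); rewrite M00 !mul0r.
have {Mn0}M0 : 0 < M by rewrite lt_def Mn0.
rewrite -ler_pdivrMl//; apply: le_quot_norm => v /H.
by rewrite ler_pdivrMl.
Qed.

Lemma quot_norm_lift w e : 0 < e ->
  exists2 v, quot_cls v = w & qnorm v <= quot_norm w + e.
Proof.
move=> e0; apply: contrapT => nH.
have : quot_norm w + e <= quot_norm w.
  apply: le_quot_norm => v vw; rewrite leNgt; apply/negP => ve.
  by apply: nH; exists v => //; exact: ltW.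
by rewrite gerDl leNgt e0.
Qed.

HB.instance Definition _ :=
  GRing.isLinear.Build (scalar k) V quot_car *:%R quot_cls quot_cls_linear.

Lemma quot_normP : is_semi_quasi_norm quot_norm.
Proof.
have ge0 w : 0 <= quot_norm w by apply: le_quot_norm => v _; exact: qnorm_ge0.
have Zle a w : quot_norm (a *: w) <= modulus a * quot_norm w.
  apply/ler_addgt0Pr => e e0.
  have m0 : 0 < modulus a + 1 by rewrite ltr_wpDl ?modulus_ge0.
  have [v vw Hv] := quot_norm_lift w (divr_gt0 e0 m0).
  rewrite -{1}vw -linearZ; apply: le_trans (quot_norm_le _) _; rewrite qnormZ.
  apply: le_trans (ler_wpM2l (modulus_ge0 a) Hv) _.
  rewrite mulrDr lerD2l mulrA ler_pdivrMr// mulrC ler_wpM2l ?(ltW e0)//.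
  by rewrite lerDl.
split=> //.
  exact: norm_homogeneous.
have [D D0 HD] := qnormD V; exists D => x y.
have D20 : 0 < D * 2 by rewrite mulr_gt0.
apply/ler_addgt0Pr => e e0.
have [v vx Hv] := quot_norm_lift x (divr_gt0 e0 D20).
have [u uy Hu] := quot_norm_lift y (divr_gt0 e0 D20).
rewrite -{1}vx -{1}uy -linearD; apply: le_trans (quot_norm_le _) _.
apply: le_trans (HD _ _) _; apply: le_trans (ler_wpM2l (ltW D0) (lerD Hv Hu)) _.
by apply: eq_ler; field; rewrite gt_eqF.
Qed.

Definition quot_space : sqspace k := SQSpace quot_normP.

Lemma quot_cls_bounded : lbounded (quot_cls : V -> quot_space).
Proof. by exists 1 => // v; rewrite mul1r; exact: quot_norm_le. Qed.

Lemma quot_is_quotient_map :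
  is_quotient_map N (@qnorm _ _ V) (quot_cls : V -> quot_space).
Proof.
split; first exact: quot_cls_linear.
- by move=> w; exists (quot_val w); exact: quot_valK.
- exact: quot_cls_eq0.
- move=> v; congr (inf _); rewrite predeqE => r; split=> -[v' Hv' <-]; exists v' => //=.
  + by apply/quot_clsE; rewrite Hv'.
  + by apply/esym/quot_clsE.
Qed.

(** The class map satisfies the hypothesis of [complete_image] by the definition of the
quotient norm as an infimum. *)
Lemma quot_complete : qcomplete V -> qcomplete quot_space.
Proof.
move=> Vc; apply: (@complete_image _ _ V quot_space quot_cls 1) => //.
- exact: quot_cls_linear.
- exact: quot_cls_bounded.
by move=> w e e0; rewrite mul1r; exact: quot_norm_lift.
Qed.

End Quotient.

(** * The spaces of operators and of quasilinear maps *)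

Section OperatorSpace.
Variables (R : realType) (k : scalar_kind R) (X Y : qbanach k).
Implicit Types u v : operator X Y.

Let values u := [set qnorm (u x) | x in [set x : X | qnorm x <= 1]].

Let values_sup u : has_sup (values u).
Proof.
split; first by exists (qnorm (u 0)), 0; rewrite //= qnorm0.
have [M M0 HM] := op_lbounded u; exists M => _ [x /= x1 <-].
by apply: le_trans (HM x) _; rewrite ler_piMr.
Qed.

Lemma op_norm_ge0 u : 0 <= op_norm u.
Proof.
apply: ub_le_sup; first by case: (values_sup u).
by exists 0; rewrite /= ?linear0 qnorm0.
Qed.

Lemma op_norm_bound u x : qnorm (u x) <= op_norm u * qnorm x.
Proof.
have := @homogeneous_lbounded _ _ X Y u 1 (op_norm u) (op_homogeneous u) ltr01.
rewrite divr1; apply=> y y1; apply: ub_le_sup; first by case: (values_sup u).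
by exists y.
Qed.

Lemma op_norm_le u C : 0 <= C -> (forall x, qnorm (u x) <= C * qnorm x) ->
  op_norm u <= C.
Proof.
move=> C0 H; apply: ge_sup; first by case: (values_sup u).
by move=> _ [x /= x1 <-]; apply: le_trans (H x) _; rewrite ler_piMr.
Qed.

Lemma op_scale_apply (a : scalar k) u x : (a *: u) x = a *: u x.
Proof. by []. Qed.

Lemma op_add_apply u v x : (u + v) x = u x + v x.
Proof. by []. Qed.

Lemma op_sub_apply u v x : (u - v) x = u x - v x.
Proof. by []. Qed.

Lemma op_normP : is_semi_quasi_norm (@op_norm _ _ X Y).
Proof.
split; first exact: op_norm_ge0.
  apply: norm_homogeneous; first exact: op_norm_ge0.
  move=> a u; apply: op_norm_le => [|x].
    by rewrite mulr_ge0 ?modulus_ge0 ?op_norm_ge0.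
  rewrite op_scale_apply qnormZ -mulrA.
  by rewrite ler_wpM2l ?modulus_ge0 ?op_norm_bound.
have [D D0 HD] := qnormD Y; exists D => u v; apply: op_norm_le => [|x].
  by rewrite mulr_ge0 ?addr_ge0 ?op_norm_ge0 ?ltW.
rewrite op_add_apply; apply: le_trans (HD _ _) _.
by rewrite -mulrA (ler_wpM2l (ltW D0))// mulrDl lerD ?op_norm_bound.
Qed.

Definition op_space : sqspace k := SQSpace op_normP.

(** The limit is taken pointwise; on a set of the filter of diameter e it stays within
2De of every element, uniformly on the ball. *)
Lemma op_space_complete : qcomplete op_space.
Proof.
move=> F FF /qcauchyP Fc.
have [D D1 HD] := qnormD_ge1 Y; have D0 : 0 < D by apply: lt_le_trans D1.
have Fball e : 0 < e -> exists2 A, F A &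
    forall u v x, A u -> A v -> qnorm (u x - v x) <= e * qnorm x.
  move=> e0; have [A FA HA] := Fc _ e0; exists A => // u v x Au Av.
  rewrite -op_sub_apply; apply: le_trans (op_norm_bound _ x) _.
  by rewrite ler_wpM2r//; exact: (HA u v Au Av).
have lim (x : X) : exists l : Y, forall e, 0 < e ->
    F [set u : operator X Y | qnorm (l - u x) <= e].
  pose G : set_system (qtop Y) := (fun u : operator X Y => u x) @ F.
  have GF : ProperFilter G by exact: fmap_proper_filter.
  have x0 : 0 < qnorm x + 1 by rewrite ltr_wpDl.
  have /sqb_complete/cvg_ex[l /qcvgP Gl] : cauchy G.
    apply/qcauchyP => e e0; have [A FA HA] := Fball _ (divr_gt0 e0 x0).
    exists [set u x | u in (A : set (operator X Y))].
      by rewrite /G /=; apply: filterS FA => u Au; exists u.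
    move=> _ _ [u Au <-] [v Av <-]; apply: le_trans (HA _ _ x Au Av) _.
    by rewrite mulrAC ler_pdivrMr// ler_wpM2l ?(ltW e0)// lerDl.
  by exists l => e e0; exact: Gl.
have [l Hl] := choice lim.
have ball e A : 0 < e ->
    (forall u v x, A u -> A v -> qnorm (u x - v x) <= e * qnorm x) -> F A ->
    forall u x, A u -> qnorm (l x - u x) <= 2 * D * e * qnorm x.
  move=> e0 HA FA u x Au; have [->|] := eqVneq x 0.
    rewrite linear0 qnorm0 mulr0 subr0 (_ : l 0 = 0) ?qnorm0//.
    apply: (@qnorm_small_eq0 _ _ _ _ 1) => d d0.
    have [v] := filter_ex (Hl 0 d d0).
    by rewrite /= linear0 subr0 mul1r.
  rewrite -qnorm_gt0 => x0.
  have [v [Av vx]] := filter_ex (filterI FA (Hl x _ (mulr_gt0 e0 x0))).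
  rewrite -(subrKA (v x)); apply: le_trans (HD _ _) _.
  apply: le_trans (ler_wpM2l (ltW D0) (lerD vx (HA _ _ x Av Au))) _.
  by apply: eq_ler; ring.
have llin : linear l.
  move=> a x y; apply/eqP; rewrite -subr_eq0; apply/eqP.
  apply: (@qnorm_small_eq0 _ _ _ _ (D * (1 + D * (modulus a + 1)))) => e e0.
  have [u [[ux uy] uxy]] := filter_ex (filterI (filterI (Hl x e e0) (Hl y e e0))
    (Hl (a *: x + y) e e0)).
  have -> : l (a *: x + y) - (a *: l x + l y) =
      (l (a *: x + y) - u (a *: x + y)) +
      (a *: (u x - l x) + (u y - l y)).
    by rewrite op_linear scalerBr; abel.
  apply: le_trans (HD _ _) _; rewrite -mulrA (ler_wpM2l (ltW D0))//.
  rewrite mulrDl mul1r lerD//.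
  apply: le_trans (HD _ _) _; rewrite -mulrA (ler_wpM2l (ltW D0))//.
  rewrite mulrDl mul1r lerD//; last by rewrite qnormB.
  by rewrite qnormZ ler_wpM2l ?modulus_ge0// qnormB.
have [|w wl] := @lbounded_operator _ _ X Y l llin.
  have [A FA HA] := Fball 1 ltr01; have [u Au] := filter_ex FA.
  apply: (@eq_lbounded _ _ _ _ (fun x => (l x - u x) + u x)) => [x|].
    by rewrite subrK.
  apply: lboundedD (op_lbounded u).
  by exists (2 * D * 1) => [|x]; [rewrite mulr1 mulr_ge0 ?ltW//|exact: (ball 1 A)].
apply/cvg_ex; exists (w : qtop op_space); apply/qcvgP => e e0.
have e1 : 0 < e / (2 * D) by rewrite divr_gt0// mulr_gt0.
have [A FA HA] := Fball _ e1; apply: (filterS _ (FA)) => u Au /=.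
apply: op_norm_le (ltW e0) _ => x; rewrite op_sub_apply wl.
apply: le_trans (ball _ _ e1 HA FA _ x Au) _.
by apply: eq_ler; field; rewrite gt_eqF.
Qed.

End OperatorSpace.

Section QuasilinearSpace.
Variables (R : realType) (k : scalar_kind R) (X Y : sqspace k).
Implicit Types F G : quasilinear X Y.

Lemma ql_homogeneous F : homogeneous F.
Proof. by have /asboolP[] := ql_funP F. Qed.

Let consts F := [set Q | 0 <= Q /\ quasilinear_const F Q].

Let consts_inf F : has_inf (consts F).
Proof.
split; last by exists 0 => Q [].
have /asboolP[_ [Q HQ]] := ql_funP F; exists `|Q|; split=> // x y.
apply: le_trans (HQ x y) _; rewrite ler_wpM2r ?ler_norm//.
by rewrite addr_ge0 ?qnorm_ge0.
Qed.

Lemma ql_norm_ge0 F : 0 <= ql_norm F.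
Proof.
by apply: lb_le_inf; [case: (consts_inf F)|move=> Q []].
Qed.

Lemma ql_norm_le F Q : 0 <= Q -> quasilinear_const F Q -> ql_norm F <= Q.
Proof. by move=> Q0 HQ; apply: ge_inf => //; case: (consts_inf F). Qed.

(** The infimum that defines Q(F) is attained. *)
Lemma ql_norm_const F : quasilinear_const F (ql_norm F).
Proof.
move=> x y; have [xy0|] := eqVneq (qnorm x + qnorm y) 0.
  by have [[Q [Q0 HQ]] _] := consts_inf F; have := HQ x y; rewrite xy0 !mulr0.
have xy : 0 <= qnorm x + qnorm y by rewrite addr_ge0 ?qnorm_ge0.
move=> n0; have {}xy : 0 < qnorm x + qnorm y by rewrite lt_def n0.
rewrite -ler_pdivrMr//; apply: lb_le_inf; first by case: (consts_inf F).
by move=> Q [Q0 HQ]; rewrite ler_pdivrMr.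
Qed.

Lemma ql_lin_apply (a : scalar k) F G x : (a *: F + G) x = a *: F x + G x.
Proof. by []. Qed.

Lemma ql_scale_apply (a : scalar k) F x : (a *: F) x = a *: F x.
Proof. by []. Qed.

Lemma ql_add_apply F G x : (F + G) x = F x + G x.
Proof. by []. Qed.

Lemma ql_normP : is_semi_quasi_norm (@ql_norm _ _ X Y).
Proof.
split; first exact: ql_norm_ge0.
  apply: norm_homogeneous; first exact: ql_norm_ge0.
  move=> a F; apply: ql_norm_le => [|x y].
    by rewrite mulr_ge0 ?modulus_ge0 ?ql_norm_ge0.
  rewrite !ql_scale_apply -!scalerBr qnormZ -mulrA.
  by rewrite ler_wpM2l ?modulus_ge0//; exact: ql_norm_const.
have [D D0 HD] := qnormD Y; exists D => F G; apply: ql_norm_le => [|x y].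
  by rewrite mulr_ge0 ?addr_ge0 ?ql_norm_ge0 ?ltW.
rewrite !ql_add_apply.
have -> : F (x + y) + G (x + y) - (F x + G x) - (F y + G y) =
  (F (x + y) - F x - F y) + (G (x + y) - G x - G y) by abel.
apply: le_trans (HD _ _) _.
by rewrite -mulrA (ler_wpM2l (ltW D0))// mulrDl lerD//; exact: ql_norm_const.
Qed.

Definition ql_space : sqspace k := SQSpace ql_normP.

Lemma quasilinear_of (F : X -> Y) Q : homogeneous F -> quasilinear_const F Q ->
  exists G : quasilinear X Y, G =1 F.
Proof.
by move=> Fh FQ; have FP : F \in @is_quasilinear _ _ X Y
  by [apply/asboolP; split=> //; exists Q]; exists (Quasilinear FP).
Qed.

End QuasilinearSpace.

Section Trivial.
Variables (R : realType) (k : scalar_kind R) (X Y : qbanach k).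

(** For homogeneous F this is triviality ([trivial_mapP]); the bounded part need not be
named, and its homogeneity is automatic. *)
Definition near_linear (F : X -> Y) :=
  exists2 L : X -> Y, linear L & lbounded (fun x => F x - L x).

Lemma trivial_mapP (F : X -> Y) : homogeneous F -> trivial_map F <-> near_linear F.
Proof.
move=> Fh; split=> [[L [B [Bh Bb FLB]]]|[L Ll Lb]].
  exists L; first exact: linearP.
  have -> : (fun x => F x - L x) = B.
    by apply/funext => x; rewrite FLB addrC addKr.
  exact: bounded_on_ball_lbounded.
pose L' : {linear X -> Y} := HB.pack L (GRing.isLinear.Build _ _ _ _ L Ll).
exists L', (fun x => F x - L x); split.
- by move=> a x; rewrite Fh (linear_scale Ll) scalerBr.
- exact: lbounded_on_ball.
- by move=> x; rewrite addrC subrK.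
Qed.

Lemma near_linear_lin a (F G : X -> Y) : near_linear F -> near_linear G ->
  near_linear (fun x => a *: F x + G x).
Proof.
move=> [L Ll Lb] [M Ml Mb]; exists (fun x => a *: L x + M x).
  move=> b x y; rewrite Ll Ml !scalerDr !scalerA mulrC; abel.
by apply: eq_lbounded (lboundedD (lboundedZ a Lb) Mb) => x; rewrite scalerBr; abel.
Qed.

Lemma near_linear_linear (F : X -> Y) : linear F -> near_linear F.
Proof.
move=> Fl; exists F => //.
by exists 0 => // x; rewrite subrr qnorm0 mul0r.
Qed.

Lemma trivial_map0 : trivial_map (0 : quasilinear X Y).
Proof.
apply/trivial_mapP; first exact: ql_homogeneous.
by apply: near_linear_linear => a x y; rewrite scaler0 addr0.
Qed.

Lemma trivial_map_lin a (F G : quasilinear X Y) :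
  trivial_map F -> trivial_map G -> trivial_map (a *: F + G).
Proof.
move=> /trivial_mapP-/(_ (@ql_homogeneous _ _ _ _ F)) HF.
move=> /trivial_mapP-/(_ (@ql_homogeneous _ _ _ _ G)) HG.
apply/trivial_mapP; first exact: ql_homogeneous.
exact: near_linear_lin.
Qed.

Definition Q_space : sqspace k := @quot_space _ _ (ql_space X Y)
  [set F : quasilinear X Y | trivial_map F] trivial_map0 trivial_map_lin.

Definition Q_cls : quasilinear X Y -> Q_space :=
  @quot_cls _ _ (ql_space X Y) [set F : quasilinear X Y | trivial_map F]
    trivial_map0 trivial_map_lin.

Lemma Q_clsE (F G : quasilinear X Y) :
  Q_cls F = Q_cls G <-> near_linear (fun x => F x - G x).
Proof.
rewrite -trivial_mapP; last first.
  by move=> a x; rewrite !ql_homogeneous scalerBr.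
exact: (@quot_clsE _ _ (ql_space X Y)).
Qed.

Lemma Q_cls_lin a (F G : quasilinear X Y) :
  Q_cls (a *: F + G) = a *: Q_cls F + Q_cls G.
Proof. exact: (@quot_cls_linear _ _ (ql_space X Y)). Qed.

Lemma Q_cls_eq0 F : Q_cls F = 0 <-> near_linear F.
Proof.
rewrite -trivial_mapP; last exact: ql_homogeneous.
exact: (@quot_cls_eq0 _ _ (ql_space X Y)).
Qed.

Lemma Q_cls_norm F : qnorm (Q_cls F) <= ql_norm F.
Proof. exact: (@quot_norm_le _ _ (ql_space X Y)). Qed.

Lemma le_Q_norm (c : Q_space) r M : 0 <= M ->
  (forall F, Q_cls F = c -> r <= M * ql_norm F) -> r <= M * qnorm c.
Proof. exact: (@le_quot_normM _ _ (ql_space X Y)). Qed.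

Lemma Q_norm_lift (c : Q_space) e : 0 < e ->
  exists2 F, Q_cls F = c & ql_norm F <= qnorm c + e.
Proof. exact: (@quot_norm_lift _ _ (ql_space X Y)). Qed.

Lemma Q_cls_surj c : exists F, Q_cls F = c.
Proof. exists (quot_val c); exact: quot_valK. Qed.

End Trivial.

(** * Finite truncations in the spaces l_q *)

(** The coordinate j is the one at which the partial sums of the weights pass t. *)
Lemma split_at_weight (R : realFieldType) (I : Type) (w : I -> R) (s : seq I)
    (t : R) : 0 <= t -> t <= \sum_(i <- s) w i -> (0 < size s)%N ->
  exists s1 j s2, [/\ s = s1 ++ j :: s2, \sum_(i <- s1) w i <= t &
    t <= \sum_(i <- s1) w i + w j].
Proof.
elim: s t => // i s IH t t0; rewrite big_cons => ts _.
have [ti|it] := leP t (w i).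
  by exists [::], i, s; rewrite big_nil add0r.
case: s IH ts => [|i' s] IH ts.
  by move: ts; rewrite big_nil addr0 leNgt it.
have [|||s1 [j [s2 [-> H1 H2]]]] := IH (t - w i) => //.
- by rewrite subr_ge0 ltW.
- by rewrite lerBlDl.
exists (i :: s1), j, s2; split=> //; rewrite big_cons.
  by rewrite addrC -lerBrDr.
by rewrite -addrA addrC -lerBlDr.
Qed.

(** Removing one coordinate is unavoidable: it may carry most of the weight. *)
Lemma split_halves (R : realFieldType) (I : Type) (w : I -> R) (s : seq I) :
  (forall i, 0 <= w i) -> (0 < size s)%N ->
  exists s1 j s2, [/\ s = s1 ++ j :: s2,
    \sum_(i <- s1) w i <= (\sum_(i <- s) w i) / 2 &
    \sum_(i <- s2) w i <= (\sum_(i <- s) w i) / 2].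
Proof.
move=> w0 s0; have W0 : 0 <= \sum_(i <- s) w i by exact: sumr_ge0.
have [|||s1 [j [s2 [sE H1 H2]]]] := @split_at_weight _ _ w s ((\sum_(i <- s) w i) / 2).
- by rewrite divr_ge0.
- lra.
- exact: s0.
exists s1, j, s2; split=> //.
have : \sum_(i <- s) w i = \sum_(i <- s1) w i + (w j + \sum_(i <- s2) w i).
  by rewrite sE big_cat big_cons.
lra.
Qed.

Section Ellq.
Variables (R : realType) (k : scalar_kind R) (I : choiceType) (q : {posnum R}).
Local Notation lq := (ellq k I q).
Implicit Types (f g : lq) (s t : seq I).

Definition weight (f : I -> scalar k) (i : I) : R := modulus (f i) `^ q%:num.

Lemma weight_ge0 f i : 0 <= weight f i. Proof. exact: powR_ge0. Qed.

(** Duplicate-free sequences, rather than finite sets, are what the bisection below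
cuts in two. *)
Lemma ellq_sum_leP (f : I -> scalar k) (c : R) :
  (ellq_sum q f <= c%:E)%E <->
  forall s, uniq s -> \sum_(i <- s) weight f i <= c.
Proof.
split=> [fc s us|fc].
  rewrite -lee_fin; apply: le_trans fc; apply: esum_ge.
  exists [set` [fset i in s]%fset]; first by split => //; exact: finite_fset.
  rewrite fsbig_finite//= set_fsetK -sumEFin.
  rewrite [leRHS](perm_big s) /=; first exact: lexx.
  by apply: uniq_perm => // i; rewrite !inE.
apply: ge_ereal_sup => _ [J [finJ _] <-].
rewrite fsbig_finite//= sumEFin lee_fin; apply: fc; exact: fset_uniq.
Qed.

Lemma ellq_normE f : ellq_sum q f = (qnorm f `^ q%:num)%:E.
Proof.
have /asboolP fo := ellq_funP f.
have s0 : (0 <= ellq_sum q f)%E.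
  by apply: esum_ge0 => i _; rewrite lee_fin powR_ge0.
rewrite /qnorm /= /ellq_norm -powRrM mulVf// powRr1 ?fine_ge0//.
by rewrite fineK// ge0_fin_numE.
Qed.

Lemma powRVK (x : R) : 0 <= x -> (x `^ q%:num^-1) `^ q%:num = x.
Proof. by move=> x0; rewrite -powRrM mulVf// powRr1. Qed.

Lemma ler_powRq (x y : R) : 0 <= x -> 0 <= y ->
  (x `^ q%:num <= y `^ q%:num) = (x <= y).
Proof.
move=> x0 y0; apply/idP/idP => [|xy]; last by apply: ge0_ler_powR.
by rewrite !leNgt; apply: contra => yx; apply: gt0_ltr_powR.
Qed.

Lemma ellq_norm_leP f c : 0 <= c -> qnorm f <= c <->
  forall s, uniq s -> \sum_(i <- s) weight f i <= c `^ q%:num.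
Proof.
by move=> c0; rewrite -ellq_sum_leP ellq_normE lee_fin ler_powRq.
Qed.

Lemma ellq_sum_le f s : uniq s -> \sum_(i <- s) weight f i <= qnorm f `^ q%:num.
Proof. by move: s; apply/ellq_norm_leP. Qed.

Lemma ellq_dominated f g : (forall i, modulus (f i) <= modulus (g i)) ->
  qnorm f <= qnorm g.
Proof.
move=> fg; apply/ellq_norm_leP => // s us.
apply: le_trans (ellq_sum_le g us); apply: ler_sum => i _.
by apply: ge0_ler_powR; rewrite ?nnegrE ?modulus_ge0.
Qed.

Definition trunc (f : I -> scalar k) s i : scalar k := if i \in s then f i else 0.

Lemma weight_trunc (f : I -> scalar k) s t :
  \sum_(i <- s) weight (trunc f t) i = \sum_(i <- [seq i <- s | i \in t]) weight f i.
Proof.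
rewrite big_filter [RHS]big_mkcond; apply: eq_bigr => i _.
rewrite /weight /trunc; case: ifP => // _.
by rewrite modulus0 powR0.
Qed.

Lemma weight_subset (f : I -> scalar k) s t : uniq s -> uniq t ->
  {subset s <= t} -> \sum_(i <- s) weight f i <= \sum_(i <- t) weight f i.
Proof.
move=> us ut st; rewrite [leRHS](bigID (mem s))/= -[X in _ <= X + _]big_filter.
rewrite [X in _ <= X + _](perm_big s) /=.
  by rewrite lerDl sumr_ge0// => i _; exact: powR_ge0.
apply: uniq_perm => //; first exact: filter_uniq.
by move=> i; rewrite mem_filter andb_idr//; exact: st.
Qed.

Lemma trunc_in_ellq (f : I -> scalar k) s : trunc f s \in @is_ellq R k I q.
Proof.
apply/asboolP; apply: le_lt_trans (ltry (\sum_(i <- undup s) weight f i)).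
apply/ellq_sum_leP => t ut; rewrite weight_trunc.
apply: weight_subset; rewrite ?filter_uniq ?undup_uniq// => i.
by rewrite mem_filter mem_undup => /andP[].
Qed.

Definition ellq_trunc (f : I -> scalar k) s : lq := Ellq (trunc_in_ellq f s).

Lemma ellq_truncE (f : I -> scalar k) s i :
  ellq_trunc f s i = if i \in s then f i else 0.
Proof. by []. Qed.

Lemma ellqP f g : (forall i, f i = g i) -> f = g.
Proof. by move=> fg; apply: val_inj; apply/funext. Qed.

Lemma ellq_trunc_norm (f : I -> scalar k) s : uniq s ->
  qnorm (ellq_trunc f s) `^ q%:num = \sum_(i <- s) weight f i.
Proof.
move=> us; apply/eqP; rewrite eq_le; apply/andP; split; last first.
  apply: le_trans (ellq_sum_le (ellq_trunc f s) us).
  rewrite big_seq [leRHS]big_seq; apply: ler_sum => i si.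
  by rewrite /weight ellq_truncE si.
have W0 : 0 <= \sum_(i <- s) weight f i by apply: sumr_ge0 => i _; exact: powR_ge0.
rewrite -[leRHS](powRVK W0).
apply: ge0_ler_powR; rewrite ?nnegrE ?qnorm_ge0 ?powR_ge0//.
apply/ellq_norm_leP => [|t ut].
  exact: powR_ge0.
rewrite powRVK// weight_trunc; apply: weight_subset; rewrite ?filter_uniq// => i.
by rewrite mem_filter => /andP[].
Qed.

(** A finite set s that almost reaches the supremum defining the norm leaves a small
rest, since s and any finite set disjoint from it have together at most the full sum. *)
Lemma ellq_trunc_dense f e : 0 < e ->
  exists2 s, uniq s & qnorm (f - ellq_trunc f s) <= e.
Proof.
move=> e0; have q0 := gt0 q.
have [s us Hs] : exists2 s, uniq s &
    qnorm f `^ q%:num - e `^ q%:num <= \sum_(i <- s) weight f i.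
  apply: contrapT => nH.
  have H s : uniq s -> \sum_(i <- s) weight f i < qnorm f `^ q%:num - e `^ q%:num.
    by move=> us; rewrite ltNge; apply/negP => Hs; apply: nH; exists s.
  have d0 : 0 <= qnorm f `^ q%:num - e `^ q%:num.
    by have := H [::] isT; rewrite big_nil => /ltW.
  have : qnorm f <= (qnorm f `^ q%:num - e `^ q%:num) `^ q%:num^-1.
    apply/ellq_norm_leP => [|s us]; first exact: powR_ge0.
    by rewrite powRVK//; exact/ltW/H.
  rewrite -ler_powRq ?powR_ge0// powRVK//.
  have := powR_gt0 q%:num e0; lra.
exists s => //; apply/ellq_norm_leP => [|t ut]; first exact: ltW.
have -> : \sum_(i <- t) weight (f - ellq_trunc f s : lq) i =
    \sum_(i <- [seq i <- t | i \notin s]) weight f i.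
  rewrite big_filter [RHS]big_mkcond; apply: eq_bigr => i _.
  rewrite /weight [X in modulus X](_ : _ = f i - ellq_trunc f s i)// ellq_truncE.
  by case: ifP => _ /=; rewrite ?subr0// subrr modulus0 powR0.
have : \sum_(i <- s ++ [seq i <- t | i \notin s]) weight f i <= qnorm f `^ q%:num.
  apply: ellq_sum_le; rewrite cat_uniq us filter_uniq//= andbT.
  by apply/hasPn => i; rewrite mem_filter => /andP[].
rewrite big_cat /=; lra.
Qed.

End Ellq.

Section EllqTrunc.
Variables (R : realType) (k : scalar_kind R) (I : choiceType) (q : {posnum R}).
Local Notation lq := (ellq k I q).
Local Notation tr := (@ellq_trunc R k I q).
Implicit Types (f g : lq) (s t : seq I).

Lemma ellq_trunc_cat f s t : uniq (s ++ t) -> tr f (s ++ t) = tr f s + tr f t.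
Proof.
rewrite cat_uniq => /and3P[_ /hasPn st _]; apply: ellqP => i.
rewrite [RHS](_ : _ = tr f s i + tr f t i)// !ellq_truncE mem_cat.
case: ifPn => [/orP[is_|it]|]; last first.
- by rewrite negb_or => /andP[/negPf -> /negPf ->]; rewrite addr0.
- by rewrite it (negPf (st i it)) add0r.
rewrite is_; case: ifPn => [/st|]; last by rewrite addr0.
by rewrite is_.
Qed.

Lemma ellq_trunc_sub_le f s t : {subset s <= t} -> qnorm (tr f s) <= qnorm (tr f t).
Proof.
move=> st; apply: ellq_dominated => i; rewrite !ellq_truncE.
case: ifPn => [/st -> //|_]; by rewrite modulus0 modulus_ge0.
Qed.

Lemma ellq_rest_le f s t : {subset s <= t} ->
  qnorm (f - tr f t) <= qnorm (f - tr f s).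
Proof.
move=> st; apply: ellq_dominated => i.
rewrite [X in modulus X <= _](_ : _ = f i - tr f t i)//.
rewrite [X in _ <= modulus X](_ : _ = f i - tr f s i)// !ellq_truncE.
have [it|it] := boolP (i \in t); first by rewrite subrr modulus0 modulus_ge0.
by rewrite (contraNF (@st i) it) subr0.
Qed.

Lemma ellq_trunc_rest_le f s t : uniq (s ++ t) ->
  qnorm (tr f t) <= qnorm (f - tr f s).
Proof.
rewrite cat_uniq => /and3P[_ /hasPn st _]; apply: ellq_dominated => i.
rewrite [X in _ <= modulus X](_ : _ = f i - tr f s i)// !ellq_truncE.
case: ifPn => [/st/negPf ->|_]; last by rewrite modulus0 modulus_ge0.
by rewrite subr0.
Qed.

Lemma ellq_trunc_lin a f g s : tr (a *: f + g : lq) s = a *: tr f s + tr g s.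
Proof.
apply: ellqP => i; rewrite [RHS](_ : _ = a *: tr f s i + tr g s i)// !ellq_truncE.
by case: ifP => // _; rewrite scaler0 addr0.
Qed.

Lemma ellq_trunc_nil f : tr f [::] = 0.
Proof. exact: ellqP. Qed.

Lemma eq_ellq_trunc f s t : s =i t -> tr f s = tr f t.
Proof. by move=> st; apply: ellqP => i; rewrite !ellq_truncE st. Qed.

Lemma ellq_trunc1 f i : tr f [:: i] = f i *: tr (fun=> 1) [:: i].
Proof.
apply: ellqP => j; rewrite [RHS](_ : _ = f i *: tr (fun=> 1) [:: i] j)//.
rewrite !ellq_truncE inE; case: eqP => [->|_]; last by rewrite scaler0.
by rewrite /GRing.scale /= mulr1.
Qed.

End EllqTrunc.

(** * Quasilinear maps on l_q are close to linear maps *)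

(** The argument uses only the truncations tr f s of f to finite sets s of coordinates
and the additivity of the q-th power of the norm on them; w f i stands for |f_i|^q
and vec i for the i-th unit vector. *)
Section QuasilinearOnTruncated.
Variables (R : realType) (k : scalar_kind R) (I : eqType) (q : {posnum R}).
Variables (L : qbanach k) (tr : L -> seq I -> L) (w : L -> I -> R).
Variables (coord : L -> I -> scalar k) (vec : I -> L).
Implicit Types (f g : L) (s t : seq I).
Hypothesis w_ge0 : forall f i, 0 <= w f i.
Hypothesis tr_norm : forall f s, uniq s ->
  qnorm (tr f s) `^ q%:num = \sum_(i <- s) w f i.
Hypothesis tr_lin : forall a f g s, tr (a *: f + g) s = a *: tr f s + tr g s.
Hypothesis tr_nil : forall f, tr f [::] = 0.
Hypothesis tr_eq_mem : forall f s t, s =i t -> tr f s = tr f t.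
Hypothesis tr_cat : forall f s t, uniq (s ++ t) -> tr f (s ++ t) = tr f s + tr f t.
Hypothesis tr_sub_le : forall f s t, {subset s <= t} ->
  qnorm (tr f s) <= qnorm (tr f t).
Hypothesis rest_le : forall f s t, {subset s <= t} ->
  qnorm (f - tr f t) <= qnorm (f - tr f s).
Hypothesis tr_rest_le : forall f s t, uniq (s ++ t) ->
  qnorm (tr f t) <= qnorm (f - tr f s).
Hypothesis tr_dense : forall f e, 0 < e ->
  exists2 s, uniq s & qnorm (f - tr f s) <= e.
Hypothesis tr1 : forall f i, tr f [:: i] = coord f i *: vec i.
Hypothesis coord_lin : forall a f g i,
  coord (a *: f + g) i = a * coord f i + coord g i.
Variables (Y : qbanach k) (p : R).
Hypotheses (qp : q%:num < p) (Yp : p_normable p Y).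

(** The value at tr f s of the linear map that agrees with F on the unit vectors. *)
Definition coord_sum (F : L -> Y) f s : Y := \sum_(i <- s) F (tr f [:: i]).

Let p0 : 0 < p. Proof. exact: lt_trans qp. Qed.

(** The p-th power of the error for the mass m is at most 2 (2CQ)^p m^(p/q), from the two
places where F is split, plus twice the same error for m/2.  Since p > q the
constant K = 2 / (1 - 2 (1/2)^(p/q)) is finite and reproduces itself. *)
Lemma coord_sum_estimate : exists2 M, 0 <= M & forall (F : L -> Y) Q,
  0 <= Q -> homogeneous F -> quasilinear_const F Q ->
  forall f s, uniq s ->
  qnorm (F (tr f s) - coord_sum F f s) <= M * Q * qnorm (tr f s).
Proof.
have [N [[[N0 NZ _] N_sep Np] [c [C [c0 C0 NcC]]]]] := Yp.
pose r := p / q%:num; have q0 : 0 < q%:num := gt0 q.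
have r1 : 1 < r by rewrite ltr_pdivlMr// mul1r.
have half : 2 * (1 / 2) `^ r < 1.
  have -> : r = 1 + (r - 1) by ring.
  rewrite powRD; last by rewrite mul1r invr_eq0 pnatr_eq0 implybT.
  rewrite powRr1 ?divr_ge0// mulrA mulrC mul1r divff// mulr1.
  rewrite -[ltRHS](_ : 1 `^ (r - 1) = 1); last by rewrite powR1.
  apply: gt0_ltr_powR; rewrite ?nnegrE ?subr_gt0 ?divr_ge0//; lra.
pose K := 2 / (1 - 2 * (1 / 2) `^ r).
have K0 : 0 <= K by rewrite divr_ge0// subr_ge0 ltW.
exists (K `^ p^-1 * (2 * C) / c).
  by rewrite divr_ge0 ?mulr_ge0 ?powR_ge0 ?(ltW c0) ?(ltW C0).
move=> F Q Q0 Fh FQ f s us.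
pose W s := \sum_(i <- s) w f i.
have W0 s' : 0 <= W s' by apply: sumr_ge0 => i _; exact: w_ge0.
have pE : p = q%:num * r by rewrite /r mulrC divfK// gt_eqF.
have trp s' : uniq s' -> qnorm (tr f s') `^ p = W s' `^ r.
  move=> us'; rewrite [in LHS]pE powRrM; congr (_ `^ r).
  exact: tr_norm.
have pmono (x y : R) : 0 <= x -> 0 <= y -> x <= y -> x `^ p <= y `^ p.
  by move=> x0 y0 xy; apply: ge0_ler_powR => //; exact: ltW.
have defect s' (x y : L) : uniq s' -> qnorm x <= qnorm (tr f s') ->
    qnorm y <= qnorm (tr f s') ->
    N (F (x + y) - F x - F y) `^ p <= (2 * C * Q) `^ p * W s' `^ r.
  move=> us' xs ys; rewrite -trp// -powRM ?mulr_ge0 ?(ltW C0)//.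
  apply: pmono => //; first by rewrite !mulr_ge0 ?(ltW C0).
  have /andP[_] := NcC (F (x + y) - F x - F y); move/le_trans; apply.
  have -> : 2 * C * Q * qnorm (tr f s') =
    C * (Q * (qnorm (tr f s') + qnorm (tr f s'))) by ring.
  rewrite ler_wpM2l ?(ltW C0)//; apply: le_trans (FQ x y) _.
  by rewrite ler_wpM2l// lerD.
pose E s := F (tr f s) - coord_sum F f s.
(* Induction on the number of coordinates, with a bound that depends on the mass only. *)
have key n s' : (size s' <= n)%N -> uniq s' ->
    N (E s') `^ p <= K * (2 * C * Q) `^ p * W s' `^ r.
  elim: n s' => [|n IH] s' sn us'; last have [s0|s0] := posnP (size s').
  - rewrite leqn0 size_eq0 in sn; rewrite (eqP sn) /E tr_nil.
    rewrite homogeneous0// /coord_sum big_nil subrr.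
    have -> : N 0 = 0 by rewrite -(scale0r (0 : Y)) NZ modulus0 mul0r.
    by rewrite powR0 ?gt_eqF// mulr_ge0 ?powR_ge0// mulr_ge0 ?powR_ge0.
  - by apply: IH => //; rewrite s0.
  have [s1 [j [s2 [s'E H1 H2]]]] := split_halves (w_ge0 f) s0.
  have /and3P[u1 uj u2] : [&& uniq s1, ~~ has (mem s1) (j :: s2) & uniq (j :: s2)].
    by rewrite -cat_uniq -s'E.
  have u2' : uniq s2 by case/andP: u2.
  have sub1 : {subset s1 <= s'} by move=> i; rewrite s'E mem_cat => ->.
  have sub2 : {subset s2 <= s'}.
    by move=> i is2; rewrite s'E mem_cat inE is2 !orbT.
  have subj2 : {subset j :: s2 <= s'}.
    by move=> i is2; rewrite s'E mem_cat is2 orbT.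
  have subj : {subset [:: j] <= s'}.
    by move=> i; rewrite !inE => /eqP ->; apply: subj2; rewrite mem_head.
  have sz : (size s1 + size s2 < n.+1)%N.
    by apply: leq_trans sn; rewrite s'E size_cat /= addnS.
  have tE : tr f s' = tr f s1 + tr f (j :: s2) by rewrite -tr_cat -?s'E.
  have t2E : tr f (j :: s2) = tr f [:: j] + tr f s2 by rewrite -tr_cat.
  have cE : coord_sum F f s' = coord_sum F f s1 +
      (F (tr f [:: j]) + coord_sum F f s2).
    by rewrite /coord_sum s'E big_cat big_cons.
  have -> : E s' = (F (tr f s1 + tr f (j :: s2)) - F (tr f s1) -
        F (tr f (j :: s2))) +
      ((F (tr f [:: j] + tr f s2) - F (tr f [:: j]) - F (tr f s2)) +
      (E s1 + E s2)).
    rewrite -tE -t2E /E cE; abel.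
  apply: le_trans (Np _ _) _.
  have D1 := defect s' _ _ us' (tr_sub_le f sub1) (tr_sub_le f subj2).
  have D2 := defect s' _ _ us' (tr_sub_le f subj) (tr_sub_le f sub2).
  have half_le s'' : W s'' <= W s' / 2 -> W s'' `^ r <= (1 / 2) `^ r * W s' `^ r.
    move=> Ws; rewrite -powRM ?divr_ge0// mul1r mulrC; apply: ge0_ler_powR => //.
    - exact: ltW (lt_trans ltr01 r1).
    - by rewrite nnegrE.
    - by rewrite nnegrE divr_ge0.
  have KC0 : 0 <= K * (2 * C * Q) `^ p by rewrite mulr_ge0 ?powR_ge0.
  have E1 : N (E s1) `^ p <= K * (2 * C * Q) `^ p * ((1 / 2) `^ r * W s' `^ r).
    apply: le_trans (IH s1 _ u1) _; last by rewrite ler_wpM2l// half_le.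
    by move: sz; rewrite ltnS; apply: leq_trans; rewrite leq_addr.
  have E2 : N (E s2) `^ p <= K * (2 * C * Q) `^ p * ((1 / 2) `^ r * W s' `^ r).
    apply: le_trans (IH s2 _ u2') _; last by rewrite ler_wpM2l// half_le.
    by move: sz; rewrite ltnS; apply: leq_trans; rewrite leq_addl.
  apply: le_trans (lerD D1 (le_trans (Np _ _) (lerD D2
    (le_trans (Np _ _) (lerD E1 E2))))) _.
  apply: eq_ler; rewrite /K; field.
  by rewrite subr_eq0 gt_eqF.
have {key} := key _ s (leqnn _) us; rewrite -/(E s) => H.
have NE : N (E s) <= K `^ p^-1 * (2 * C * Q) * qnorm (tr f s).
  have CQ0 : 0 <= 2 * C * Q by rewrite !mulr_ge0 ?(ltW C0).
  have pK (x : R) : 0 <= x -> (x `^ p) `^ p^-1 = x.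
    by move=> x0; rewrite -powRrM mulfV ?gt_eqF// powRr1.
  rewrite -(pK (N (E s)))//.
  apply: le_trans (ge0_ler_powR _ _ _ H) _.
  - by rewrite invr_ge0 ltW.
  - by rewrite nnegrE powR_ge0.
  - by rewrite nnegrE mulr_ge0 ?powR_ge0// mulr_ge0 ?powR_ge0.
  rewrite -trp// [leLHS]powRM; last 2 first.
  - by rewrite mulr_ge0 ?powR_ge0.
  - exact: powR_ge0.
  rewrite [X in X * _]powRM ?powR_ge0// !pK//.
have /andP[+ _] := NcC (E s) => /le_trans/(_ NE) cE.
rewrite -(ler_pM2l c0); apply: le_trans cE _.
by apply: eq_ler; field; rewrite gt_eqF.
Qed.

Lemma coord_sum_lin (F : L -> Y) a f g s : homogeneous F ->
  coord_sum F (a *: f + g) s = a *: coord_sum F f s + coord_sum F g s.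
Proof.
move=> Fh; rewrite /coord_sum scaler_sumr -big_split; apply: eq_bigr => i _ /=.
by rewrite !tr1 !Fh coord_lin scalerDl scalerA.
Qed.

(** The approximants a f s = F(f - tr f s) + coord_sum F f s are linear in f up to an
error that tends to 0 with the rest f - tr f s, and any two of them differ by at
most a multiple of their rests: enlarging s to s ++ t splits off tr f t, for which
[coord_sum_estimate] applies.  So they converge to a linear map T, and s = [::]
gives the distance from F to T. *)
Lemma quasilinear_near_linear : exists2 M, 0 <= M &
  forall (F : L -> Y) Q, 0 <= Q -> homogeneous F -> quasilinear_const F Q ->
  exists2 T : L -> Y, linear T &
    forall f, qnorm (F f - T f) <= M * Q * qnorm f.
Proof.
have [M M0 HM] := coord_sum_estimate.
have [D D1 HD] := qnormD_ge1 Y; have D0 : 0 <= D by apply: le_trans D1.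
have [c [A [c0 c1 A0 lim]]] := geometric_limit Y.
exists (D * (D * (D * (2 + M)))); first by rewrite !mulr_ge0 ?addr_ge0.
move=> F Q Q0 Fh FQ; pose K := D * (2 + M) * Q.
have K0 : 0 <= K by rewrite !mulr_ge0 ?addr_ge0.
pose a f s := F (f - tr f s) + coord_sum F f s.
pose res f s := qnorm (f - tr f s).
have a_cat f s t : uniq (s ++ t) -> qnorm (a f s - a f (s ++ t)) <= K * res f s.
  move=> ust; have := ust; rewrite cat_uniq => /and3P[us _ ut].
  have -> : a f s - a f (s ++ t) =
      (F ((f - tr f (s ++ t)) + tr f t) - F (f - tr f (s ++ t)) - F (tr f t)) +
      (F (tr f t) - coord_sum F f t).
    rewrite /a [coord_sum F f (s ++ t)]/coord_sum big_cat /=.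
    rewrite -!/(coord_sum _ _ _) (_ : f - tr f (s ++ t) + tr f t = f - tr f s).
      abel.
    by rewrite tr_cat//; abel.
  have H1 := tr_rest_le f ust.
  have H2 : qnorm (f - tr f (s ++ t)) <= res f s.
    by apply: rest_le => i; rewrite mem_cat => ->.
  apply: le_trans (HD _ _) _; rewrite /K -!mulrA ler_wpM2l//.
  have -> : (2 + M) * (Q * res f s) = Q * (res f s + res f s) + M * Q * res f s.
    by ring.
  apply: lerD; first by apply: le_trans (FQ _ _) _; rewrite ler_wpM2l// lerD.
  apply: le_trans (HM F Q Q0 Fh FQ f t ut) _.
  by rewrite ler_wpM2l// mulr_ge0.
have a_perm f s t : perm_eq s t -> a f s = a f t.
  move=> st; rewrite /a (tr_eq_mem f (perm_mem st)).
  by congr (_ + _); exact: perm_big.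
have a_dist f s t : uniq s -> uniq t ->
    qnorm (a f s - a f t) <= D * (K * (res f s + res f t)).
  move=> us ut; pose s' := s ++ [seq i <- t | i \notin s].
  pose t' := t ++ [seq i <- s | i \notin t].
  have uniq_join (u v : seq I) : uniq u -> uniq v ->
      uniq (u ++ [seq i <- v | i \notin u]).
    move=> uu uv; rewrite cat_uniq uu filter_uniq//= andbT.
    by apply/hasPn => i; rewrite mem_filter => /andP[].
  have us' : uniq s' by exact: uniq_join.
  have ut' : uniq t' by exact: uniq_join.
  have st' : perm_eq s' t'.
    apply: uniq_perm => // i; rewrite !mem_cat !mem_filter.
    by case: (i \in s); case: (i \in t).
  rewrite -(subrKA (a f s')); apply: le_trans (HD _ _) _.
  rewrite ler_wpM2l// mulrDr lerD//; first exact: a_cat.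
  by rewrite (a_perm _ _ _ st') qnormB; exact: a_cat.
have limit f : exists l, forall s, uniq s ->
    qnorm (a f s - l) <= D * (D * K) * res f s.
  have /choice[s Hs] n : exists s, uniq s /\ res f s <= c ^+ n.
    by have [s us Hs] := tr_dense f (exprn_gt0 n c0); exists s.
  have [||| l Hl] := lim (fun n => a f (s n)) (fun n => D * (K * (2 * c ^+ n))).
  - by move=> n; rewrite mulr_ge0// mulr_ge0// mulr_ge0// exprn_ge0// ltW.
  - by move=> n; apply: eq_ler; rewrite exprS; ring.
  - move=> n; apply: le_trans (a_dist f _ _ (Hs _).1 (Hs _).1) _.
    rewrite ler_wpM2l// ler_wpM2l// mulr2n mulrDl mul1r lerD//.
      apply: le_trans (Hs n.+1).2 _.
      by rewrite exprS ler_piMl ?exprn_ge0// ltW.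
    exact: (Hs n).2.
  exists l => t ut; apply/ler_addgt0Pr => e e0.
  have [|n Hn] := @exprn_small _ (D * (D * K + A * (D * (K * 2)))) c e _ e0.
    by rewrite c1 ltW.
  rewrite -(subrKA (a f (s n))); apply: le_trans (HD _ _) _.
  have H1 : qnorm (a f t - a f (s n)) <= D * (K * (res f t + c ^+ n)).
    apply: le_trans (a_dist f _ _ ut (Hs _).1) _.
    by rewrite ler_wpM2l// ler_wpM2l// lerD2l; exact: (Hs n).2.
  have H2 := Hl n; rewrite qnormB in H2.
  apply: le_trans (ler_wpM2l D0 (lerD H1 H2)) _.
  by rewrite -lerBlDl; apply: le_trans Hn; apply: eq_ler; ring.
have [T HT] := choice limit.
exists T; last first.
  move=> f; have := HT f [::] isT; rewrite /a /res tr_nil subr0.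
  rewrite /coord_sum big_nil addr0 /K; move/le_trans; apply.
  by apply: eq_ler; ring.
move=> b f g; apply/eqP; rewrite -subr_eq0; apply/eqP.
have [Dl Dl1 HDl] := qnormD_ge1 L; have Dl0 : 0 <= Dl by apply: le_trans Dl1.
have mb := modulus_ge0 b; set B := modulus b in mb.
pose K' := D * (D * K).
have K'0 : 0 <= K' by rewrite mulr_ge0// mulr_ge0.
apply: (@qnorm_small_eq0 _ _ _ _ (D * (K' * (Dl * (B + 1)) +
  D * (Q * (B + 1) + D * (B * K' + K'))))) => e e0.
have [s us resf] := tr_dense f e0.
have [t ut resg] := tr_dense g e0.
pose u := undup (s ++ t); have uu : uniq u by exact: undup_uniq.
have {}resf : res f u <= e.
  by apply: le_trans resf; apply: rest_le => i; rewrite mem_undup mem_cat => ->.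
have {}resg : res g u <= e.
  apply: le_trans resg; apply: rest_le => i.
  by rewrite mem_undup mem_cat => ->; rewrite orbT.
set h := b *: f + g.
have hE : h - tr h u = b *: (f - tr f u) + (g - tr g u).
  by rewrite /h tr_lin scalerBr; abel.
have resh : res h u <= Dl * (B + 1) * e.
  rewrite /res hE; apply: le_trans (HDl _ _) _; rewrite -mulrA ler_wpM2l//.
  by rewrite mulrDl mul1r lerD// qnormZ ler_wpM2l.
have -> : T h - (b *: T f + T g) = (T h - a h u) +
    ((F (b *: (f - tr f u) + (g - tr g u)) - F (b *: (f - tr f u)) - F (g - tr g u)) +
    (b *: (a f u - T f) + (a g u - T g))).
  rewrite -hE (Fh b) /a /h coord_sum_lin// !(scalerBr, scalerDr); abel.
apply: le_trans (HD _ _) _; rewrite -mulrA ler_wpM2l// mulrDl lerD//.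
  rewrite qnormB; apply: le_trans (HT h u uu) _; rewrite -/K' -mulrA ler_wpM2l//.
apply: le_trans (HD _ _) _; rewrite -mulrA ler_wpM2l// mulrDl lerD//.
  apply: le_trans (FQ _ _) _; rewrite -mulrA ler_wpM2l// mulrDl mul1r lerD//.
  by rewrite qnormZ ler_wpM2l.
apply: le_trans (HD _ _) _; rewrite -mulrA ler_wpM2l// mulrDl lerD//.
  rewrite qnormZ -mulrA ler_wpM2l//; apply: le_trans (HT f u uu) _.
  by rewrite ler_wpM2l.
by apply: le_trans (HT g u uu) _; rewrite ler_wpM2l.
Qed.

End QuasilinearOnTruncated.

(** With q < p, this says that l_q(I) is projective up to linear maps for p-normable
spaces: every extension of l_q(I) by Y splits, with uniform control. *)
Theorem quasilinear_ellq_near_linear (R : realType) (k : scalar_kind R)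
    (I : choiceType) (q : {posnum R}) (Y : qbanach k) (p : R) :
  q%:num < p -> p_normable p Y -> exists2 M, 0 <= M &
  forall (F : ellq k I q -> Y) Q, 0 <= Q -> homogeneous F ->
    quasilinear_const F Q ->
  exists2 T : ellq k I q -> Y, linear T &
    forall f, qnorm (F f - T f) <= M * Q * qnorm f.
Proof.
move=> qp Yp.
apply: (@quasilinear_near_linear R k I q (ellq k I q)
  (fun f s => ellq_trunc q f s) (fun f i => weight q f i) (fun f i => f i)
  (fun i => ellq_trunc q (fun=> 1) [:: i]) _ _ _ _ _ _ _ _ _ _ _ _ Y p qp Yp).
- by move=> f i; exact: weight_ge0.
- by move=> f s; exact: ellq_trunc_norm.
- exact: ellq_trunc_lin.
- exact: ellq_trunc_nil.
- exact: eq_ellq_trunc.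
- exact: ellq_trunc_cat.
- exact: ellq_trunc_sub_le.
- exact: ellq_rest_le.
- exact: ellq_trunc_rest_le.
- exact: ellq_trunc_dense.
- exact: ellq_trunc1.
- by [].
Qed.

(** * Quasilinear maps representing extensions *)

Section Sections.
Variables (R : realType) (k : scalar_kind R).

(** On each line one vector is selected, a preimage of it of comparable norm is chosen,
and the rest of the line follows by homogeneity. *)
Lemma homogeneous_section (Z X : qbanach k) (T : operator Z X) :
  (forall x, exists z, T z = x) ->
  exists B : X -> Z, [/\ homogeneous B, lbounded B & forall x, T (B x) = x].
Proof.
move=> Ts; have [C C0 HC] := open_mapping Ts.
have /choice[b Hb] x : exists z, T z = x /\ qnorm z <= C * qnorm x.
  by have [z Tz zC] := HC x; exists z.
(* The nonzero multiples of x; equal lines have equal representatives. *)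
pose line (x : X) := [set y : X | exists2 a : scalar k, a != 0 & y = a *: x].
pose r x := xget 0 (line x).
have rP x : line x (r x).
  by apply: xgetPex; exists x, 1; rewrite ?oner_neq0// scale1r.
have rZ a x : a != 0 -> r (a *: x) = r x.
  move=> a0; rewrite /r; congr xget; rewrite predeqE => y; split=> -[c c0 ->].
    by exists (c * a); rewrite ?mulf_neq0// scalerA.
  by exists (c / a); rewrite ?mulf_neq0 ?invr_eq0// scalerA divfK.
have /choice[c Hc] x : exists c, x = c *: r x.
  by have [a a0 ->] := rP x; exists a^-1; rewrite scalerA mulVf// scale1r.
have r0 x : x != 0 -> r x != 0.
  by move=> x0; have [a a0 ->] := rP x; rewrite scaler_eq0 negb_or a0.
have B_le x : qnorm (c x *: b (r x)) <= C * qnorm x.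
  rewrite qnormZ [in leRHS](Hc x) qnormZ mulrCA ler_wpM2l ?modulus_ge0//.
  by case: (Hb (r x)).
exists (fun x => c x *: b (r x)); split; last 2 first.
- by exists C.
- by move=> x; rewrite linearZ /= (Hb _).1 -Hc.
have B0 : c 0 *: b (r 0) = 0.
  apply: qb_separated; apply/eqP; rewrite eq_le qnorm_ge0 andbT.
  by apply: le_trans (B_le 0) _; rewrite qnorm0 mulr0.
move=> a x; have [->|a0] := eqVneq a 0; first by rewrite !scale0r.
have [->|x0] := eqVneq x 0; first by rewrite scaler0 B0 scaler0.
rewrite rZ// scalerA; congr (_ *: _).
have : (c (a *: x) - a * c x) *: r x = 0.
  by rewrite scalerBl -scalerA -(Hc x) -(rZ a x a0) -Hc subrr.
by move/eqP; rewrite scaler_eq0 (negPf (r0 x x0)) orbF subr_eq0 => /eqP.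
Qed.

End Sections.

Section Representations.
Variables (R : realType) (k : scalar_kind R).

Section OneExtension.
Variables (X Y : qbanach k) (E : extension X Y).

Lemma ext_pi y : ext_p E (ext_i E y) = 0.
Proof. by apply/ext_exact; exists y. Qed.

Lemma ext_i_bounded_below :
  exists2 C, 0 <= C & forall y, qnorm y <= C * qnorm (ext_i E y).
Proof. exact: injective_closed_range (@ext_i_inj _ _ _ _ E) (@ext_exact _ _ _ _ E). Qed.

(** A map into the middle space killed by the quotient map factors through Y, and the
factor inherits linearity, homogeneity and boundedness. *)
Lemma ext_i_lift (T : Type) (f : T -> mid E) : (forall x, ext_p E (f x) = 0) ->
  exists g : T -> Y, forall x, ext_i E (g x) = f x.
Proof.
move=> f0; have /choice[g Hg] x : exists y, ext_i E y = f x by apply/ext_exact.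
by exists g.
Qed.

Lemma ext_i_lift_linear (Z : sqspace k) (f : Z -> mid E) (g : Z -> Y) :
  (forall x, ext_i E (g x) = f x) -> linear f -> linear g.
Proof.
move=> gf fl a x y; apply: (@ext_i_inj _ _ _ _ E).
by rewrite op_linear !gf fl.
Qed.

Lemma ext_i_lift_homogeneous (Z : sqspace k) (f : Z -> mid E) (g : Z -> Y) :
  (forall x, ext_i E (g x) = f x) -> homogeneous f -> homogeneous g.
Proof.
move=> gf fh a x; apply: (@ext_i_inj _ _ _ _ E).
by rewrite op_homogeneous !gf fh.
Qed.

Lemma ext_i_lift_lbounded (Z : sqspace k) (f : Z -> mid E) (g : Z -> Y) :
  (forall x, ext_i E (g x) = f x) -> lbounded f -> lbounded g.
Proof.
move=> gf [M M0 HM]; have [C C0 HC] := ext_i_bounded_below.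
exists (C * M); first exact: mulr_ge0.
by move=> x; apply: le_trans (HC _) _; rewrite gf -mulrA ler_wpM2l.
Qed.

(** Two sections, one bounded homogeneous and one linear, differ by F. *)
Definition represents (F : X -> Y) := exists (B L : X -> mid E),
  [/\ bounded_section B, linear L, forall x, ext_p E (L x) = x &
      forall x, ext_i E (F x) = B x - L x].

Lemma bounded_section_lbounded (B : X -> mid E) :
  bounded_section B -> lbounded B.
Proof. by move=> [Bh Bb _]; exact: bounded_on_ball_lbounded. Qed.

Lemma represents_quasilinear F : represents F ->
  exists G : quasilinear X Y, G =1 F.
Proof.
move=> [B [L [Bs Ll Lp iF]]]; have [Bh _ Bp] := Bs.
have [M M0 HM] := bounded_section_lbounded Bs.
have [C C0 HC] := ext_i_bounded_below.
have [D D1 HD] := qnormD_ge1 (mid E); have D0 : 0 <= D by apply: le_trans D1.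
have [DX DX1 HDX] := qnormD_ge1 X; have DX0 : 0 <= DX by apply: le_trans DX1.
apply: (@quasilinear_of _ _ X Y F (C * (D * (M * DX + D * M)))).
  apply: ext_i_lift_homogeneous iF _ => a x.
  by rewrite Bh (linear_scale Ll) scalerBr.
move=> x y; apply: le_trans (HC _) _; rewrite -mulrA ler_wpM2l//.
have -> : ext_i E (F (x + y) - F x - F y) = B (x + y) - (B x + B y).
  by rewrite !(linear_sub (op_linear _)) !iF (linear_add Ll); abel.
apply: le_trans (HD _ _) _; rewrite -mulrA ler_wpM2l// qnormN mulrDl lerD//.
  by apply: le_trans (HM _) _; rewrite -mulrA ler_wpM2l.
apply: le_trans (HD _ _) _; rewrite -mulrA ler_wpM2l// mulrDr.
by rewrite lerD.
Qed.

Lemma exists_represents : exists F : quasilinear X Y, represents F.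
Proof.
have [B [Bh Bb Bp]] := homogeneous_section (@ext_p_surj _ _ _ _ E).
have [L Ll Lp] := linear_section (op_linear (ext_p E)) (@ext_p_surj _ _ _ _ E).
have [F HF] : exists F : X -> Y, forall x, ext_i E (F x) = B x - L x.
  by apply: ext_i_lift => x; rewrite (linear_sub (op_linear _)) Bp Lp subrr.
have FE : represents F.
  by exists B, L; split=> //; split=> //; exact: lbounded_on_ball.
by have [G /funext GF] := represents_quasilinear FE; exists G; rewrite GF.
Qed.

(** If F - G is linear plus bounded, the bounded part is absorbed in B and the linear
part in L. *)
Lemma represents_near (F G : X -> Y) : homogeneous F -> homogeneous G ->
  represents F -> near_linear (fun x => F x - G x) -> represents G.
Proof.
move=> Fh Gh [B [L [Bs Ll Lp iF]]] [l ll lb]; have [Bh _ Bp] := Bs.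
exists (fun x => B x - ext_i E (F x - G x - l x)), (fun x => L x + ext_i E (l x)).
split; first split.
- move=> a x; rewrite Bh Fh Gh (linear_scale ll) -!scalerBr op_homogeneous.
  by rewrite scalerBr.
- apply: lbounded_on_ball; apply: lboundedB; first exact: bounded_section_lbounded.
  by apply: lbounded_comp lb; exact: op_lbounded.
- by move=> x; rewrite (linear_sub (op_linear _)) ext_pi subr0.
- by move=> a x y; rewrite Ll ll op_linear scalerDr; abel.
- by move=> x; rewrite (linear_add (op_linear _)) ext_pi addr0.
- by move=> x; rewrite !(linear_sub (op_linear _)) iF; abel.
Qed.

End OneExtension.

Section Morphisms.
Variables (X Y X' Y' : qbanach k) (beta : operator Y Y') (gamma : operator X X').
Variables (E : extension X Y) (E' : extension X' Y').

(** The morphisms of exact sequences over fixed maps of the end terms; equivalences,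
push-outs and pull-backs are the cases where both, or one, of these are identities. *)
Definition ext_mor := exists t : operator (mid E) (mid E'),
  (forall y, t (ext_i E y) = ext_i E' (beta y)) /\
  (forall z, ext_p E' (t z) = gamma (ext_p E z)).

(** A morphism t carries B - L to t B - t L, which differs from (B' - L') gamma by
the bounded t B - B' gamma and the linear t L - L' gamma.  Conversely, if
beta F - F' gamma is l plus bounded, t is prescribed on the two summands of
z = (z - L p z) + L p z: the first is in Y and goes to its image under beta, the
second goes to L' gamma p z - i' l p z.  The map t is linear, and
rewriting L and L' by means of B and B' shows that it is bounded. *)
Lemma ext_morP (F : X -> Y) (F' : X' -> Y') : represents E F -> represents E' F' ->
  ext_mor <-> near_linear (fun x => beta (F x) - F' (gamma x)).
Proof.
move=> [B [L [Bs Ll Lp iF]]] [B' [L' [Bs' Ll' Lp' iF']]].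
have [Bh _ Bp] := Bs; have [Bh' _ Bp'] := Bs'.
have Bb := bounded_section_lbounded Bs.
have Bb' := bounded_section_lbounded Bs'.
split=> [[t [ti pt]]|[l ll lb]].
  have [l Hl] : exists l : X -> Y', forall x,
      ext_i E' (l x) = L' (gamma x) - t (L x).
    apply: ext_i_lift => x; rewrite (linear_sub (op_linear _)) pt Lp' Lp.
    by rewrite subrr.
  exists l.
    apply: ext_i_lift_linear Hl _ => a x y.
    by rewrite op_linear Ll' Ll op_linear scalerBr; abel.
  apply: (@ext_i_lift_lbounded _ _ E' _ (fun x => t (B x) - B' (gamma x))) => [x|].
    rewrite !(linear_sub (op_linear _)) iF' Hl -ti iF.
    by rewrite (linear_sub (op_linear _)); abel.
  apply: lboundedB; first exact: lbounded_comp (op_lbounded t) Bb.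
  exact: lbounded_comp Bb' (op_lbounded gamma).
(* The coordinates of z in Y with respect to L (linear) and to B (bounded). *)
have [r Hr] : exists r : mid E -> Y, forall z,
    ext_i E (r z) = z - L (ext_p E z).
  by apply: ext_i_lift => z; rewrite (linear_sub (op_linear _)) Lp subrr.
have [b Hb] : exists b : mid E -> Y, forall z,
    ext_i E (b z) = z - B (ext_p E z).
  by apply: ext_i_lift => z; rewrite (linear_sub (op_linear _)) Bp subrr.
have rl : linear r.
  by apply: ext_i_lift_linear Hr _ => a x y; rewrite op_linear Ll scalerBr; abel.
have bb : lbounded b.
  apply: ext_i_lift_lbounded Hb _; apply: lboundedB; first exact: lbounded_id.
  exact: lbounded_comp Bb (op_lbounded _).
have rE z : r z = b z + F (ext_p E z).
  by apply: (@ext_i_inj _ _ _ _ E); rewrite (linear_add (op_linear _)) Hr Hb iF; abel.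
pose t z := ext_i E' (beta (r z) - l (ext_p E z)) + L' (gamma (ext_p E z)).
have tl : linear t.
  move=> a x y; rewrite /t !(linear_sub (op_linear (ext_i E'))).
  by rewrite op_linear rl ll !op_linear Ll' !(scalerDr, scalerN); abel.
have tb : lbounded t.
  apply: (@eq_lbounded _ _ _ _ (fun z => ext_i E' (beta (b z)) +
      ext_i E' (beta (F (ext_p E z)) - F' (gamma (ext_p E z)) - l (ext_p E z)) +
      B' (gamma (ext_p E z)))) => [z|].
    rewrite /t rE (linear_add (op_linear beta)) !(linear_sub (op_linear _)).
    by rewrite (linear_add (op_linear _)) iF'; abel.
  apply: lboundedD; last first.
    apply: lbounded_comp Bb' _.
    exact: lbounded_comp (op_lbounded gamma) (op_lbounded _).
  apply: lboundedD; last first.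
    apply: lbounded_comp (op_lbounded _) _.
    exact: (lbounded_comp lb (op_lbounded (ext_p E))).
  apply: lbounded_comp (op_lbounded _) _.
  exact: lbounded_comp (op_lbounded beta) bb.
have [u ut] := lbounded_operator tl tb.
exists u; split=> [y|z]; rewrite ut /t.
  have -> : r (ext_i E y) = y.
    apply: (@ext_i_inj _ _ _ _ E); rewrite Hr ext_pi (linear_zero Ll) subr0//.
  rewrite ext_pi (linear_zero ll) subr0 (linear_zero (op_linear gamma)).
  by rewrite (linear_zero Ll') addr0.
by rewrite (linear_add (op_linear _)) ext_pi add0r Lp'.
Qed.

End Morphisms.

(** A splitting is a section that is both linear and bounded. *)
Lemma ext_split_near (X Y : qbanach k) (E : extension X Y) (F : X -> Y) :
  represents E F -> ext_split E <-> near_linear F.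
Proof.
move=> [B [L [Bs Ll Lp iF]]]; have [Bh _ Bp] := Bs.
have Bb := bounded_section_lbounded Bs.
split=> [[s sp]|[l ll lb]].
  have [l Hl] : exists l : X -> Y, forall x, ext_i E (l x) = s x - L x.
    by apply: ext_i_lift => x; rewrite (linear_sub (op_linear _)) sp Lp subrr.
  exists l.
    apply: ext_i_lift_linear Hl _ => a x y.
    by rewrite op_linear Ll scalerBr; abel.
  apply: (@ext_i_lift_lbounded _ _ E _ (fun x => B x - s x)) => [x|].
    by rewrite (linear_sub (op_linear _)) iF Hl; abel.
  by apply: lboundedB => //; exact: op_lbounded.
have sl : linear (fun x => L x + ext_i E (l x)).
  by move=> a x y; rewrite Ll ll op_linear scalerDr; abel.
have [|s Hs] := lbounded_operator sl.
  apply: (@eq_lbounded _ _ _ _ (fun x => B x - ext_i E (F x - l x))) => [x|].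
    by rewrite (linear_sub (op_linear _)) iF; abel.
  by apply: lboundedB => //; exact: lbounded_comp (op_lbounded _) lb.
exists s => x.
by rewrite Hs (linear_add (op_linear _)) Lp ext_pi addr0.
Qed.

End Representations.

(** * Twisted sums, push-outs and pull-backs *)

Section TwistedSum.
Variables (R : realType) (k : scalar_kind R) (X Y : qbanach k).
Variable F : quasilinear X Y.

Let F0 : F 0 = 0. Proof. exact: homogeneous0 (@ql_homogeneous _ _ _ _ F). Qed.

Let tw_normP : is_semi_quasi_norm
  (fun z : (Y * X)%type => qnorm (z.1 - F z.2) + qnorm z.2).
Proof.
split=> [z|a z|]; first by rewrite addr_ge0.
  by rewrite /= ql_homogeneous -scalerBr !qnormZ mulrDr.
have [D D1 HD] := qnormD_ge1 X; have D0 : 0 <= D by apply: le_trans D1.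
have [D' D1' HD'] := qnormD_ge1 Y; have D0' : 0 <= D' by apply: le_trans D1'.
exists (D' * (D' + ql_norm F) + D) => x y /=.
have -> : x.1 + y.1 - F (x.2 + y.2) = ((x.1 - F x.2) + (y.1 - F y.2)) -
    (F (x.2 + y.2) - F x.2 - F y.2) by abel.
have xy0 : 0 <= qnorm x.2 + qnorm y.2 by rewrite addr_ge0.
have xy1 : 0 <= qnorm (x.1 - F x.2) + qnorm (y.1 - F y.2) by rewrite addr_ge0.
have Q0 := ql_norm_ge0 F.
rewrite mulrDl; apply: lerD.
  apply: le_trans (HD' _ _) _; rewrite -mulrA ler_wpM2l// qnormN mulrDl.
  apply: lerD.
    apply: le_trans (HD' _ _) _; rewrite ler_wpM2l//.
    by rewrite addrACA lerDl.
  apply: le_trans (ql_norm_const F _ _) _; rewrite ler_wpM2l//.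
  by rewrite addrACA lerDr.
apply: le_trans (HD _ _) _; rewrite ler_wpM2l//.
by rewrite addrACA lerDr.
Qed.

Definition twisted_space : sqspace k := SQSpace tw_normP.

Let tw_complete : qcomplete twisted_space.
Proof.
move=> G FG /qcauchyP Gc.
have [D D1 HD] := qnormD_ge1 Y; have D0 : 0 < D by apply: lt_le_trans D1.
pose H : set_system (qtop X) := (fun z : Y * X => z.2) @ G.
have HF : ProperFilter H by exact: fmap_proper_filter.
have /sqb_complete/cvg_ex[x /qcvgP Hx] : cauchy H.
  apply/qcauchyP => e /Gc[A GA HA]; exists [set z.2 | z in A].
    by rewrite /H /=; apply: filterS GA => a Aa; exists a.
  move=> _ _ [a Aa <-] [b Ab <-]; apply: le_trans (HA _ _ Aa Ab).
  by rewrite lerDr.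
(* If x is the limit of the second components then the first component y of the limit
   must satisfy |(y - z.1) - F(x - z.2)| -> 0, so it is the limit of z.1 + F(x - z.2). *)
pose K : set_system (qtop Y) := (fun z : Y * X => z.1 + F (x - z.2)) @ G.
have KF : ProperFilter K by exact: fmap_proper_filter.
have Q0 := ql_norm_ge0 F.
have /sqb_complete/cvg_ex[y /qcvgP Ky] : cauchy K.
  apply/qcauchyP => e e0.
  have C0 : 0 < D * (1 + ql_norm F * 2).
    by rewrite mulr_gt0// ltr_wpDr// mulr_ge0.
  have d0 := divr_gt0 e0 C0; set d := e / _ in d0.
  have [A GA HA] := Gc d d0.
  exists ((fun z : Y * X => z.1 + F (x - z.2)) @`
    (A `&` [set z : Y * X | qnorm (x - z.2) <= d])).
    by rewrite /K /=; apply: filterS (filterI GA (Hx d d0 : G _)) => a Aa; exists a.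
  move=> _ _ [z [Az zd] <-] [z' [Az' zd'] <-]; rewrite /= in zd zd'.
  have Hzz : qnorm (z.1 - z'.1 - F (z.2 - z'.2)) + qnorm (z.2 - z'.2) <= d :=
    HA _ _ Az Az'.
  have -> : z.1 + F (x - z.2) - (z'.1 + F (x - z'.2)) =
      (z.1 - z'.1 - F (z.2 - z'.2)) -
      (F ((z.2 - z'.2) + (x - z.2)) - F (z.2 - z'.2) - F (x - z.2)).
    by rewrite (_ : z.2 - z'.2 + (x - z.2) = x - z'.2); abel.
  apply: le_trans (HD _ _) _; rewrite qnormN.
  have H1 : qnorm (z.1 - z'.1 - F (z.2 - z'.2)) <= d.
    by apply: le_trans Hzz; rewrite lerDl.
  have H2 : qnorm (F (z.2 - z'.2 + (x - z.2)) - F (z.2 - z'.2) - F (x - z.2)) <=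
      ql_norm F * (d + d).
    apply: le_trans (ql_norm_const F _ _) _; rewrite ler_wpM2l// lerD//.
    by apply: le_trans Hzz; rewrite lerDr.
  apply: le_trans (ler_wpM2l (ltW D0) (lerD H1 H2)) _.
  have : D * (1 + ql_norm F * 2) * d = e by rewrite mulrC divfK// gt_eqF.
  by move=> <-; apply: eq_ler; ring.
apply/cvg_ex; exists ((y, x) : qtop twisted_space); apply/qcvgP => e e0.
have e2 : 0 < e / 2 by rewrite divr_gt0.
apply: filterS2 (Ky _ e2 : G _) (Hx _ e2 : G _) => z /= yz xz.
rewrite (splitr e) /qnorm /=; apply: lerD => //.
by move: yz; rewrite opprD addrA.
Qed.

Let tw_separated (z : twisted_space) : qnorm z = 0 -> z = 0.
Proof.
move=> /eqP; rewrite paddr_eq0// => /andP[/eqP z1 /eqP z2].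
case: z z1 z2 => y x /= + /qb_separated x0; rewrite {}x0 F0 subr0.
by move=> /qb_separated ->.
Qed.

Definition twisted_sum : qbanach k :=
  QBanach (qb_space := SQBanach tw_complete) tw_separated.

Let tw_i_is_operator : (fun y => (y, 0)) \in @is_operator R k Y twisted_sum.
Proof.
apply: (@bounded_is_operator _ _ _ _ _ 1).
  by move=> a x y; congr pair; rewrite /= scaler0 addr0.
by move=> y; rewrite mul1r {1}/qnorm /= F0 subr0 qnorm0 addr0.
Qed.

Let tw_p_is_operator : (fun z => z.2) \in @is_operator R k twisted_sum X.
Proof.
apply: (@bounded_is_operator _ _ _ _ _ 1) => // z.
by rewrite mul1r {2}/qnorm /= lerDr.
Qed.

Definition twisted_i : operator Y twisted_sum := Operator tw_i_is_operator.
Definition twisted_p : operator twisted_sum X := Operator tw_p_is_operator.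

Let tw_inj : injective twisted_i. Proof. by move=> x y []. Qed.

Let tw_surj x : exists z, twisted_p z = x. Proof. by exists (0, x). Qed.

Let tw_exact z : twisted_p z = 0 <-> exists y, twisted_i y = z.
Proof. by split=> [|[y <-]//]; case: z => y x /= ->; exists y. Qed.

Definition twisted_ext : extension X Y := Extension tw_inj tw_surj tw_exact.

(** The graph of F is a section whose norm is that of x. *)
Lemma twisted_represents : represents twisted_ext F.
Proof.
exists (fun x => (F x, x)), (fun x => (0, x)); split; first split=> //.
- by move=> a x; congr pair; exact: ql_homogeneous.
- exists 1 => x x1; rewrite {1}/qnorm /= subrr qnorm0 add0r//.
- by move=> a x y; congr pair; rewrite /= scaler0 addr0.
- by [].
- by move=> x; rewrite [RHS](_ : _ = (F x - 0, x - x))// subr0 subrr.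
Qed.

End TwistedSum.

Section UniversalSquares.
Variables (R : realType) (k : scalar_kind R).

Lemma dsum_represents (X1 X2 Y1 Y2 : qbanach k)
    (E1 : extension X1 Y1) (E2 : extension X2 Y2) F1 F2 :
  represents E1 F1 -> represents E2 F2 ->
  represents (dsum_ext E1 E2) (fun x => (F1 x.1, F2 x.2)).
Proof.
move=> [B1 [L1 [Bs1 Ll1 Lp1 iF1]]] [B2 [L2 [Bs2 Ll2 Lp2 iF2]]].
have [Bh1 [M1 HM1] Bp1] := Bs1; have [Bh2 [M2 HM2] Bp2] := Bs2.
exists (fun x => (B1 x.1, B2 x.2)), (fun x => (L1 x.1, L2 x.2)).
split; first split.
- by move=> a x; rewrite /= Bh1 Bh2.
- exists (M1 + M2) => x x1; rewrite {1}/qnorm /=; apply: lerD.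
    by apply: HM1; apply: le_trans x1; rewrite {2}/qnorm /= lerDl.
  by apply: HM2; apply: le_trans x1; rewrite {2}/qnorm /= lerDr.
- by case=> x y; rewrite /= Bp1 Bp2.
- by move=> a x y; rewrite /= Ll1 Ll2.
- by case=> x y; rewrite /= Lp1 Lp2.
- by move=> x; rewrite /= iF1 iF2.
Qed.

(** In a commutative diagram of extensions with the same quotient, t and i' together are
onto the middle space of E', and what they identify is identified by every competing
pair of maps; by the open mapping theorem the induced map is continuous. *)
Lemma pushout_extP (X Y Y' : qbanach k) (beta : operator Y Y')
    (E : extension X Y) (E' : extension X Y') :
  pushout_ext beta E E' <-> ext_mor beta (op_id X) E E'.
Proof.
split=> [[t [pt [ti _]]]|[t [ti pt]]].
  exists t; split=> // y.
  by have := congr1 (fun u : operator Y (mid E') => u y) ti.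
exists t; split=> //; split; first by apply: opP => y; exact: ti.
move=> W f g fg.
have {}fg y : f (ext_i E y) = g (beta y).
  by have := congr1 (fun u : operator Y W => u y) fg.
have cover z' : exists z y', z' = t z + ext_i E' y'.
  have [z pz] := ext_p_surj E (ext_p E' z').
  have /ext_exact[y' Hy'] : ext_p E' (z' - t z) = 0.
    by rewrite (linear_sub (op_linear _)) pt /= pz subrr.
  by exists z, y'; rewrite Hy'; abel.
have sl : linear (fun w : dsum (mid E) Y' => t w.1 + ext_i E' w.2).
  by move=> a x y; rewrite /= !op_linear scalerDr; abel.
have gl : linear (fun w : dsum (mid E) Y' => f w.1 + g w.2).
  by move=> a x y; rewrite /= !op_linear scalerDr; abel.
have fstb : lbounded (fun w : dsum (mid E) Y' => w.1).
  by exists 1 => // w; rewrite mul1r {2}/qnorm /= lerDl.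
have sndb : lbounded (fun w : dsum (mid E) Y' => w.2).
  by exists 1 => // w; rewrite mul1r {2}/qnorm /= lerDr.
have [|s Hs] := lbounded_operator sl.
  by apply: lboundedD; exact: lbounded_comp (op_lbounded _) _.
have [|m Hm] := lbounded_operator gl.
  by apply: lboundedD; exact: lbounded_comp (op_lbounded _) _.
have [||h Hh] := @operator_factor _ _ _ _ _ s m.
- by move=> z'; have [z [y' ->]] := cover z'; exists (z, y'); rewrite Hs.
- move=> [z y']; rewrite Hs Hm /= => zy.
  have /ext_exact[y yz] : ext_p E z = 0.
    have := congr1 (ext_p E') zy.
    by rewrite (linear_add (op_linear _)) pt ext_pi addr0 (linear_zero (op_linear _)).
  move: zy; rewrite -yz ti -(linear_add (op_linear _)) => zy.
  have {}zy : beta y + y' = 0.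
    by apply: (@ext_i_inj _ _ _ _ E'); rewrite zy (linear_zero (op_linear _)).
  by rewrite fg -(linear_add (op_linear _)) zy (linear_zero (op_linear _)).
exists h; split; first split; try apply: opP => w /=.
- have := Hh (w, 0); rewrite Hs Hm /=.
  by rewrite !(linear_zero (op_linear _)) !addr0.
- have := Hh (0, w); rewrite Hs Hm /=.
  by rewrite !(linear_zero (op_linear _)) !add0r.
- move=> h' [h't h'i]; apply: opP => z'; have [z [y' ->]] := cover z'.
  have := Hh (z, y'); rewrite Hs Hm /= => ->.
  rewrite (linear_add (op_linear _)) -h't -h'i.
  by [].
Qed.

(** The pair (t, p') embeds the middle space of E' as the closed subspace of pairs with
equal images in X. *)
Lemma pullback_extP (X X' Y : qbanach k) (gamma : operator X' X)
    (E : extension X Y) (E' : extension X' Y) :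
  pullback_ext gamma E E' <-> ext_mor (op_id Y) gamma E' E.
Proof.
split=> [[t [ti [pt _]]]|[t [ti pt]]].
  exists t; split=> // z.
  by have := congr1 (fun u : operator (mid E') X => u z) pt.
exists t; split=> //; split; first by apply: opP => z; exact: pt.
move=> W f g fg.
have {}fg w : ext_p E (f w) = gamma (g w).
  by have := congr1 (fun u : operator W X => u w) fg.
have inj z : t z = 0 -> ext_p E' z = 0 -> z = 0.
  move=> tz /ext_exact[y yz]; move: tz; rewrite -yz ti => iy.
  have -> : y = 0.
    by apply: (@ext_i_inj _ _ _ _ E); rewrite iy (linear_zero (op_linear _)).
  exact: linear_zero (op_linear _).
have sl : linear (fun z : mid E' => (t z, ext_p E' z) : dsum (mid E) X').
  by move=> a x y; rewrite !op_linear.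
have vl : linear (fun a : dsum (mid E) X' => ext_p E a.1 - gamma a.2).
  by move=> a x y; rewrite /= !op_linear scalerBr; abel.
have gl : linear (fun w : W => (f w, g w) : dsum (mid E) X').
  by move=> a x y; rewrite !op_linear.
have pairb (V : qbanach k) (u : operator V (mid E)) (v : operator V X') :
    lbounded (fun z : V => (u z, v z) : dsum (mid E) X').
  have [M M0 HM] := op_lbounded u; have [M' M0' HM'] := op_lbounded v.
  exists (M + M'); first exact: addr_ge0.
  by move=> z; rewrite {1}/qnorm /= mulrDl lerD.
have [s Hs] := lbounded_operator sl (pairb _ _ _).
have [m Hm] := lbounded_operator gl (pairb _ _ _).
have [|v Hv] := lbounded_operator vl.
  apply: lboundedB.
    apply: (lbounded_comp (op_lbounded (ext_p E))).
    by exists 1 => // w; rewrite mul1r {2}/qnorm /= lerDl.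
  apply: (lbounded_comp (op_lbounded gamma)).
  by exists 1 => // w; rewrite mul1r {2}/qnorm /= lerDr.
have [|||h Hh] := @operator_lift _ _ _ _ _ _ s v m.
- move=> z z'; rewrite !Hs => -[tz pz]; apply/eqP; rewrite -subr_eq0; apply/eqP.
  by apply: inj; rewrite (linear_sub (op_linear _)) ?tz ?pz subrr.
- move=> [z x']; rewrite Hv /=; split=> [/eqP|[z0]]; last first.
    by rewrite Hs => -[<- <-]; rewrite pt subrr.
  rewrite subr_eq0 => /eqP pz; have [z0 pz0] := ext_p_surj E' x'.
  have /ext_exact[y yz] : ext_p E (z - t z0) = 0.
    by rewrite (linear_sub (op_linear _)) pt pz0 pz subrr.
  exists (z0 + ext_i E' y); rewrite Hs; congr pair.
    by rewrite (linear_add (op_linear _)) ti /= yz; abel.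
  by rewrite (linear_add (op_linear _)) ext_pi addr0.
- by move=> w; rewrite Hm Hv /= fg subrr.
exists h; split; first split; try apply: opP => w /=.
- by have := Hh w; rewrite Hs Hm => -[].
- by have := Hh w; rewrite Hs Hm => -[].
- move=> h' [h't h'p]; apply: opP => w; apply/eqP; rewrite -subr_eq0; apply/eqP.
  have := Hh w; rewrite Hs Hm => -[thw phw].
  apply: inj; rewrite (linear_sub (op_linear _)).
    by rewrite thw -h't subrr.
  by rewrite phw -h'p subrr.
Qed.

End UniversalSquares.

(** * Extensions and their classes in Q(X, Y) *)

Section Action.
Variables (R : realType) (k : scalar_kind R).

Section OneAction.
Variables (X X' Y Y' : qbanach k) (beta : operator Y Y') (gamma : operator X' X).

Lemma ql_act_const (F : quasilinear X Y) :
  quasilinear_const (fun x => beta (F (gamma x)))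
    (op_norm beta * op_norm gamma * ql_norm F).
Proof.
move=> x y; rewrite -!(linear_sub (op_linear beta)) (linear_add (op_linear gamma)).
apply: le_trans (op_norm_bound _ _) _; rewrite -!mulrA ler_wpM2l ?op_norm_ge0//.
apply: le_trans (ql_norm_const F _ _) _; rewrite mulrCA ler_wpM2l ?ql_norm_ge0//.
by rewrite mulrDr lerD// op_norm_bound.
Qed.

Lemma ql_act_quasilinear (F : quasilinear X Y) :
  (fun x => beta (F (gamma x))) \in @is_quasilinear _ _ X' Y'.
Proof.
apply/asboolP; split; last by exists (op_norm beta * op_norm gamma * ql_norm F);
  exact: ql_act_const.
by move=> a x; rewrite op_homogeneous ql_homogeneous op_homogeneous.
Qed.

Definition ql_act (F : quasilinear X Y) : quasilinear X' Y' :=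
  Quasilinear (ql_act_quasilinear F).

Lemma ql_act_norm F :
  ql_norm (ql_act F) <= op_norm beta * op_norm gamma * ql_norm F.
Proof.
apply: ql_norm_le; last exact: ql_act_const.
by rewrite !mulr_ge0 ?op_norm_ge0 ?ql_norm_ge0.
Qed.

Lemma ql_act_near (F G : X -> Y) : near_linear (fun x => F x - G x) ->
  near_linear (fun x => beta (F (gamma x)) - beta (G (gamma x))).
Proof.
move=> [L Ll Lb]; exists (fun x => beta (L (gamma x))).
  by move=> a x y; rewrite op_linear Ll op_linear.
apply: eq_lbounded (lbounded_comp (op_lbounded beta)
  (lbounded_comp Lb (op_lbounded gamma))) => x.
by rewrite !(linear_sub (op_linear beta)).
Qed.

(** The class of beta F gamma depends only on that of F, and its norm is controlled
by that of any representative of the class. *)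
Lemma exists_Q_act : exists u : operator (Q_space X Y) (Q_space X' Y'),
  forall F, u (Q_cls F) = Q_cls (ql_act F).
Proof.
have /choice[rep repK] (c : Q_space X Y) : exists F, Q_cls F = c by exact: Q_cls_surj.
pose f c : Q_space X' Y' := Q_cls (ql_act (rep c)).
have fE F : f (Q_cls F) = Q_cls (ql_act F).
  by apply/Q_clsE; apply: ql_act_near; apply/Q_clsE; rewrite repK.
have fl : linear f.
  move=> a c d; rewrite -[in LHS](repK c) -[in LHS](repK d) -Q_cls_lin fE /f -Q_cls_lin.
  apply/Q_clsE; apply: near_linear_linear => b x y.
  rewrite !(ql_lin_apply, op_linear) /= !(ql_lin_apply, op_linear) !subrr.
  by rewrite scaler0 addr0.
have [|u Hu] := lbounded_operator fl.
  exists (op_norm beta * op_norm gamma); first by rewrite mulr_ge0 ?op_norm_ge0.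
  move=> c; apply: le_Q_norm; first by rewrite mulr_ge0 ?op_norm_ge0.
  by move=> F <-; rewrite fE; exact: le_trans (Q_cls_norm _) (ql_act_norm F).
by exists u => F; rewrite Hu fE.
Qed.

Definition Q_act : operator (Q_space X Y) (Q_space X' Y') := projT1 (cid exists_Q_act).

Lemma Q_actE F : Q_act (Q_cls F) = Q_cls (ql_act F).
Proof. by rewrite /Q_act; case: cid. Qed.

End OneAction.

Lemma eq_Q_cls (X Y : qbanach k) (F G : quasilinear X Y) : F =1 G -> Q_cls F = Q_cls G.
Proof. by move=> FG; congr Q_cls; apply: val_inj; exact/funext. Qed.

Lemma eq_Q_act (X X' Y Y' : qbanach k) (beta beta' : operator Y Y')
    (gamma gamma' : operator X' X) (c : Q_space X Y) :
  beta =1 beta' -> gamma =1 gamma' -> Q_act beta gamma c = Q_act beta' gamma' c.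
Proof. by move=> /opP -> /opP ->. Qed.

Lemma Q_act_id (X Y : qbanach k) (c : Q_space X Y) : Q_act (op_id Y) (op_id X) c = c.
Proof. by have [F <-] := Q_cls_surj c; rewrite Q_actE; exact: eq_Q_cls. Qed.

Lemma Q_act_comp (X X' X'' Y Y' Y'' : qbanach k) (beta : operator Y Y')
    (beta' : operator Y' Y'') (gamma : operator X' X) (gamma' : operator X'' X')
    (c : Q_space X Y) :
  Q_act beta' gamma' (Q_act beta gamma c) =
  Q_act (op_comp beta' beta) (op_comp gamma gamma') c.
Proof. by have [F <-] := Q_cls_surj c; rewrite !Q_actE; exact: eq_Q_cls. Qed.

Lemma Q_act_lin (X X' Y Y' : qbanach k) (gamma : operator X' X)
    (a : scalar k) (u v : operator Y Y') (c : Q_space X Y) :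
  Q_act (a *: u + v) gamma c = a *: Q_act u gamma c + Q_act v gamma c.
Proof.
by have [F <-] := Q_cls_surj c; rewrite !Q_actE -Q_cls_lin; exact: eq_Q_cls.
Qed.

Lemma Q_act_scale_id (X Y : qbanach k) (a : scalar k) (c : Q_space X Y) :
  Q_act (a *: op_id Y) (op_id X) c = a *: c.
Proof.
have [F <-] := Q_cls_surj c; rewrite Q_actE -(linear_scale (@Q_cls_lin _ _ X Y)).
exact: eq_Q_cls.
Qed.

Lemma Q_act_norm (X X' Y Y' : qbanach k) (gamma : operator X' X)
    (u : operator Y Y') (c : Q_space X Y) :
  qnorm (Q_act u gamma c) <= op_norm u * op_norm gamma * qnorm c.
Proof.
have uv0 : 0 <= op_norm u * op_norm gamma by rewrite mulr_ge0 ?op_norm_ge0.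
apply: le_Q_norm => // F <-; rewrite Q_actE.
exact: le_trans (Q_cls_norm _) (ql_act_norm _ _ F).
Qed.

End Action.

Section Classes.
Variables (R : realType) (k : scalar_kind R).

Definition ext_rep (X Y : qbanach k) (E : extension X Y) : quasilinear X Y :=
  projT1 (cid (exists_represents E)).

Lemma ext_repP (X Y : qbanach k) (E : extension X Y) : represents E (ext_rep E).
Proof. by rewrite /ext_rep; case: cid. Qed.

Definition ext_cls (X Y : qbanach k) (E : extension X Y) : Q_space X Y :=
  Q_cls (ext_rep E).

(** The dictionary [ext_morP] in terms of classes. *)
Lemma ext_morE (X Y X' Y' : qbanach k) (beta : operator Y Y')
    (gamma : operator X X') (E : extension X Y) (E' : extension X' Y') :
  ext_mor beta gamma E E' <->
  Q_act beta (op_id X) (ext_cls E) = Q_act (op_id Y') gamma (ext_cls E').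
Proof.
rewrite !Q_actE Q_clsE; exact: ext_morP (ext_repP E) (ext_repP E').
Qed.

Lemma ext_mor_id (X Y : qbanach k) (E : extension X Y) :
  ext_mor (op_id Y) (op_id X) E E.
Proof. by exists (op_id (mid E)). Qed.

Lemma ext_clsE (X Y : qbanach k) (E : extension X Y) (F : quasilinear X Y) :
  represents E F -> ext_cls E = Q_cls F.
Proof.
move=> EF; apply/Q_clsE.
exact: (ext_morP (op_id Y) (op_id X) (ext_repP E) EF).1 (ext_mor_id E).
Qed.

Lemma ext_cls_represents (X Y : qbanach k) (E : extension X Y)
    (F : quasilinear X Y) : ext_cls E = Q_cls F -> represents E F.
Proof.
move/Q_clsE; apply: represents_near (ext_repP E); exact: ql_homogeneous.
Qed.

Lemma ext_cls_surj (X Y : qbanach k) (c : Q_space X Y) : exists E, ext_cls E = c.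
Proof.
have [F <-] := Q_cls_surj c; exists (twisted_ext F).
apply: ext_clsE; exact: twisted_represents.
Qed.

Lemma pushout_extE (X Y Y' : qbanach k) (beta : operator Y Y')
    (E : extension X Y) (E' : extension X Y') :
  pushout_ext beta E E' <-> ext_cls E' = Q_act beta (op_id X) (ext_cls E).
Proof. by rewrite pushout_extP ext_morE Q_act_id; split. Qed.

Lemma pullback_extE (X X' Y : qbanach k) (gamma : operator X' X)
    (E : extension X Y) (E' : extension X' Y) :
  pullback_ext gamma E E' <-> ext_cls E' = Q_act (op_id Y) gamma (ext_cls E).
Proof. by rewrite pullback_extP ext_morE Q_act_id. Qed.

Lemma ext_equivE (X Y : qbanach k) (E E' : extension X Y) :
  ext_equiv E E' <-> ext_cls E = ext_cls E'.
Proof. by rewrite -(Q_act_id (ext_cls E)) -(Q_act_id (ext_cls E')) -ext_morE. Qed.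

Lemma ext_splitE (X Y : qbanach k) (E : extension X Y) :
  ext_split E <-> ext_cls E = 0.
Proof.
by rewrite Q_cls_eq0; exact: ext_split_near (ext_repP E).
Qed.

Lemma ext_cls_dsum (X1 X2 Y1 Y2 : qbanach k) (E1 : extension X1 Y1)
    (E2 : extension X2 Y2) : exists2 F : quasilinear (dsum X1 X2) (dsum Y1 Y2),
  ext_cls (dsum_ext E1 E2) = Q_cls F &
  forall x, F x = (ext_rep E1 x.1, ext_rep E2 x.2).
Proof.
have H := dsum_represents (ext_repP E1) (ext_repP E2).
have [F FE] := represents_quasilinear H; exists F => //.
by apply: ext_clsE; rewrite (funext FE).
Qed.

(** The direct sum of the extensions is represented by F1 x F2, and the codiagonal and
the diagonal turn F1 x F2 into F1 + F2. *)
Lemma baer_sumE (X Y : qbanach k) (E1 E2 E : extension X Y) :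
  baer_sum E1 E2 E <-> ext_cls E = ext_cls E1 + ext_cls E2.
Proof.
have -> : ext_cls E1 + ext_cls E2 =
    Q_act (op_codiag Y) (op_diag X) (ext_cls (dsum_ext E1 E2)).
  have [F -> FE] := ext_cls_dsum E1 E2; rewrite Q_actE.
  rewrite -[ext_cls E1]scale1r -Q_cls_lin; apply: eq_Q_cls => x.
  by rewrite ql_lin_apply scale1r /= FE.
split=> [[E' [/pullback_extE E'1 /pushout_extE ->]]|EE].
  by rewrite E'1 Q_act_comp; exact: eq_Q_act.
have [E' E'E] := ext_cls_surj (Q_act (op_id (dsum Y Y)) (op_diag X)
  (ext_cls (dsum_ext E1 E2))).
exists E'; split; first exact/pullback_extE.
by apply/pushout_extE; rewrite E'E Q_act_comp EE; exact: eq_Q_act.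
Qed.

(** The defects of B and of i F are equal, since L is linear. *)
Lemma section_constE (X Y : qbanach k) (E : extension X Y) (F : quasilinear X Y)
    (B L : X -> mid E) : linear L -> (forall x, ext_i E (F x) = B x - L x) ->
  section_const B = (ql_norm F)%:E.
Proof.
move=> Ll iF; have defect x y :
    ext_i E (F (x + y) - F x - F y) = B (x + y) - B x - B y.
  by rewrite !(linear_sub (op_linear _)) !iF (linear_add Ll); abel.
have F0 : F 0 = 0 by exact: homogeneous0 (@ql_homogeneous _ _ _ _ F).
have gt0 (x y : X) : (x, y) <> (0, 0) -> 0 < qnorm x + qnorm y.
  move=> xy; rewrite lt_def addr_ge0// andbT paddr_eq0// !qnorm_eq0.
  by apply/negP => /andP[/eqP x0 /eqP y0]; apply: xy; rewrite x0 y0.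
apply/eqP; rewrite eq_le; apply/andP; split.
  apply: ge_ereal_sup => _ [->|[x [y [w [xy wE ->]]]]].
    by rewrite lee_fin ql_norm_ge0.
  have -> : w = F (x + y) - F x - F y.
    by apply: (@ext_i_inj _ _ _ _ E); rewrite wE defect.
  rewrite lee_fin ler_pdivrMr; last exact: gt0.
  exact: ql_norm_const.
set S := section_const B.
have S0 : (0 <= S)%E by apply: ereal_sup_ubound; left.
move: S0; case Ss: S => [s| |//] s0.
- rewrite lee_fin; rewrite lee_fin in s0; apply: ql_norm_le => // x y.
  case: (pselect ((x, y) = (0, 0))) => [[-> ->]|xy].
    by rewrite addr0 F0 !subr0 !qnorm0 addr0 mulr0.
  rewrite -ler_pdivrMr; last exact: gt0.
  rewrite -lee_fin -Ss; apply: ereal_sup_ubound; right.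
  by exists x, y, (F (x + y) - F x - F y).
- by rewrite leey.
Qed.

(** Every bounded homogeneous section gives a representative of the class with the same
constant, and by [ext_cls_represents] every representative arises in this way. *)
Lemma ext_rhoE (X Y : qbanach k) (E : extension X Y) :
  ext_rho E = (qnorm (ext_cls E))%:E.
Proof.
apply/eqP; rewrite eq_le; apply/andP; split; last first.
  apply: le_ereal_inf_tmp => _ [B Bs <-].
  have [L Ll Lp] := linear_section (op_linear (ext_p E)) (@ext_p_surj _ _ _ _ E).
  have [F HF] : exists F : X -> Y, forall x, ext_i E (F x) = B x - L x.
    apply: ext_i_lift => x; case: Bs => _ _ Bp.
    by rewrite (linear_sub (op_linear _)) Bp Lp subrr.
  have FE : represents E F by exists B, L.
  have [G GF] := represents_quasilinear FE.
  have iG x : ext_i E (G x) = B x - L x by rewrite GF.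
  rewrite (section_constE Ll iG) lee_fin (ext_clsE (F := G)).
    exact: Q_cls_norm.
  by exists B, L.
apply/lee_addgt0Pr => e e0.
have [F Fc Fe] := Q_norm_lift (ext_cls E) e0.
have [B [L [Bs Ll _ iF]]] := ext_cls_represents (esym Fc).
rewrite -EFinD; apply: (@le_trans _ _ (ql_norm F)%:E); last by rewrite lee_fin.
by apply: ereal_inf_lbound; exists B => //; exact: section_constE Ll iF.
Qed.

End Classes.

(** * The quotient of the operators on the kernel of a presentation *)

(** The comparison with Ext^varpi depends on the presentation 0 -> K -> M -> X -> 0
only through the property of M that quasilinear maps from M to Y are uniformly
close to linear ones. *)
Section Presented.
Variables (R : realType) (k : scalar_kind R) (X K Y : qbanach k).
Variable E0 : extension X K.
Hypothesis quasilinear_mid : exists2 M, 0 <= M &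
  forall (F : mid E0 -> Y) Q, 0 <= Q -> homogeneous F -> quasilinear_const F Q ->
  exists2 T : mid E0 -> Y, linear T & forall z, qnorm (F z - T z) <= M * Q * qnorm z.

(** The class of the push-out of E0 along u. *)
Definition pushout_cls (u : op_space K Y) : Q_space X Y :=
  Q_act u (op_id X) (ext_cls E0).

Lemma pushout_cls_linear : linear pushout_cls.
Proof. by move=> a u v; exact: Q_act_lin. Qed.

Lemma pushout_cls_bounded : lbounded pushout_cls.
Proof.
exists (op_norm (op_id X) * qnorm (ext_cls E0)).
  by rewrite mulr_ge0 ?op_norm_ge0.
by move=> u; apply: le_trans (Q_act_norm _ _ _) _; rewrite -mulrA mulrC.
Qed.

(** The push-out along u splits if and only if u extends to the middle space; a morphism
from E0 to the trivial extension is the extension of u paired with the quotient map. *)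
Lemma pushout_cls_eq0 u : pushout_cls u = 0 <->
  exists v : operator (mid E0) Y, op_comp v (ext_i E0) = u.
Proof.
have cls0 : ext_cls (twisted_ext (0 : quasilinear X Y)) = 0.
  rewrite (ext_clsE (twisted_represents _)); apply/Q_cls_eq0.
  by apply: near_linear_linear => a x y; rewrite scaler0 addr0.
have morE := ext_morE u (op_id X) E0 (twisted_ext (0 : quasilinear X Y)).
rewrite cls0 (linear_zero (op_linear _)) -/(pushout_cls u) in morE.
rewrite -morE; split=> [[t [ti _]]|[v vu]].
  have [||v Hv] := @lbounded_operator _ _ (mid E0) Y (fun z => (t z).1).
  - by move=> a x y; rewrite op_linear.
  - apply: (lbounded_comp (f := t)
      (g := fun z : twisted_sum (0 : quasilinear X Y) => z.1)).
      by exists 1 => // z; rewrite mul1r {2}/qnorm /= subr0 lerDl.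
    exact: op_lbounded.
  by exists v; apply: opP => x; rewrite /= Hv ti.
have tl : linear (fun z : mid E0 =>
    (v z, ext_p E0 z) : twisted_sum (0 : quasilinear X Y)).
  by move=> a x y; rewrite !op_linear.
have [|t Ht] := lbounded_operator tl.
  have [M M0 HM] := op_lbounded v; have [M' M0' HM'] := op_lbounded (ext_p E0).
  exists (M + M'); first exact: addr_ge0.
  by move=> z; rewrite {1}/qnorm /= subr0 mulrDl lerD.
exists t; split=> [x|z]; rewrite Ht //=.
by rewrite ext_pi -vu.
Qed.

(** The composite of F with the quotient map is close to a linear T, and vanishes on
K; so T is bounded on K, by a multiple of Q(F).  With B - L = i omega,
T i omega - F + T L = T B - F, the difference of T and F p along B. *)
Lemma pushout_cls_lift : exists2 C, 0 <= C & forall F : quasilinear X Y,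
  exists2 u, pushout_cls u = Q_cls F & op_norm u <= C * ql_norm F.
Proof.
have [M M0 HM] := quasilinear_mid.
pose NP := op_norm (ext_p E0); have NP0 : 0 <= NP by exact: op_norm_ge0.
pose NI := op_norm (ext_i E0); have NI0 : 0 <= NI by exact: op_norm_ge0.
exists (M * NP * NI); first by rewrite !mulr_ge0.
move=> F; have Q0 := ql_norm_ge0 F.
have Fc : quasilinear_const (fun z => F (ext_p E0 z)) (ql_norm F * NP).
  move=> x y; rewrite (linear_add (op_linear _)).
  apply: le_trans (ql_norm_const F _ _) _; rewrite -mulrA ler_wpM2l// mulrDr.
  by rewrite lerD// op_norm_bound.
have [|||T Tl TF] := HM (fun z => F (ext_p E0 z)) (ql_norm F * NP).
- by rewrite mulr_ge0.
- by move=> a z; rewrite op_homogeneous ql_homogeneous.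
- exact: Fc.
have F0 : F 0 = 0 by exact: homogeneous0 (@ql_homogeneous _ _ _ _ F).
have TiB x : qnorm (T (ext_i E0 x)) <= M * NP * NI * ql_norm F * qnorm x.
  have := TF (ext_i E0 x); rewrite ext_pi F0 sub0r qnormN => /le_trans; apply.
  rewrite [leRHS](_ : _ = M * (ql_norm F * NP) * (NI * qnorm x)); last by ring.
  by rewrite ler_wpM2l ?op_norm_bound// mulr_ge0// mulr_ge0.
have C0 : 0 <= M * NP * NI * ql_norm F by rewrite !mulr_ge0.
have [||u Hu] := @lbounded_operator _ _ K Y (fun x => T (ext_i E0 x)).
- by move=> a x y; rewrite op_linear Tl.
- by exists (M * NP * NI * ql_norm F).
exists u; last by apply: op_norm_le => // x; rewrite Hu.
rewrite /pushout_cls /ext_cls Q_actE; apply/Q_clsE.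
have [B [L [Bs Ll _ iF]]] := ext_repP E0; have [_ _ Bp] := Bs.
exists (fun x => - T (L x)).
  by move=> a x y; rewrite Ll Tl opprD scalerN.
have TB : lbounded (fun z => F (ext_p E0 z) - T z).
  by exists (M * (ql_norm F * NP)); rewrite // !mulr_ge0.
apply: eq_lbounded (lboundedN (lbounded_comp TB (bounded_section_lbounded Bs))) => x.
by rewrite /= Hu iF (linear_sub Tl) Bp; abel.
Qed.

Lemma Q_space_complete : qcomplete (Q_space X Y).
Proof.
have [C C0 HC] := pushout_cls_lift.
apply: (complete_image (C := C) (@op_space_complete _ _ K Y)
  pushout_cls_linear pushout_cls_bounded) => c e e0.
have C1 : 0 < C + 1 by rewrite ltr_wpDl.
have [F <- Fe] := Q_norm_lift c (divr_gt0 e0 C1).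
have [u uF uC] := HC F; exists u => //; apply: le_trans uC _.
apply: le_trans (ler_wpM2l C0 Fe) _; rewrite mulrDr lerD2l.
by rewrite mulrA ler_pdivrMr// mulrC ler_wpM2l ?(ltW e0)// lerDl.
Qed.

Definition restrictions : set (op_space K Y) :=
  [set op_comp v (ext_i E0) | v in [set: operator (mid E0) Y]].

Lemma restrictionsE u : restrictions u <-> pushout_cls u = 0.
Proof.
rewrite pushout_cls_eq0; split=> [[v _ vu]|[v vu]]; first by exists v.
by exists v.
Qed.

Lemma restrictions0 : restrictions 0.
Proof. by apply/restrictionsE; exact: linear_zero pushout_cls_linear. Qed.

Lemma restrictions_lin a u v :
  restrictions u -> restrictions v -> restrictions (a *: u + v).
Proof.
move=> /restrictionsE u0 /restrictionsE v0; apply/restrictionsE.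
by rewrite pushout_cls_linear u0 v0 scaler0 addr0.
Qed.

Definition varpi_space : sqspace k := quot_space restrictions0 restrictions_lin.

Definition varpi_cls : op_space K Y -> varpi_space :=
  quot_cls restrictions0 restrictions_lin.

Lemma varpi_cls_linear : linear varpi_cls.
Proof. exact: quot_cls_linear. Qed.

Lemma varpi_space_complete : qcomplete varpi_space.
Proof. apply: quot_complete; exact: op_space_complete. Qed.

Lemma varpi_cls_surj c : exists u, varpi_cls u = c.
Proof. by exists (quot_val c); exact: quot_valK. Qed.

Lemma varpi_quotient_map : is_quotient_map restrictions (@op_norm _ _ K Y) varpi_cls.
Proof. exact: (quot_is_quotient_map restrictions0 restrictions_lin). Qed.

(** The class map [pushout_cls] passes to the quotient by its kernel, and the liftings
of [pushout_cls_lift] bound the inverse. *)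
Lemma varpi_space_iso : exists (eta : operator varpi_space (Q_space X Y))
    (theta : operator (Q_space X Y) varpi_space),
  [/\ forall u, eta (varpi_cls u) = pushout_cls u, forall c, theta (eta c) = c &
      forall c, eta (theta c) = c].
Proof.
have same_cls u v : pushout_cls u = pushout_cls v <-> varpi_cls u = varpi_cls v.
  rewrite quot_clsE restrictionsE (linear_sub pushout_cls_linear).
  by split=> [->|/eqP]; rewrite ?subrr// subr_eq0 => /eqP.
have /choice[r Hr] c : exists u, varpi_cls u = c by exact: varpi_cls_surj.
have rE u : pushout_cls (r (varpi_cls u)) = pushout_cls u by apply/same_cls; rewrite Hr.
have el : linear (fun c => pushout_cls (r c)).
  move=> a c d; rewrite -pushout_cls_linear; apply/same_cls.
  by rewrite varpi_cls_linear !Hr.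
have [|eta Heta] := lbounded_operator el.
  have [M M0 HM] := pushout_cls_bounded; exists M => // c.
  apply: le_quot_normM => // u <-; rewrite rE; exact: HM.
have [C C0 HC] := pushout_cls_lift.
have /choice[s Hs] c : exists u, pushout_cls u = c.
  by have [F <-] := Q_cls_surj c; have [u uF _] := HC F; exists u.
have tl : linear (fun c => varpi_cls (s c)).
  move=> a c d; rewrite -varpi_cls_linear.
  by apply/same_cls; rewrite pushout_cls_linear !Hs.
have [|theta Htheta] := lbounded_operator tl.
  exists C => // c; apply: le_Q_norm => // F Fc.
  have [u uF uC] := HC F; apply: le_trans uC.
  have -> : varpi_cls (s c) = varpi_cls u by apply/same_cls; rewrite Hs uF Fc.
  exact: quot_norm_le.
exists eta, theta; split=> [u|c|c]; rewrite ?Heta ?Htheta ?rE//.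
  by rewrite -[RHS]Hr; apply/same_cls; rewrite Hs.
Qed.

End Presented.

(** * The three functors *)

Section TheFunctors.
Variables (R : realType) (k : scalar_kind R).
Variable P : forall X Y : qbanach k, presentation X Y.

Lemma quasilinear_presentation (X Y : qbanach k) : exists2 M, 0 <= M &
  forall (F : mid (pr_ext (P X Y)) -> Y) Q, 0 <= Q -> homogeneous F ->
  quasilinear_const F Q ->
  exists2 T : mid (pr_ext (P X Y)) -> Y, linear T &
    forall z, qnorm (F z - T z) <= M * Q * qnorm z.
Proof.
exact: quasilinear_ellq_near_linear (pr_q_lt (P X Y)) (pr_normable_Y (P X Y)).
Qed.

(** The completeness of Q(X, Y) is deduced from that of the space of operators K -> Y. *)
Definition Q_sqbanach (X Y : qbanach k) : sqbanach k :=
  SQBanach (Q_space_complete (quasilinear_presentation X Y)).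

Definition varpi_sqbanach (X Y : qbanach k) : sqbanach k :=
  SQBanach (@varpi_space_complete _ _ X _ Y (pr_ext (P X Y))).

Let fQ (a b : qbanach k * qbanach k) (f : operator a.1 b.1 * operator b.2 a.2) :
  operator (Q_sqbanach a.2 a.1) (Q_sqbanach b.2 b.1) := Q_act f.1 f.2.

Let fQ_id (a : product_category (Qcat k) (opposite (Qcat k))) :
  fQ (idm a) = op_id (Q_sqbanach a.2 a.1).
Proof. by apply: opP => c; exact: Q_act_id. Qed.

Let fQ_cmp (a b c : product_category (Qcat k) (opposite (Qcat k)))
    (g : hom b c) (f : hom a b) : fQ (cmp g f) = op_comp (fQ g) (fQ f).
Proof. by apply: opP => w; rewrite /= Q_act_comp. Qed.

Definition Q_functor : bifunctor k :=
  @Functor (product_category (Qcat k) (opposite (Qcat k))) (Qhalf k)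
    (fun a => Q_sqbanach a.2 a.1) fQ fQ_id fQ_cmp.

Let eta_theta (X Y : qbanach k) := varpi_space_iso (quasilinear_presentation X Y).

Definition eta (X Y : qbanach k) : operator (varpi_sqbanach X Y) (Q_sqbanach X Y) :=
  projT1 (cid (eta_theta X Y)).

Definition theta (X Y : qbanach k) : operator (Q_sqbanach X Y) (varpi_sqbanach X Y) :=
  projT1 (cid (projT2 (cid (eta_theta X Y)))).

Lemma eta_varpi_cls (X Y : qbanach k) u : 
  eta X Y (varpi_cls (pr_ext (P X Y)) u) = pushout_cls (pr_ext (P X Y)) u.
Proof. by have [] := projT2 (cid (projT2 (cid (eta_theta X Y)))). Qed.

Lemma etaK (X Y : qbanach k) c : theta X Y (eta X Y c) = c.
Proof. by have [] := projT2 (cid (projT2 (cid (eta_theta X Y)))). Qed.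

Lemma thetaK (X Y : qbanach k) c : eta X Y (theta X Y c) = c.
Proof. by have [] := projT2 (cid (projT2 (cid (eta_theta X Y)))). Qed.

Let fP (a b : qbanach k * qbanach k) (f : operator a.1 b.1 * operator b.2 a.2) :
    operator (varpi_sqbanach a.2 a.1) (varpi_sqbanach b.2 b.1) :=
  op_comp (theta b.2 b.1) (op_comp (fQ f) (eta a.2 a.1)).

Let fP_id (a : product_category (Qcat k) (opposite (Qcat k))) :
  fP (idm a) = op_id (varpi_sqbanach a.2 a.1).
Proof. by apply: opP => c; rewrite /fP fQ_id /= etaK. Qed.

Let fP_cmp (a b c : product_category (Qcat k) (opposite (Qcat k)))
    (g : hom b c) (f : hom a b) : fP (cmp g f) = op_comp (fP g) (fP f).
Proof. by apply: opP => w; rewrite /fP fQ_cmp /= thetaK. Qed.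

(** Operators act on Ext^varpi by transport along the isomorphism with Q, which makes the
functor laws and the naturality immediate; that this is the action by liftings is
[varpi_actionE]. *)
Definition varpi_functor : bifunctor k :=
  @Functor (product_category (Qcat k) (opposite (Qcat k))) (Qhalf k)
    (fun a => varpi_sqbanach a.2 a.1) fP fP_id fP_cmp.

Lemma Q_functor_is_Q : is_Q_functor Q_functor.
Proof.
exists (fun X Y => @Q_cls R k X Y); split=> [X Y|X X' Y Y' beta gamma].
  exact: (@quot_is_quotient_map _ _ (ql_space X Y)).
split=> [F|F F' FF']; first by exists (ql_act beta gamma F).
change (Q_act beta gamma (Q_cls F) = Q_cls F').
by rewrite Q_actE; apply: eq_Q_cls => x; rewrite FF'.
Qed.

Lemma Q_functor_is_Ext : is_Ext_functor Q_functor.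
Proof.
exists (fun X Y => @ext_cls R k X Y); split.
- exact: ext_cls_surj.
- by move=> X Y E E'; rewrite ext_equivE.
- split; first by move=> X Y E; rewrite ext_splitE.
  split=> X Y; split.
  + move=> [E1 E2]; have [E EE] := ext_cls_surj (ext_cls E1 + ext_cls E2).
    by exists E; apply/baer_sumE.
  + by move=> [E1 E2] E /baer_sumE.
  + move=> E; have [E' EE'] := ext_cls_surj (Q_act (a *: op_id Y) (op_id X) (ext_cls E)).
    by exists E'; apply/pushout_extE.
  + by move=> E E' /pushout_extE ->; rewrite Q_act_scale_id.
- move=> X Y E; rewrite -(ereal_inf1 (qnorm (ext_cls E))%:E).
  congr (ereal_inf _); rewrite predeqE => r; split=> [->|[E' /ext_equivE EE' ->]].
    by exists E; [exact/ext_equivE|rewrite ext_rhoE].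
  by rewrite ext_rhoE EE'.
- move=> X X' Y Y' beta gamma.
  have actE E E' : (exists E1 : extension X Y',
      pushout_ext beta E E1 /\ pullback_ext gamma E1 E') <->
      ext_cls E' = Q_act beta gamma (ext_cls E).
    split=> [[E1 [/pushout_extE E1E /pullback_extE ->]]|EE'].
      by rewrite E1E Q_act_comp; exact: eq_Q_act.
    have [E1 E1E] := ext_cls_surj (Q_act beta (op_id X) (ext_cls E)).
    exists E1; split; first exact/pushout_extE.
    by apply/pullback_extE; rewrite E1E Q_act_comp EE'; exact: eq_Q_act.
  split=> [E|E E' /actE ->//].
  have [E' EE'] := ext_cls_surj (Q_act beta gamma (ext_cls E)).
  by exists E'; apply/actE.
Qed.

(** A lifting V whose restriction is u' is a morphism over u' and gamma from the
presentation of X' to the push-out along beta u; by [ext_morE] it exists exactly when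
the classes of the two induced extensions of X' by Y' agree. *)
Lemma varpi_actionE (X X' Y Y' : qbanach k) (beta : operator Y Y')
    (gamma : operator X' X) (u : operator (pr_ker (P X Y)) Y)
    (u' : operator (pr_ker (P X' Y')) Y') :
  varpi_action beta gamma u u' <->
  pushout_cls (pr_ext (P X' Y')) u' =
  Q_act beta gamma (pushout_cls (pr_ext (P X Y)) u).
Proof.
have clsE (E : extension X Y') :
    ext_cls E = Q_act (op_comp beta u) (op_id X) (ext_cls (pr_ext (P X Y))) ->
    Q_act (op_id Y') gamma (ext_cls E) =
    Q_act beta gamma (pushout_cls (pr_ext (P X Y)) u).
  by move=> ->; rewrite /pushout_cls !Q_act_comp; exact: eq_Q_act.
split=> [[E [V [/pushout_extE/clsE <- VE Vu']]]|u'E].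
  by apply/ext_morE; exists V; split=> [x|f]; [rewrite Vu'|exact: VE].
have [E EE] := ext_cls_surj
  (Q_act (op_comp beta u) (op_id X) (ext_cls (pr_ext (P X Y)))).
have /ext_morE[V [Vu' VE]] : pushout_cls (pr_ext (P X' Y')) u' =
    Q_act (op_id Y') gamma (ext_cls E) by rewrite u'E clsE.
exists E, V; split=> [|f|x]; [exact/pushout_extE|exact: VE|exact/esym/Vu'].
Qed.

Lemma varpi_functor_is_varpi : is_varpi_functor P varpi_functor.
Proof.
exists (fun X Y => @varpi_cls R k X (pr_ker (P X Y)) Y (pr_ext (P X Y))).
split=> [X Y|X X' Y Y' beta gamma].
  exact: varpi_quotient_map.
have actE u : fact varpi_functor beta gamma (varpi_cls (pr_ext (P X Y)) u) =
    theta X' Y' (Q_act beta gamma (pushout_cls (pr_ext (P X Y)) u)).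
  by rewrite -eta_varpi_cls.
split=> [u|u u' /varpi_actionE uu'].
  have [u' u'E] := varpi_cls_surj (theta X' Y'
    (Q_act beta gamma (pushout_cls (pr_ext (P X Y)) u))).
  by exists u'; apply/varpi_actionE; rewrite -eta_varpi_cls u'E thetaK.
by rewrite actE -uu' -eta_varpi_cls etaK.
Qed.

Lemma Q_functor_equiv_varpi : naturally_equivalent Q_functor varpi_functor.
Proof.
exists (fun a => theta a.2 a.1); split=> [a|a b f].
  by exists (eta a.2 a.1); split; apply: opP => c /=; rewrite ?thetaK ?etaK.
by apply: opP => c /=; rewrite thetaK.
Qed.

End TheFunctors.

Theorem theorem1 (R : realType) (k : scalar_kind R)
    (P : forall X Y : qbanach k, presentation X Y) :
  exists FExt FQ FP : bifunctor k,
    [/\ is_Ext_functor FExt, is_Q_functor FQ, is_varpi_functor P FP,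
        naturally_equivalent FExt FQ & naturally_equivalent FQ FP].
Proof.
exists (Q_functor P), (Q_functor P), (varpi_functor P); split.
- exact: Q_functor_is_Ext.
- exact: Q_functor_is_Q.
- exact: varpi_functor_is_varpi.
- exists (fun a => idm (Q_functor P a)); split=> [a|a b f].
    by exists (idm (Q_functor P a)); rewrite cmp_idl.
  by rewrite cmp_idl cmp_idr.
- exact: Q_functor_equiv_varpi.
Qed.
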